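(* Suppose that $\gamma_0,\dots,\gamma_{n-1}$ are the deformed Verblunsky coefficients of an $n\times n$ unitary matrix with distinct eigenvalues $\{e^{i\lambda_k},1\le k\le n\}$, none of which is equal to $1$. Define $$\tilde A_k=\begin{pmatrix}\frac1{1-\gamma_k}&-\frac{\gamma_k}{1-\gamma_k}\\-\frac{\bar\gamma_k}{1-\bar\gamma_k}&\frac1{1-\bar\gamma_k}\end{pmatrix},\qquad b_k=\mathcal P\,\tilde A_0^{-1}\cdots\tilde A_{k-1}^{-1}\begin{pmatrix}0\\1\end{pmatrix}\ (0\le k\le n-1),$$ $$b_n=\mathcal P\,\tilde A_0^{-1}\cdots\tilde A_{n-2}^{-1}\begin{pmatrix}\gamma_{n-1}\\1\end{pmatrix},\qquad b(t)=b_{\lfloor nt\rfloor},\ t\in[0,1].$$ Then $|b(t)|<1$ for $t\in[0,1)$ and $|b(1)|=1$. The Dirac operator $$\tau g=\frac{2}{1-|b|^2}\begin{pmatrix}1+|b|^2&2b\\2\bar b&1+|b|^2\end{pmatrix}\begin{pmatrix}-i&0\\0&i\end{pmatrix}g',\qquad t\in[0,1),$$ acting on functions $g:[0,1)\to\mathbb C^2$ with initial and end conditions $(1,1)^t$ and $(b(1),1)^t$ is self-adjoint (on the domain described in the context). The spectrum of $\tau$ is the set $\{n\lambda_k+2\pi nj:\ 1\le k\le n,\ j\in\mathbb Z\}$.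
   Context: $\mathcal P(r_1,r_2)^t=r_1/r_2$. Deformed Verblunsky coefficients: let $V$ be an $n\times n$ unitary matrix with $n$ distinct eigenvalues, with $1$ not an eigenvalue, and fix a unit vector $e$ not orthogonal to any eigenvector. Gram–Schmidt applied to $e,Ve,\dots,V^{n-1}e$ gives the orthogonal basis $\Phi_0(V)e,\dots,\Phi_{n-1}(V)e$ with $\Phi_0=1$ and $\Phi_k$ monic of degree $k$; put $\Phi_n(z)=\det(z-V)$ and $\Phi_k^*(z)=z^k\overline{\Phi_k(1/\bar z)}$. The Verblunsky coefficients $\alpha_k$ are defined by the Szegő recursion $$\begin{pmatrix}\Phi_{k+1}\\\Phi_{k+1}^*\end{pmatrix}=\begin{pmatrix}1&-\bar\alpha_k\\-\alpha_k&1\end{pmatrix}\begin{pmatrix}z&0\\0&1\end{pmatrix}\begin{pmatrix}\Phi_k\\\Phi_k^*\end{pmatrix},\quad 0\le k\le n-1.$$ The deformed Verblunsky coefficients are $\gamma_k=\bar\alpha_k\frac{\Phi_k^*(1)}{\Phi_k(1)}$, $0\le k\le n-1$; $|\gamma_k|=|\alpha_k|$, which is $<1$ for $k<n-1$ and $=1$ for $k=n-1$. Hilbert space and domain: the operator $\tau$ is the conjugate $\tilde U\sigma\tilde U^{-1}$, $\tilde U=\frac1{\sqrt2}\begin{pmatrix}1&-i\\1&i\end{pmatrix}$, of the operator $\sigma v=R^{-1}Jv'$ with $J=\begin{pmatrix}0&-1\\1&0\end{pmatrix}$, $R=\frac1{2y}\begin{pmatrix}1&-x\\-x&x^2+y^2\end{pmatrix}$,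 $\frac{x+iy-i}{x+iy+i}=b$. It acts in the Hilbert space of functions $g:[0,1)\to\mathbb C^2$ with inner product $\int_0^1g^*Wh\,dt$, $W=\tilde UR\tilde U^*=\frac{1}{2(1-|b|^2)}\begin{pmatrix}1+|b|^2&-2b\\-2\bar b&1+|b|^2\end{pmatrix}$. The domain consists of the locally absolutely continuous $g$ with $g,\tau g$ in this Hilbert space, $g(0)\parallel(1,1)^t$ and $\lim_{t\to1}g(t)\parallel(b(1),1)^t$ (parallel over $\mathbb C$, the zero vector allowed). *)

(* Defs.v *)
From HB Require Import structures.
From mathcomp Require Import all_boot all_order all_algebra.
From mathcomp Require Import all_classical all_reals all_analysis.
From mathcomp Require Import complex.

Set Implicit Arguments.
Unset Strict Implicit.
Unset Printing Implicit Defensive.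

Import Order.TTheory GRing.Theory Num.Theory numFieldNormedType.Exports.

Local Open Scope classical_set_scope.
Local Open Scope ring_scope.
Local Open Scope sesquilinear_scope.

Definition mx2 (T : Type) (a b c d : T) : 'M[T]_2 :=
  \matrix_(i, j) if i == 0 then (if j == 0 then a else b)
                 else (if j == 0 then c else d).

Definition cv2 (T : Type) (a b : T) : 'cV[T]_2 :=
  \col_i if i == 0 then a else b.

Definition cexpi (R : realType) (x : R) : R[i] := (cos x +i* sin x)%C.

Section Verblunsky.
Variables (R : realType) (n : nat) (V : 'M[R[i]]_n) (e : 'cV[R[i]]_n).

Definition vdot (u v : 'cV[R[i]]_n) : R[i] := (u^t* *m v) 0 0.

(* p(V)e; horner_mx is only available for dimensions of the form n.+1. *)
Definition poly_vec (p : {poly R[i]}) : 'cV[R[i]]_n :=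
  \sum_(i < size p) p`_i *: (V ^+ i *m e).

(* [:: Phi_0; ...; Phi_(k-1)], unnormalised Gram-Schmidt applied to
   e, Ve, ..., V^(k-1)e and carried out on the polynomials p rather than on the
   vectors p(V)e. *)
Fixpoint gram_schmidt (k : nat) : seq {poly R[i]} :=
  if k is j.+1 then
    let s := gram_schmidt j in
    rcons s ('X^j - \sum_(p <- s)
      (vdot (poly_vec p) (poly_vec 'X^j) / vdot (poly_vec p) (poly_vec p)) *: p)
  else [::].

Definition opuc (k : nat) : {poly R[i]} :=
  if (k < n)%N then nth 0 (gram_schmidt k.+1) k else char_poly V.

(* The polynomial z^k conj(p(1/conj z)), for p of degree at most k. *)
Definition revpoly (k : nat) (p : {poly R[i]}) : {poly R[i]} :=
  \poly_(i < k.+1) (p`_(k - i))^*.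

Definition opuc_star (k : nat) : {poly R[i]} := revpoly k (opuc k).

Definition verblunsky (alpha : nat -> R[i]) : Prop :=
  forall k, (k < n)%N ->
    cv2 (opuc k.+1) (opuc_star k.+1) =
    mx2 1 (- ((alpha k)^*)%:P) (- (alpha k)%:P) 1
      *m mx2 'X 0 0 1 *m cv2 (opuc k) (opuc_star k).

Definition deformed_verblunsky (gamma : nat -> R[i]) : Prop :=
  exists2 alpha, verblunsky alpha &
    forall k, (k < n)%N ->
      gamma k = (alpha k)^* * (opuc_star k).[1] / (opuc k).[1].

End Verblunsky.

Section Path.
Variables (R : realType) (n : nat) (gamma : nat -> R[i]).

Definition Atilde (g : R[i]) : 'M[R[i]]_2 :=
  mx2 (1 / (1 - g)) (- (g / (1 - g)))
      (- (g^* / (1 - g^*))) (1 / (1 - g^*)).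

Definition proj_ratio (r : 'cV[R[i]]_2) : R[i] := r 0 0 / r 1 0.

Definition path_vec (k : nat) : 'cV[R[i]]_2 :=
  if (k < n)%N then (\prod_(j < k) invmx (Atilde (gamma j))) *m cv2 0 1
  else (\prod_(j < n.-1) invmx (Atilde (gamma j))) *m cv2 (gamma n.-1) 1.

Definition path_pt (k : nat) : R[i] := proj_ratio (path_vec k).

Definition path_fun (t : R) : R[i] := path_pt (Num.truncn (n%:R * t)).

End Path.

(* Functions [0,1) -> C^2 are represented by functions R -> C^2 whose values
   outside [0,1) are ignored. *)
Section Hilbert.
Variable R : realType.
Implicit Types (f g h u w : R -> 'cV[R[i]]_2) (b : R -> R[i]) (i : 'I_2).

Definition re_comp f i (t : R) : R := complex.Re (f t i 0).
Definition im_comp f i (t : R) : R := complex.Im (f t i 0).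

Definition ae_eq01 f g : Prop :=
  {ae (@lebesgue_measure R), forall t, 0 <= t < 1 -> f t = g t}.

Definition weight (c : R[i]) : 'M[R[i]]_2 :=
  (2 * (1 - `|c| ^+ 2))^-1 *:
    mx2 (1 + `|c| ^+ 2) (- (2 * c)) (- (2 * c^*)) (1 + `|c| ^+ 2).

Definition wform b g h (t : R) : R[i] :=
  ((g t)^t* *m weight (b t) *m h t) 0 0.

Definition inner b g h : R[i] :=
  ((\int[@lebesgue_measure R]_(t in `[0, 1[) complex.Re (wform b g h t)) +i*
   (\int[@lebesgue_measure R]_(t in `[0, 1[) complex.Im (wform b g h t)))%C.

Definition hnorm b f : R := Num.sqrt (complex.Re (inner b f f)).

(* Elements of the Hilbert space, as functions; equality in the Hilbert space
   is ae_eq01. *)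
Definition hilb b f : Prop :=
  (forall i, measurable_fun `[(0 : R), 1[ (re_comp f i) /\
             measurable_fun `[(0 : R), 1[ (im_comp f i)) /\
  (\int[@lebesgue_measure R]_(t in `[0%R, 1%R[)
     (complex.Re (wform b f f t))%:E < +oo)%E.

(* An operator is given by its graph T, compatible with ae_eq01. *)
Definition dense_dom b (T : (R -> 'cV[R[i]]_2) -> (R -> 'cV[R[i]]_2) -> Prop) :=
  forall f, hilb b f -> forall eps : R, 0 < eps ->
    exists g, (exists h, T g h) /\ hnorm b (fun t => f t - g t) < eps.

Definition adjoint b (T : (R -> 'cV[R[i]]_2) -> (R -> 'cV[R[i]]_2) -> Prop) u w :=
  [/\ hilb b u, hilb b w & forall g h, T g h -> inner b u h = inner b w g].

Definition self_adjoint b T : Prop :=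
  dense_dom b T /\ forall u w, adjoint b T u w <-> T u w.

Definition resolvent b T : set R[i] := [set z |
  (forall g h, T g h -> ae_eq01 h (fun t => z *: g t) ->
     ae_eq01 g (fun _ => 0)) /\
  exists M : R, forall f, hilb b f -> exists g h,
    [/\ T g h, ae_eq01 (fun t => h t - z *: g t) f
      & hnorm b g <= M * hnorm b f]].

Definition spectrum b T : set R[i] := ~` resolvent b T.

End Hilbert.

Section Dirac.
Variable R : realType.
Implicit Types (f g h : R -> 'cV[R[i]]_2) (b : R -> R[i]).

Definition abs_cont (a c : R) (F : R -> R) : Prop :=
  forall eps : R, 0 < eps -> exists2 delta : R, 0 < delta &
    forall (m : nat) (x y : 'I_m -> R),
      (forall k, a <= x k <= y k /\ y k <= c) ->
      (forall j k, j != k -> y j <= x k \/ y k <= x j) ->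
      \sum_(k < m) (y k - x k) < delta ->
      \sum_(k < m) `|F (y k) - F (x k)| < eps.

Definition loc_abs_cont f : Prop :=
  forall c : R, 0 <= c < 1 -> forall i,
    abs_cont 0 c (re_comp f i) /\ abs_cont 0 c (im_comp f i).

Definition parallel (v u : 'cV[R[i]]_2) : Prop := exists c : R[i], v = c *: u.

(* R[i] carries no topology in the library, hence the componentwise limit. *)
Definition lim_at1 f (l : 'cV[R[i]]_2) : Prop :=
  forall i, re_comp f i t @[t --> (1 : R)^'-] --> complex.Re (l i 0) /\
            im_comp f i t @[t --> (1 : R)^'-] --> complex.Im (l i 0).

(* Meaningful where f is differentiable, i.e. almost everywhere for locally
   absolutely continuous f. *)
Definition vderiv f (t : R) : 'cV[R[i]]_2 :=
  \col_i (derive1 (re_comp f i) t +i* derive1 (im_comp f i) t)%C.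

Definition tau b f (t : R) : 'cV[R[i]]_2 :=
  (2 / (1 - `|b t| ^+ 2)) *:
    (mx2 (1 + `|b t| ^+ 2) (2 * b t) (2 * (b t)^*) (1 + `|b t| ^+ 2)
       *m mx2 (- 'i) 0 0 'i *m vderiv f t).

Definition dirac_dom b (u0 u1 : 'cV[R[i]]_2) f : Prop :=
  [/\ loc_abs_cont f,
      hilb b f,
      exists2 h, hilb b h & ae_eq01 h (tau b f),
      parallel (f 0) u0
    & exists2 l, lim_at1 f l & parallel l u1].

(* Graph of tau on the Hilbert space: g is the class of some f in the domain
   and h is the class of tau f. *)
Definition dirac_op b (u0 u1 : 'cV[R[i]]_2) g h : Prop :=
  exists2 f, dirac_dom b u0 u1 f &
    [/\ hilb b g, hilb b h, ae_eq01 g f & ae_eq01 h (tau b f)].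

End Dirac.

(* Main.v *)
Require Import Defs.
From HB Require Import structures.
From mathcomp Require Import all_boot all_order all_algebra.
From mathcomp Require Import all_classical all_reals all_analysis.
From mathcomp Require Import measurable_realfun complex ring lra.

Set Implicit Arguments.
Unset Strict Implicit.
Unset Printing Implicit Defensive.

Import Order.TTheory GRing.Theory Num.Theory numFieldNormedType.Exports.

Local Open Scope classical_set_scope.
Local Open Scope ring_scope.

(* On the j-th interval the path b is constant, equal to q / p^* for an SU(1,1)
   (up to a scalar) matrix Q with first row (p, q), and there tau g = z g reads
   a' = (iz/2) a, c' = -(iz/2) c in the coordinates (a, c) = Q^-1 g.  Hence the
   solution of tau g = z g with g(0) = (1, 1) is, at the end points of the
   intervals and up to a scalar and the factor Q, given by the Szego recursion
   started at (1, 1) with spectral parameter e^(iz/n); in the normalisation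
   Phi_k(z) / Phi_k(1), Phi_k^*(z) / Phi_k^*(1) this recursion has the matrices
   Atilde_k diag(z, 1).  The condition at the end point becomes
   det(e^(iz/n) - V) = 0.
   The functional analysis only uses that b is measurable and bounded away from
   the unit circle.  Writing tau in integrated form, integration by parts gives
   symmetry, and variation of constants gives a bounded inverse of tau - z as soon
   as the solution started at (1, 1) misses the end condition; a symmetric operator
   with dense domain that is onto is self-adjoint. *)

(** * Absolutely continuous functions *)

Section AbsCont.
Variable R : realType.
Implicit Types (a b c x y : R) (F G : R -> R) (L : seq (R * R)).
Notation mu := (@lebesgue_measure R).

(** The operator is defined through the epsilon-delta notion of absolute continuity and pointwise
    derivatives, so the first obstacle is Lebesgue's theorem that such a function is the integral of
    its derivative. It is obtained from the Jordan decomposition and the Radon-Nikodym theorem for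
    Stieltjes measures. From then on a function is carried together with its density on the closed
    interval [0, 1], where the end condition is a condition on a value. Solutions are written down
    explicitly on each interval, and injectivity of tau - z off the candidate spectrum comes from
    symmetry and surjectivity at conj z; so no general theory of differential equations enters.
    Self-adjointness uses surjectivity at z = 0, where the spectral parameter is 1; this is the
    second use of 1 not being an eigenvalue, after gamma_(n-1) being different from 1. The
    deformation of the Verblunsky coefficients is the normalisation under which every Atilde_k fixes
    (1, 1), the initial vector of both the Dirac operator and the recursion. *)

Definition disjoint_itvs a b L : bool :=
  all (fun p => (a <= p.1 <= p.2) && (p.2 <= b)) L &&
  pairwise (fun p q => (p.2 <= q.1) || (q.2 <= p.1)) L.

(* The non-strict bound survives passing to suprema, i.e. to total variations. *)
Definition seq_abs_cont a b F : Prop := forall eps : R, 0 < eps ->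
  exists2 delta : R, 0 < delta & forall L, disjoint_itvs a b L ->
    \sum_(p <- L) (p.2 - p.1) < delta ->
    \sum_(p <- L) `|F p.2 - F p.1| <= eps.

Lemma abs_cont_seq a b F : abs_cont a b F -> seq_abs_cont a b F.
Proof.
move=> acF eps eps0; have [d d0 H] := acF _ eps0; exists d => // L.
move=> /andP[/allP inL /(pairwiseP (0, 0)) pwL] sL; apply/ltW.
pose x (k : 'I_(size L)) := (nth (0, 0) L k).1.
pose y (k : 'I_(size L)) := (nth (0, 0) L k).2.
have := H (size L) x y; rewrite !(big_nth (0, 0)) !big_mkord in sL *; apply => //.
- move=> k; have /andP[/andP[h1 h2] h3] := inL _ (mem_nth (0,0) (ltn_ord k)).
  by rewrite /x /y h1 h2.
- move=> j k; rewrite -val_eqE neq_ltn => /orP[] jk.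
  + by have /orP[] := pwL j k (ltn_ord _) (ltn_ord _) jk; [left|right].
  + by have /orP[] := pwL k j (ltn_ord _) (ltn_ord _) jk; [right|left].
Qed.

Definition pieces a (s : seq R) := zip (a :: s) s.

Lemma sum_pieces a s (h : R -> R -> R) :
  \sum_(p <- pieces a s) h p.1 p.2 = \sum_(p <- zip s (a :: s)) h p.2 p.1.
Proof.
rewrite /pieces; elim: s a => [|x s IH] a; first by rewrite !big_nil.
by rewrite /= !big_cons IH.
Qed.

Lemma sum_pieces_len a s : \sum_(p <- pieces a s) (p.2 - p.1) = last a s - a.
Proof.
rewrite /pieces; elim: s a => [|x s IH] a; first by rewrite big_nil subrr.
by rewrite /= big_cons IH /=; ring.
Qed.

Lemma pieces_disjoint a s : path <%R a s ->
  disjoint_itvs a (last a s) (pieces a s).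
Proof.
rewrite /disjoint_itvs /pieces; elim: s a => //= x s IH a /andP[ax pxs].
have /andP[/allP h1 h2] := IH _ pxs.
have xl : x <= last x s.
  case: (s) pxs => // z s' pz; have /allP h := order_path_min lt_trans pz.
  by apply/ltW/h => /=; exact: mem_last.
rewrite lexx (ltW ax) xl /= h2 andbT; apply/andP; split; apply/allP => p /h1.
  by move=> /andP[/andP[h ->] ->]; rewrite (le_trans (ltW ax)).
by move=> /andP[/andP[h _] _]; rewrite h.
Qed.

(** Used to replace the interval (x, y) by a partition of it. The pieces are put in front of [L2]
    because the induction in the next lemma moves intervals from the first list to the second. *)
Lemma disjoint_itvs_refine a b L1 L2 x y L : disjoint_itvs x y L ->
  disjoint_itvs a b ((x, y) :: L1 ++ L2) -> disjoint_itvs a b (L1 ++ (L ++ L2)).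
Proof.
rewrite /disjoint_itvs => /andP[/allP inL pwL] /=.
move=> /andP[/andP[/andP[/andP[ax xy] yb]]].
rewrite !all_cat => /andP[i1 i2] /andP[/andP[p1 p2]].
rewrite !pairwise_cat => /and3P[p12 q1 q2].
have inLab : all (fun p => (a <= p.1 <= p.2) && (p.2 <= b)) L.
  apply/allP => p /inL /andP[/andP[h1 h2] h3].
  by rewrite (le_trans ax)// h2 (le_trans _ yb).
rewrite i1 i2 inLab q1 q2 pwL /= andbT.
have sep K : all (fun q => (y <= q.1) || (q.2 <= x)) K ->
    allrel (fun p q => (p.2 <= q.1) || (q.2 <= p.1)) L K.
  move=> /allP HK; apply/allrelP => p q /inL /andP[/andP[h1 h2] h3] /HK /orP[h|h].
    by rewrite (le_trans h3 h).
  by rewrite (le_trans h h1) orbT.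
rewrite allrel_catr p12 andbT (sep _ p2) !andbT.
rewrite allrelC; have := sep _ p1; congr (is_true _); apply: eq_allrel => p q.
by rewrite orbC.
Qed.

(** Induction on [L1]: any partition of its head may join [L2], since this keeps the total length,
    and the supremum over these partitions is the variation on the head. *)
Lemma seq_abs_cont_total_variation a b F (eps delta : R) :
  (forall L, disjoint_itvs a b L -> \sum_(p <- L) (p.2 - p.1) < delta ->
    \sum_(p <- L) `|F p.2 - F p.1| <= eps) ->
  forall L1 L2, disjoint_itvs a b (L1 ++ L2) ->
    \sum_(p <- L1 ++ L2) (p.2 - p.1) < delta ->
    (\sum_(p <- L1) total_variation p.1 p.2 F +
     (\sum_(p <- L2) `|F p.2 - F p.1|)%:E <= eps%:E)%E.
Proof.
move=> H; elim => [|[x y] L1 IH] L2 dL sL.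
  by rewrite big_nil add0e lee_fin; exact: H.
(* Finiteness allows this sum to be moved across the inequality in the extended reals, which
   isolates the supremum over the partitions of the head. *)
have fin12 : (\sum_(p <- L1) total_variation p.1 p.2 F +
    (\sum_(p <- L2) `|F p.2 - F p.1|)%:E)%E \is a fin_num.
  rewrite ge0_fin_numE; last first.
    apply: adde_ge0; last by rewrite lee_fin sumr_ge0.
    rewrite big_seq sume_ge0 => // p pL1; apply: total_variation_ge0.
    have /andP[/allP/= h _] := dL.
    have /h/andP[/andP[]//] : p \in (x, y) :: L1 ++ L2.
    by rewrite inE mem_cat pL1 orbT.
  apply: (@le_lt_trans _ _ eps%:E); last exact: ltry.
  apply: IH.
    move: dL; rewrite /disjoint_itvs/= => /andP[/andP[_ ->]] /andP[_ ->] //.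
  apply: le_lt_trans sL; rewrite /= big_cons lerDr subr_ge0.
  by move: dL => /andP[/= /andP[/andP[/andP[]]]].
rewrite big_cons -addeA addeC -leeBrDl//.
apply: ge_ereal_sup => _ [_ [s /= ps <-] <-].
rewrite leeBrDl//.
have [pxs /eqP lxs] := ps.
rewrite variation_zip// -(sum_pieces x s (fun u v => `|F v - F u|)).
rewrite -addeA -EFinD [X in (_ + X%:E)%E]addrC -big_cat; apply: IH.
  apply: disjoint_itvs_refine dL.
  by rewrite -[X in disjoint_itvs _ X _]lxs pieces_disjoint.
move: sL; rewrite /= big_cons !big_cat/= sum_pieces_len lxs.
by rewrite addrCA.
Qed.

(** On an interval shorter than the delta for epsilon 1 the variation is at most 1, and finitely
    many steps of half that length lead from a to x. *)
Lemma acs_tv_fin a b F : seq_abs_cont a b F -> forall x, a <= x <= b ->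
  total_variation a x F \is a fin_num.
Proof.
move=> /(_ 1 ltr01)[d d0 H] x axb.
suff K : forall k y, a <= y <= b -> y - a <= (d / 2) *+ k ->
    total_variation a y F \is a fin_num.
  apply: (K (Num.bound ((x - a) / (d / 2)))) => //.
  rewrite -mulr_natr -ler_pdivrMl ?divr_gt0// mulrC; apply/ltW.
  by case/andP: axb => ax _; apply: archi_boundP; rewrite divr_ge0 ?subr_ge0// ltW// divr_gt0.
elim => [|k IH] y /andP[ay yb].
  rewrite mulr0n subr_le0 => ya; suff -> : y = a by rewrite total_variationxx.
  by apply/eqP; rewrite eq_le ya ay.
rewrite mulrSr => yk; pose z := Num.max a (y - d / 2).
have az : a <= z by rewrite le_max lexx.
have zy : z <= y by rewrite ge_max ay lerBlDr lerDl ltW// divr_gt0.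
rewrite (total_variationD F az zy) fin_numD IH/=; last 2 first.
- by rewrite az (le_trans zy).
- rewrite /z lerBlDr ge_max; apply/andP; split.
    by rewrite lerDr mulrn_wge0// ltW// divr_gt0.
  by move: yk; set u := _ *+ k => yk; lra.
have := seq_abs_cont_total_variation H (L1 := [:: (z, y)]) (L2 := [::]).
rewrite !cats0 !big_seq1 /= !big_nil adde0 => K.
rewrite ge0_fin_numE ?total_variation_ge0//; apply: le_lt_trans (ltry 1).
apply: K; first by rewrite /disjoint_itvs/= az zy yb.
rewrite ltrBlDl -ltrBlDr lt_max; apply/orP; right; lra.
Qed.

Lemma acs_tv a b F : seq_abs_cont a b F ->
  seq_abs_cont a b (fun x => fine (total_variation a x F)) /\
  {in `[a, b] &, {homo (fun x => fine (total_variation a x F)) : x y / x <= y}}.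
Proof.
move=> acF; have tvfin := acs_tv_fin acF.
have tvE x y : a <= x <= y -> y <= b -> (fine (total_variation a y F)
    - fine (total_variation a x F))%:E = total_variation x y F.
  move=> /andP[ax xy] yb.
  have fx : total_variation a x F \is a fin_num by rewrite tvfin// ax (le_trans xy).
  have fy : total_variation a y F \is a fin_num by rewrite tvfin// yb (le_trans ax).
  rewrite EFinB !fineK// (total_variationD F ax xy).
  by rewrite addeAC subee ?add0e.
split.
  move=> e e0; have [d d0 H] := acF _ e0; exists d => // L dL sL.
  have := seq_abs_cont_total_variation H (L1 := L) (L2 := [::]).
  rewrite cats0 big_nil adde0 -lee_fin -sumEFin => /(_ dL sL).
  rewrite big_seq [X in _ -> (X <= _)%E]big_seq.
  rewrite [X in _ -> (X <= _)%E](eq_bigr (fun p => total_variation p.1 p.2 F))//.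
  move=> p; have /andP[/allP h _ /h /andP[/andP[h1 h2] h3]] := dL.
  have := tvE p.1 p.2; rewrite h1 h2 => /(_ isT h3) tp; rewrite ger0_norm ?tp//.
  by rewrite -lee_fin tp; exact: total_variation_ge0.
move=> x y; rewrite !in_itv/= => /andP[ax xb] /andP[ay yb] xy.
by rewrite -subr_ge0 -lee_fin tvE ?ax// total_variation_ge0.
Qed.

Lemma acsB a b F G : seq_abs_cont a b F -> seq_abs_cont a b G -> seq_abs_cont a b (fun x => F x - G x).
Proof.
move=> aF aG e e0; have e20 : 0 < e / 2 by rewrite divr_gt0.
have [d1 d10 H1] := aF _ e20; have [d2 d20 H2] := aG _ e20.
exists (Num.min d1 d2); first by rewrite lt_min d10 d20.
move=> L dL; rewrite lt_min => /andP[s1 s2].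
rewrite [leRHS](splitr e); apply: le_trans (lerD (H1 L dL s1) (H2 L dL s2)).
rewrite -big_split/=; apply: ler_sum => p _.
rewrite (_ : F p.2 - _ - _ = (F p.2 - F p.1) - (G p.2 - G p.1)); last by ring.
exact: ler_normB.
Qed.

(** Jordan decomposition, with the variation function T and T - F. *)
Lemma abs_cont_decomp a b F : abs_cont a b F -> exists G1 G2,
  [/\ forall x, F x = G1 x - G2 x, seq_abs_cont a b G1, seq_abs_cont a b G2,
   {in `[a, b] &, {homo G1 : x y / x <= y}} &
   {in `[a, b] &, {homo G2 : x y / x <= y}}].
Proof.
move=> /abs_cont_seq acF; have [aT nT] := acs_tv acF.
pose T := fun x => fine (total_variation a x F).
exists T, (fun x => T x - F x); split => //.
- by move=> x; rewrite subKr.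
- exact: acsB.
move=> x y xab yab xy; move: (xab) (yab).
rewrite !in_itv/= => /andP[ax xb] /andP[ay yb].
rewrite -subr_ge0 (_ : _ - _ = (T y - T x) - (F y - F x)); last by ring.
rewrite subr_ge0.
apply: le_trans (ler_norm _) _; rewrite -lee_fin.
apply: le_trans (total_variation_ge F xy) _.
rewrite EFinB /T !fineK ?(acs_tv_fin acF) ?ax ?ay//.
by rewrite (total_variationD F ax xy) addeAC subee ?add0e// (acs_tv_fin acF)// ax.
Qed.
End AbsCont.

(** * Monotone absolutely continuous functions and Stieltjes measures *)

Section Primitive.
Variable R : realType.
Implicit Types (a b c x y : R) (F G : R -> R) (L : seq (R * R)).
Notation mu := (@lebesgue_measure R).

(** Nearest point of [a, b]. It extends a function by constants here, and later lets a flow run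
    during one time interval only. *)
Definition clamp a b x : R := Num.max a (Num.min x b).

Lemma clamp_itv a b x : a <= b -> a <= clamp a b x <= b.
Proof. by move=> ab; rewrite /clamp le_max lexx/= ge_max ab ge_min lexx orbT. Qed.

Lemma clamp_id a b x : a <= x <= b -> clamp a b x = x.
Proof. by move=> /andP[ax xb]; rewrite /clamp (min_idPl xb) (max_idPr ax). Qed.

Lemma le_clamp a b : {homo clamp a b : x y / x <= y}.
Proof.
move=> x y xy; rewrite /clamp ge_max le_max lexx/= le_max.
by apply/orP; right; rewrite le_min !ge_min xy lexx !orbT.
Qed.

Lemma clamp_lip a b x y : a <= b -> x <= y ->
  clamp a b y - clamp a b x <= y - x.
Proof.
by move=> ab xy; rewrite /clamp !maxEle !minEle;
  repeat case: ifPn; rewrite -?ltNge; lra.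
Qed.

Section monotone.
Variables (a b : R) (g : R -> R).
Hypotheses (ab : a <= b) (ag : seq_abs_cont a b g).
Hypothesis ng : {in `[a, b] &, {homo g : x y / x <= y}}.

Let gc x := g (clamp a b x).

Let gc_nd : nondecreasing gc.
Proof.
by move=> x y xy; apply: ng; rewrite ?in_itv/= ?clamp_itv//; exact: le_clamp.
Qed.

Let gc_rc : right_continuous gc.
Proof.
move=> x; apply/cvgrPdist_le => e e0; have [d d0 H] := ag e0.
near=> y; have xy : x <= y by near: y; exact: nbhs_right_ge.
have := H [:: (clamp a b x, clamp a b y)]; rewrite !big_seq1 distrC; apply => /=.
  by rewrite /disjoint_itvs/= le_clamp//=; have /andP[-> _] := clamp_itv x ab;
   have /andP[_ ->] := clamp_itv y ab.
apply: le_lt_trans (clamp_lip ab xy) _; rewrite ltrBlDl.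
by near: y; apply: nbhs_right_lt; rewrite ltrDl.
Unshelve. all: by end_near. Qed.

Let gC : cumulative R R := HB.pack gc (isCumulative.Build R _ R gc gc_nd gc_rc).

Let nu : {measure set (measurableTypeR R) -> \bar R} := lebesgue_stieltjes_measure gC.

Let nu_itv x y : x <= y -> nu `]x, y]%classic = (gc y - gc x)%:E.
Proof.
move=> xy; have : lebesgue_stieltjes_measure gC `]x, y]%classic = (gc y - gc x)%:E.
  rewrite /lebesgue_stieltjes_measure /measure_extension.
  by rewrite measurable_mu_extE/=; [rewrite wlength_itv_bnd|exact: is_ocitv].
by move=> <-.
Qed.

(** Two points of [I] are at most [mu I] apart, as [I] contains the segment between them; so [I] is
    bounded, and its infimum and supremum serve as end points. The infimum lies outside because [I]
    is open, hence the half-open cell, the shape on which [nu_itv] computes. *)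
Let open_itv_bnd (I : set R) : open I -> is_interval I -> (mu I < +oo)%E ->
  I !=set0 -> exists xy : R * R, [/\ xy.1 < xy.2, `]xy.1, xy.2[ `<=` I,
     I `<=` `]xy.1, xy.2] & (xy.2 - xy.1)%:E = mu I].
Proof.
move=> oI iI muI [z Iz].
have IE := (is_intervalP I).1 iI.
have bndI : forall x y, I x -> I y -> `|x - y| <= fine (mu I).
  move=> x y; wlog xy : x y / x <= y.
    by move=> W Ix Iy; have [/W|/ltW/W] := leP x y; [apply|rewrite distrC; apply].
  move=> Ix Iy; rewrite distrC ger0_norm ?subr_ge0// -lee_fin fineK; last first.
    by rewrite ge0_fin_numE.
  have <- : mu `[x, y]%classic = (y - x)%:E.
    rewrite lebesgue_measure_itv/= lte_fin; have [_|yx] := ltP x y; last first.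
      by rewrite (@le_anti _ _ x y) ?xy ?subrr.
    by rewrite -EFinB.
  apply: le_measure; rewrite ?inE; [exact: measurable_itv|exact: open_measurable|].
  by move=> w /=; rewrite in_itv/=; exact: iI.
pose l := inf I; pose r := sup I.
have lbI : has_lbound I.
  exists (z - fine (mu I)) => x Ix.
  by rewrite lerBlDr -lerBlDl; apply: le_trans (bndI _ _ Iz Ix); exact: ler_norm.
have ubI : has_ubound I.
  exists (z + fine (mu I)) => x Ix.
  by rewrite -lerBlDl; apply: le_trans (bndI _ _ Ix Iz); exact: ler_norm.
have infI : has_inf I by split => //; exists z.
have supI : has_sup I by split => //; exists z.
have lI : forall x, I x -> l <= x by move=> x Ix; exact: ge_inf.
have Ir : forall x, I x -> x <= r by move=> x Ix; exact: ub_le_sup.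
have notl : ~ I l.
  move=> Il; have /nbhs_ballP[e /= e0 eI] := oI _ Il.
  have : I (l - e / 2).
    apply: eI; rewrite /ball/= opprB addrCA subrr addr0 gtr0_norm ?divr_gt0//.
    by rewrite ltr_pdivrMr// ltr_pMr// ltr1n.
  by move/lI; rewrite lerDl oppr_ge0 leNgt divr_gt0.
have lrI : `]l, r[ `<=` I.
  move=> x; rewrite /= in_itv/= => /andP[lx xr].
  have [u Iu ux] := inf_adherent (ltac:(by rewrite subr_gt0) : 0 < x - l) infI.
  have [v Iv vx] := sup_adherent (ltac:(by rewrite subr_gt0) : 0 < r - x) supI.
  apply: (iI u v) => //; rewrite -/l -/r in ux vx.
  by apply/andP; split; lra.
have IlR : I `<=` `]l, r].
  move=> x Ix; rewrite /= in_itv/= Ir// andbT lt_neqAle lI// andbT.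
  by apply/eqP => lx; apply: notl; rewrite lx.
have lr : l < r.
  have := IlR _ Iz; rewrite /= in_itv/= => /andP[lz zr]; exact: lt_le_trans zr.
exists (l, r); split => //=; apply/eqP; rewrite eq_le; apply/andP; split.
  have <- : mu `]l, r[%classic = (r - l)%:E.
    by rewrite lebesgue_measure_itv/= lte_fin lr -EFinB.
  by apply: le_measure; rewrite ?inE; [exact: measurable_itv|exact: open_measurable|].
have <- : mu `]l, r]%classic = (r - l)%:E.
  by rewrite lebesgue_measure_itv/= lte_fin lr -EFinB.
by apply: le_measure; rewrite ?inE; [exact: open_measurable|exact: measurable_itv|].
Qed.

(** Outer regularity covers A by an open set of Lebesgue measure below the delta of absolute
    continuity. Its components, clamped to [a, b], form admissible families of intervals, so their
    [nu]-measures add up to at most epsilon. *)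
Let nu_null (A : set (measurableTypeR R)) : measurable A -> mu A = 0%E -> nu A = 0%E.
Proof.
move=> mA A0; apply/eqP; rewrite eq_le measure_ge0 andbT.
apply/lee_addgt0Pr => e e0; rewrite add0e; have [d d0 H] := ag e0.
have A0oo : (mu A < +oo)%E by rewrite A0 ltry.
have [U [oU AU Ud]] := lebesgue_regularity_outer mA A0oo d0.
have {}Ud : (mu U < d%:E)%E.
  apply: le_lt_trans Ud; rewrite -[U in leLHS](setDUK AU).
  apply: le_trans (measureU2 _ _ _) _ => //.
    by apply: measurableD => //; exact: open_measurable.
  by rewrite [X in (X + _)%E](_ : _ = 0%E) ?add0e.
apply: (@le_trans _ _ (nu U)); first by apply: le_measure; rewrite ?inE//; exact: open_measurable.
pose I := open_disjoint_itv oU.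
have oI i : open (I i) by exact: open_disjoint_itv_open.
have mI i : measurable (I i) by exact: open_measurable.
have tI : trivIset setT I by exact: open_disjoint_itv_trivIset.
have UE : U = \bigcup_i I i by exact: open_disjoint_itv_bigcup.
have IU i : I i `<=` U by move=> x Ix; rewrite UE; exists i.
have muI i : (mu (I i) < +oo)%E.
  apply: (@le_lt_trans _ _ (mu U)); last exact: lt_trans Ud (ltry _).
  by apply: le_measure; rewrite ?inE//; exact: open_measurable.
(* An empty component gets the degenerate interval at [a], which clamping preserves and which is
   disjoint, in the non-strict sense, from every clamped interval. *)
have /choice[xy xyP] : forall i, exists xy : R * R,
    [/\ xy.1 <= xy.2, (I i !=set0 -> xy.1 < xy.2) & `]xy.1, xy.2[ `<=` I i] /\
     [/\ I i `<=` `]xy.1, xy.2], (xy.2 - xy.1)%:E = mu (I i) &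
      ~ (I i !=set0) -> xy = (a, a)].
  move=> i; have [I0|I0] := pselect (I i !=set0).
    have [xy [h1 h2 h3 h4]] := open_itv_bnd (oI i) (@open_disjoint_itv_is_interval _ _ oU i) (muI i) I0.
    by exists xy; split; split => //; exact/ltW.
  exists (a, a); move/set0P/negP/negPn/eqP : I0 => ->.
  split; split => //=; first by move=> [? []].
    by rewrite set_itvoo0.
  by rewrite measure0 subrr.
pose p i := (clamp a b (xy i).1, clamp a b (xy i).2).
have nuI i : (nu (I i) <= (g (p i).2 - g (p i).1)%:E)%E.
  have [[h1 _ _] [h2 _ _]] := xyP i; rewrite -(nu_itv h1).
  apply: le_measure; rewrite ?inE; [exact: mI|exact: measurable_itv|exact: h2].
have -> : nu U = (\sum_(i <oo) nu (I i))%E.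
  have := @measure_bigcup _ _ _ nu setT I (fun i _ => mI i) tI.
  rewrite -UE => ->; apply: eq_eseriesl => i; exact: in_setT.
apply: lime_le; first exact: is_cvg_nneseries.
apply: nearW => N; apply: (@le_trans _ _ (\sum_(0 <= i < N) (g (p i).2 - g (p i).1)%:E)%E).
  by apply: lee_sum => i _.
rewrite sumEFin lee_fin; pose L := [seq p i | i <- index_iota 0 N].
have dL : disjoint_itvs a b L.
  apply/andP; split.
    apply/allP => _ /mapP[i _ ->] /=; have [[h1 _ _] _] := xyP i.
    by rewrite le_clamp//=; have /andP[-> _] := clamp_itv (xy i).1 ab;
     have /andP[_ ->] := clamp_itv (xy i).2 ab.
  rewrite pairwise_map; apply/(pairwiseP 0%N) => i j; rewrite !inE size_iota subn0.
  move=> iN jN ij; rewrite !nth_iota ?subn0// !add0n.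
  have [[i1 i2 i3] [i4 _ i5]] := xyP i.
  have [[j1 j2 j3] [j4 _ j5]] := xyP j.
  have [I0|/i5 pia] := pselect (I i !=set0); last first.
    rewrite /= /p pia/= (@clamp_id a b a) ?lexx//.
    by have /andP[-> _] := clamp_itv (xy j).1 ab.
  have [J0|/j5 pja] := pselect (I j !=set0); last first.
    rewrite /= /p pja/= (@clamp_id a b a) ?lexx//.
    by have /andP[-> _] := clamp_itv (xy i).1 ab; rewrite orbT.
  have {}i2 := i2 I0; have {}j2 := j2 J0.
  rewrite /= /p/=; have [yx|xyij] := leP (xy i).2 (xy j).1; first by rewrite le_clamp.
  have [yx|xyji] := leP (xy j).2 (xy i).1; first by rewrite orbC le_clamp.
  (* Otherwise the two open intervals share the midpoint of their intersection, against the
     disjointness of the components. *)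
  exfalso; pose lo := Num.max (xy i).1 (xy j).1.
  pose hi := Num.min (xy i).2 (xy j).2.
  have lohi : lo < hi by rewrite /lo /hi gt_max !lt_min i2 j2 xyij xyji.
  have tij := tI i j.
  have : i = j.
    have h1 : lo < (lo + hi) / 2 by lra.
    have h2 : (lo + hi) / 2 < hi by lra.
    move: h1 h2; set m := _ / 2; rewrite gt_max lt_min => /andP[l1 l2] /andP[u1 u2].
    apply: tij => //; exists m; split; [apply: i3|apply: j3].
      by rewrite /= in_itv/= l1 u1.
    by rewrite /= in_itv/= l2 u2.
  by move=> ij'; rewrite ij' ltnn in ij.
have := H L dL; rewrite !big_map/= => HL.
apply: le_trans (HL _); first by apply: ler_sum => i _; exact: ler_norm.
rewrite -lte_fin; apply: le_lt_trans Ud.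
rewrite -sumEFin; apply: (@le_trans _ _ (\sum_(0 <= i < N) mu (I i))%E).
  apply: lee_sum => i _; have [[h1 _ _] [_ <- _]] := xyP i.
  by rewrite lee_fin clamp_lip.
rewrite big_mkord -measure_bigsetU//.
apply: le_measure; rewrite ?inE; last 2 first.
- exact: open_measurable.
- by apply: (big_ind (fun X => X `<=` U)) => // X Y XU YU x [/XU|/YU].
by apply: bigsetU_measurable => i _; exact: mI.
Qed.

(* The Lebesgue-Stieltjes measure of [g], extended by constants outside [a, b], is
   dominated by the Lebesgue measure; k is its Radon-Nikodym derivative. *)
Lemma seq_abs_cont_nondecreasing_primitive : exists2 k : R -> R,
  mu.-integrable setT (EFin \o k) &
  forall t, a <= t <= b -> g t - g a = \int[mu]_(s in `[a, t]) k s.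
Proof.
have mab : measurable (`]a, b]%classic : set (measurableTypeR R)) by exact: measurable_itv.
have nuab : (nu `]a, b]%classic < +oo)%E by rewrite nu_itv// ltry.
pose nuf := mfrestr mab nuab.
have dom : nuf `<< mu.
  apply/null_content_dominatesP => A mA A0; rewrite /nuf /mfrestr /mrestr/=.
  apply/eqP; rewrite eq_le measure_ge0 andbT -(nu_null mA A0).
  by apply: le_measure; rewrite ?inE//; exact: measurableI.
have [f [f0 ff fi fE]] := radon_nikodym_sigma_finite dom.
exists (fine \o f).
  by apply: eq_integrable fi => // x _ /=; rewrite fineK.
move=> t /andP[at_ tb]; rewrite /Rintegral -integral_itv_obnd_cbnd; last first.
  apply/measurable_EFinP/measurableT_comp => //.
  apply: measurable_funTS.
  exact: measurable_int fi.
rewrite (eq_integral f); last by move=> x _ /=; rewrite fineK.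
transitivity (fine (nuf `]a, t]%classic)); last first.
  by congr fine; apply: fE; exact: measurable_itv.
rewrite /nuf /mfrestr/= /mfrestr /mrestr/= (_ : _ `&` _ = `]a, t]%classic).
  by rewrite nu_itv//= /gc !clamp_id ?lexx ?ab ?at_.
rewrite setIidl//; exact: subset_itvl.
Qed.

End monotone.
End Primitive.

(** * The fundamental theorem of calculus for absolutely continuous functions *)

Section Prim.
Variable R : realType.
Implicit Types (a b c x y t : R) (F G k l : R -> R).
Notation mu := (@lebesgue_measure R).
Notation I01 := (`[0%R, 1%R[%classic : set R).

Definition intg k : Prop := mu.-integrable I01 (EFin \o k).

(* Values of k outside [0, 1) do not matter. *)
Definition prim k t : R := \int[mu]_(s in `[0, t]) (k \_ I01) s.

Lemma aeS (P Q : R -> Prop) : (forall t, P t -> Q t) ->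
  {ae mu, forall t, P t} -> {ae mu, forall t, Q t}.
Proof. by move=> PQ; apply: (@filterS _ _ (ae_filter_ringOfSetsType mu)). Qed.

Lemma aeI (P Q : R -> Prop) : {ae mu, forall t, P t} ->
  {ae mu, forall t, Q t} -> {ae mu, forall t, P t /\ Q t}.
Proof. exact: (@filterI _ _ (ae_filter_ringOfSetsType mu)). Qed.

Lemma measurableI01 : measurable (I01 : set (measurableTypeR R)).
Proof. exact: measurable_itv. Qed.
Hint Resolve measurableI01 : core.

Lemma intg_restrict k : intg k -> mu.-integrable setT (EFin \o (k \_ I01)).
Proof. by move=> ik; rewrite -restrict_EFin; apply/integrable_restrict => //; rewrite setTI. Qed.

Lemma intg_restrictS k (A : set R) : measurable A -> intg k ->
  mu.-integrable A (EFin \o (k \_ I01)).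
Proof. by move=> mA /intg_restrict; exact: integrableS. Qed.

Lemma restrictI01 k t : 0 <= t < 1 -> (k \_ I01) t = k t.
Proof. by move=> t01; rewrite patchE mem_set// /= in_itv/=. Qed.

Lemma Rintegral_itv_split (f : R -> R) x y z : x <= y -> y <= z ->
  mu.-integrable setT (EFin \o f) ->
  \int[mu]_(s in `[x, z]) f s =
  \int[mu]_(s in `[x, y]) f s + \int[mu]_(s in `]y, z]) f s.
Proof.
move=> xy yz fi; rewrite -(@Rintegral_itvB _ f (BLeft x) (BRight z) y).
- by rewrite subrKC.
- exact: integrableS fi.
- by rewrite bnd_simp.
- by rewrite bnd_simp.
Qed.

(** Absolute continuity of the set function given by integrating |f|, applied to the union of the
    intervals. They are taken half-open, so that intervals with a common end point are disjoint
    sets. *)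
Lemma integral_abs_cont a b (f : R -> R) : mu.-integrable setT (EFin \o f) ->
  abs_cont a b (fun t => \int[mu]_(s in `[a, t]) f s).
Proof.
move=> fi e e0; have [d [d0 H]] := integral_normr_continuous fi e0.
exists d => // m x y xyab dxy sxy.
pose J (k : 'I_m) : set (measurableTypeR R) := `]x k, y k]%classic.
have mJ (k : 'I_m) : measurable (J k) by exact: measurable_itv.
have tJ : trivIset setT J.
  move=> i j _ _ [z []]; rewrite /J /= !in_itv/= => /andP[i1 i2] /andP[j1 j2].
  apply/eqP/negP => /negP /dxy[] h.
    by have := le_lt_trans (le_trans i2 h) j1; rewrite ltxx.
  by have := le_lt_trans (le_trans j2 h) i1; rewrite ltxx.
have mD : measurable (\big[setU/set0]_(i <- index_enum 'I_m) J i).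
  by apply: bigsetU_measurable.
have muJ (k : 'I_m) : mu (J k) = (y k - x k)%:E.
  have [/andP[h1 h2] h3] := xyab k.
  rewrite lebesgue_measure_itv/= lte_fin; case: ltP => [_|yx].
    by rewrite -EFinB.
  by rewrite (@le_anti _ _ (x k) (y k)) ?h2 ?subrr.
have : (mu (\big[setU/set0]_(i < m) J i) < d%:E)%E.
  by rewrite measure_semi_additive_ord// (eq_bigr _ (fun i _ => muJ i)) sumEFin lte_fin.
move=> /(H _ mD); apply: le_lt_trans.
have fiJ (k : 'I_m) : mu.-integrable (J k) (EFin \o f) by exact: integrableS fi.
rewrite -lee_fin /Rintegral fineK; last first.
  apply: integrable_fin_num => //; apply: integrableS measurableT _ _ _ => //.
  exact: integrable_norm.
rewrite integral_bigsetU_EFin//=; last 3 first.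
- exact: index_enum_uniq.
- by move=> i j _ _; apply: tJ.
- apply: measurable_funTS; apply: measurable_int.
  exact: integrable_norm fi.
rewrite -sumEFin; apply: lee_sum => i _.
have [/andP[h1 h2] h3] := xyab i.
rewrite -/(Rintegral _ _ _) -/(Rintegral _ _ _) (Rintegral_itv_split h1 h2 fi).
rewrite addrAC subrr add0r.
apply: le_trans (_ : (\int[mu]_(s in J i) `|f s|)%:E <= _)%E.
  by rewrite lee_fin; apply: le_normr_Rintegral; [exact: mJ|exact: fiJ].
rewrite fineK//; apply: integrable_fin_num => //.
by apply: integrable_norm; exact: fiJ.
Qed.

Lemma prim_abs_cont k : intg k -> abs_cont 0 1 (prim k).
Proof. by move=> ik; apply: integral_abs_cont; exact: intg_restrict. Qed.

Lemma integral_deriv (f : R -> R) : mu.-integrable setT (EFin \o f) -> forall a,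
  {ae mu, forall t, a < t ->
     derivable (fun t => \int[mu]_(s in `[a, t]) f s) t 1 /\
     derive1 (fun t => \int[mu]_(s in `[a, t]) f s) t = f t}.
Proof.
move=> fi a; have locf : locally_integrable setT f.
  by have := integrable_locally measurableT fi; rewrite patch_setT.
have fiy y : mu.-integrable [set` Interval (BLeft a) (BRight y)] (EFin \o f).
  by apply: integrableS fi.
have /= := FTC1 fiy locf.
by apply: aeS => t H at_; apply: H; rewrite lte_fin.
Qed.

Lemma prim_deriv k : intg k -> {ae mu, forall t, 0 < t < 1 ->
  derivable (prim k) t 1 /\ derive1 (prim k) t = k t}.
Proof.
move=> ik; have := integral_deriv (intg_restrict ik) 0.
apply: aeS => t H /andP[t0 t1]; have [h1 h2] := H t0; split; first exact: h1.
by rewrite [LHS]h2 restrictI01// ltW// t1.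
Qed.

(** Lebesgue's theorem; the Jordan decomposition reduces it to the monotone case. *)
Lemma abs_cont_primitive a b F : a <= b -> abs_cont a b F -> exists2 k : R -> R,
  mu.-integrable setT (EFin \o k) &
  forall t, a <= t <= b -> F t - F a = \int[mu]_(s in `[a, t]) k s.
Proof.
move=> ab /abs_cont_decomp[G1 [G2 [FG a1 a2 n1 n2]]].
have [k1 i1 k1E] := seq_abs_cont_nondecreasing_primitive ab a1 n1.
have [k2 i2 k2E] := seq_abs_cont_nondecreasing_primitive ab a2 n2.
exists (fun t => k1 t - k2 t); first exact: (integrableB measurableT i1 i2).
move=> t tab; rewrite RintegralB//; [|exact: integrableS i1|exact: integrableS i2].
by rewrite -k1E// -k2E// !FG; ring.
Qed.

(** F is the integral of some h, and Lebesgue differentiation gives F' = h almost everywhere; hence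
    h = k almost everywhere. *)
Lemma abs_cont_deriv_prim c F k : 0 <= c <= 1 -> abs_cont 0 c F -> intg k ->
  {ae mu, forall t, 0 < t < c -> derive1 F t = k t} -> F c = F 0 + prim k c.
Proof.
move=> /andP[c0 c1] acF ik Fk; have [h hi hE] := abs_cont_primitive c0 acF.
apply/eqP; rewrite addrC -subr_eq hE ?c0 ?lexx//; apply/eqP; rewrite /prim /Rintegral.
have ikc := intg_restrict ik.
rewrite -!integral_itv_obnd_cbnd; last 2 first.
- by apply: measurable_funTS; apply: measurable_int ikc.
- by apply: measurable_funTS; apply: measurable_int hi.
rewrite -!integral_itv_bndo_bndc; last 2 first.
- by apply: measurable_funTS; apply: measurable_int ikc.
- by apply: measurable_funTS; apply: measurable_int hi.
congr fine; apply: ae_eq_integral => //.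
- by apply: measurable_funTS; apply: measurable_int hi.
- by apply: measurable_funTS; apply: measurable_int ikc.
have := aeI Fk (integral_deriv hi 0); apply: aeS => t [Ht1 Ht2].
rewrite /= in_itv/= => /andP[t0 tc]; rewrite restrictI01; last first.
  by rewrite (ltW t0) (lt_le_trans tc).
rewrite -Ht1 ?t0//; have [_ <-] := Ht2 t0; congr (_%:E).
rewrite !derive1E; have : \forall s \near t, F s = F 0 + \int[mu]_(r in `[0, s]) h r.
  near=> s; rewrite -hE ?subrKC//; apply/andP; split.
    by apply/ltW; near: s; exact: lt_nbhsr.
  by apply/ltW; near: s; exact: lt_nbhsl.
move=> /near_eq_derive ->.
transitivity ('D_1 (cst (F 0) + (fun s => \int[mu]_(r in `[0, s]) h r)) t) => //.
by rewrite deriveD//; [rewrite derive_cst add0r|have [] := Ht2 t0].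
Unshelve. all: by end_near. Qed.

End Prim.

(** * Calculus of primitives of integrable functions *)

Section IsPrim.
Variable R : realType.
Implicit Types (a b c x y t : R) (F G k l : R -> R).
Notation mu := (@lebesgue_measure R).
Notation I01 := (`[0%R, 1%R[%classic : set R).
Hint Resolve measurableI01 : core.

Lemma intgD k l : intg k -> intg l -> intg (fun t => k t + l t).
Proof.
move=> ik il; apply: (eq_integrable (@measurableI01 R) _ _ _ (integrableD (@measurableI01 R) ik il)) => t _ /=.
by rewrite EFinD.
Qed.

Lemma intgZ c k : intg k -> intg (fun t => c * k t).
Proof.
move=> ik; apply: (eq_integrable (@measurableI01 R) _ _ _ (integrableZl (@measurableI01 R) c ik)) => t _ /=.
by rewrite EFinM.
Qed.

Lemma intg_measurable k : intg k -> measurable_fun I01 k.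
Proof. by move=> /integrableP[/measurable_EFinP]. Qed.

Lemma eq_intg k l : (forall t, 0 <= t < 1 -> k t = l t) -> intg k -> intg l.
Proof.
move=> kl; apply: eq_integrable => // t; rewrite inE/= in_itv/= => t01.
by rewrite /= kl.
Qed.

Lemma intgM_bounded (f k : R -> R) M : measurable_fun I01 f ->
  (forall t, 0 <= t < 1 -> `|f t| <= M) -> intg k -> intg (fun t => f t * k t).
Proof.
move=> mf fM ik; have mk := intg_measurable ik.
apply: (@le_integrable _ _ _ mu I01 _ _ (fun t => (M * `|k t|)%:E)) => //.
- by apply/measurable_EFinP; exact: measurable_funM.
- move=> t; rewrite /= in_itv/= => t01; rewrite lee_fin !normrM normr_id.
  by rewrite ler_wpM2r// (le_trans (fM _ t01))// ler_norm.
- by apply: (@intgZ M (fun t => `|k t|)); exact: (integrable_norm ik).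
Qed.

Lemma intg_bounded (f : R -> R) M : measurable_fun I01 f ->
  (forall t, 0 <= t < 1 -> `|f t| <= M) -> intg f.
Proof.
move=> mf fM; apply: (@eq_intg (fun t => f t * 1)) => [t _|].
  by rewrite mulr1.
apply: intgM_bounded mf fM _.
have muI : (mu I01 < +oo)%E by rewrite lebesgue_measure_itv/= lte01 -EFinB ltry.
apply: (measurable_bounded_integrable (@measurableI01 R) muI) => //.
by exists 1; split => // x x1 t _ /=; rewrite normr1 ltW.
Qed.

Lemma intg0 : intg (fun _ => 0 : R).
Proof. by apply: (@intg_bounded _ 0) => // t _; rewrite normr0. Qed.

Lemma prim0 k : prim k 0 = 0.
Proof. by rewrite /prim set_itv1 Rintegral_set1. Qed.

Lemma prim1 k : intg k -> prim k 1 = \int[mu]_(s in I01) k s.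
Proof.
move=> ik; rewrite /prim -Rintegral_itv_bndo_bndc; last exact: intg_restrictS.
by apply: eq_Rintegral => t; rewrite inE/= in_itv/= => t01; rewrite restrictI01.
Qed.

Lemma eq_prim k l : (forall t, 0 <= t < 1 -> k t = l t) -> prim k =1 prim l.
Proof.
move=> kl t; apply: eq_Rintegral => s _; rewrite !patchE; case: ifP => //.
by rewrite inE/= in_itv/= => /kl.
Qed.

Lemma ae_eq_prim k l : intg k -> intg l ->
  {ae mu, forall t, 0 <= t < 1 -> k t = l t} -> prim k =1 prim l.
Proof.
move=> ik il kl t; rewrite /prim /Rintegral; congr fine.
have mi : measurable (`[0, t]%classic : set (measurableTypeR R)) by exact: measurable_itv.
apply: ae_eq_integral => //.
- exact: (measurable_int _ (intg_restrictS mi ik)).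
- exact: (measurable_int _ (intg_restrictS mi il)).
apply: aeS kl => s kls _; rewrite !patchE; case: ifP => //.
by rewrite inE/= in_itv/= => /kls ->.
Qed.

Lemma primD k l t : intg k -> intg l ->
  prim (fun s => k s + l s) t = prim k t + prim l t.
Proof.
move=> ik il; rewrite /prim -RintegralD//; [|exact: intg_restrictS..].
apply: eq_Rintegral => s _; rewrite !patchE; case: ifP => //.
by rewrite /point/= addr0.
Qed.

Lemma primZ c k t : intg k -> prim (fun s => c * k s) t = c * prim k t.
Proof.
move=> ik; rewrite /prim -RintegralZl//; last exact: intg_restrictS.
apply: eq_Rintegral => s _; rewrite !patchE; case: ifP => //.
by rewrite /point/= mulr0.
Qed.

Lemma prim_bound k t : 0 <= t <= 1 -> intg k -> `|prim k t| <= \int[mu]_(s in I01) `|k s|.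
Proof.
move=> /andP[t0 t1] ik; rewrite /prim; apply: le_trans.
  by apply: le_normr_Rintegral => //; exact: intg_restrictS.
have ikn : intg (fun s => `|k s|) by exact: (integrable_norm ik).
rewrite -(prim1 ikn) /prim (@Rintegral_itv_split _ _ 0 t 1)//; last exact: intg_restrict.
rewrite (@eq_Rintegral _ _ _ mu _ ((fun s => `|k s|) \_ I01)); last first.
  by move=> s _; rewrite !patchE; case: ifP => // _; rewrite /point/= normr0.
rewrite lerDl; apply: Rintegral_ge0 => s _; rewrite patchE.
by case: ifP => // _; rewrite /point.
Qed.

Lemma abs_contD a b F G : abs_cont a b F -> abs_cont a b G ->
  abs_cont a b (fun t => F t + G t).
Proof.
move=> aF aG e e0; have e20 : 0 < e / 2 by rewrite divr_gt0.
have [d1 d10 H1] := aF _ e20; have [d2 d20 H2] := aG _ e20.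
exists (Num.min d1 d2); first by rewrite lt_min d10 d20.
move=> m x y xy dxy; rewrite lt_min => /andP[s1 s2].
rewrite [ltRHS](splitr e); apply: le_lt_trans (ltrD (H1 _ _ _ xy dxy s1) (H2 _ _ _ xy dxy s2)).
rewrite -big_split/=; apply: ler_sum => i _.
by rewrite opprD addrACA; exact: ler_normD.
Qed.

Lemma abs_contM a b F G M : 0 < M ->
  (forall t, a <= t <= b -> `|F t| <= M) -> (forall t, a <= t <= b -> `|G t| <= M) ->
  abs_cont a b F -> abs_cont a b G -> abs_cont a b (fun t => F t * G t).
Proof.
move=> M0 FM GM aF aG e e0.
have e20 : 0 < e / 2 / M by rewrite !divr_gt0.
have [d1 d10 H1] := aF _ e20; have [d2 d20 H2] := aG _ e20.
exists (Num.min d1 d2); first by rewrite lt_min d10 d20.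
move=> m x y xy dxy; rewrite lt_min => /andP[s1 s2].
have := ltrD (H1 _ _ _ xy dxy s1) (H2 _ _ _ xy dxy s2).
rewrite -mulrDl -splitr ltr_pdivlMr// -big_split/=; apply: le_lt_trans.
rewrite mulr_suml; apply: ler_sum => i _.
have [/andP[h1 h2] h3] := xy i.
have -> : F (y i) * G (y i) - F (x i) * G (x i) =
  (F (y i) - F (x i)) * G (y i) + F (x i) * (G (y i) - G (x i)) by ring.
apply: le_trans (ler_normD _ _) _; rewrite !normrM mulrDl.
apply: lerD; first by rewrite ler_wpM2l// GM// h3 (le_trans h1).
by rewrite mulrC ler_wpM2l// FM// h1 (le_trans h2).
Qed.

Lemma abs_cont_cst a b c : abs_cont a b (fun _ => c).
Proof.
move=> e e0; exists 1 => // m x y _ _ _.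
by rewrite big1// => i _; rewrite subrr normr0.
Qed.

Lemma abs_cont_lip a b F L : 
  (forall x y, a <= x -> x <= y -> y <= b -> `|F y - F x| <= L * (y - x)) ->
  abs_cont a b F.
Proof.
move=> H e e0; exists (e / (`|L| + 1)).
  by rewrite divr_gt0// ltr_wpDl.
move=> m x y xy _; rewrite ltr_pdivlMr ?ltr_wpDl// mulrC; apply: le_lt_trans.
rewrite mulr_sumr; apply: ler_sum => i _; have [/andP[h1 h2] h3] := xy i.
apply: le_trans (H _ _ h1 h2 h3) _; rewrite ler_wpM2r ?subr_ge0//.
by rewrite (le_trans (ler_norm _))// lerDl.
Qed.

Lemma abs_contS a b c F : c <= b -> abs_cont a b F -> abs_cont a c F.
Proof.
move=> cb aF e e0; have [d d0 H] := aF _ e0; exists d => // m x y xy.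
by apply: H => i; have [h1 h2] := xy i; rewrite (le_trans h2).
Qed.

Lemma eq_abs_cont a b F G : (forall t, a <= t <= b -> F t = G t) ->
  abs_cont a b F -> abs_cont a b G.
Proof.
move=> FG aF e e0; have [d d0 H] := aF _ e0; exists d => // m x y xy dxy s.
have := H m x y xy dxy s; congr (_ < _); apply: eq_bigr => i _.
have [/andP[h1 h2] h3] := xy i.
by rewrite !FG// ?h1 ?h3 ?andbT/= ?(le_trans h1)// (le_trans h2).
Qed.

Lemma abs_cont_within a b F : abs_cont a b F -> {within `[a, b], continuous F}.
Proof.
move=> aF; apply/subspace_continuousP => x; rewrite /= in_itv/= => /andP[ax xb].
apply/cvgrPdist_lt => e e0; have [d d0 H] := aF _ e0.
rewrite near_withinE; near=> y; rewrite /= in_itv/= => /andP[ay yb].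
have : `|x - y| < d by near: y; exact: nbhsx_ballx.
have := H 1%N (fun _ => Num.min x y) (fun _ => Num.max x y).
rewrite !big_ord1; have [xy|/ltW yx] := leP x y => K dxy.
  rewrite distrC; apply: K; last by rewrite distrC ger0_norm ?subr_ge0// in dxy.
  - by rewrite ax xy yb.
  - by move=> i j; rewrite !ord1 eqxx.
apply: K; last by rewrite ger0_norm ?subr_ge0// in dxy.
- by rewrite ay yx xb.
- by move=> i j; rewrite !ord1 eqxx.
Unshelve. all: by end_near. Qed.

(** The range of t includes 1, where [k] is not evaluated: [F 1] is the limit at the end point and
    will carry the end condition. *)
Definition is_prim F k : Prop :=
  intg k /\ forall t, 0 <= t <= 1 -> F t = F 0 + prim k t.

Lemma is_prim_prim k c : intg k -> is_prim (fun t => c + prim k t) k.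
Proof. by move=> ik; split => // t _; rewrite prim0 addr0. Qed.

Lemma is_prim_ac F k : is_prim F k -> abs_cont 0 1 F.
Proof.
move=> [ik FE]; apply: (@eq_abs_cont _ _ (fun t => F 0 + prim k t)).
  by move=> t /FE.
by apply: abs_contD; [exact: abs_cont_cst|exact: prim_abs_cont].
Qed.

Lemma is_prim_bound F k : is_prim F k ->
  exists2 M, 0 < M & forall t, 0 <= t <= 1 -> `|F t| <= M.
Proof.
move=> [ik FE]; exists (`|F 0| + \int[mu]_(s in I01) `|k s| + 1).
  by rewrite ltr_wpDl// addr_ge0//; apply: Rintegral_ge0.
move=> t t01; rewrite FE//; apply: le_trans (ler_normD _ _) _.
by rewrite -addrA lerD2l ler_wpDr//; exact: prim_bound.
Qed.

Lemma is_prim_within F k : is_prim F k -> {within `[0, 1], continuous F}.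
Proof. by move=> /is_prim_ac/abs_cont_within. Qed.

Lemma is_prim_measurable F k : is_prim F k -> measurable_fun I01 F.
Proof.
move=> /is_prim_within cF.
have mI : measurable (`[0, 1]%classic : set (measurableTypeR R)).
  exact: measurable_itv.
have := subspace_continuous_measurable_fun mI cF.
by apply: measurable_funS => //; apply: subset_itvl; rewrite bnd_simp.
Qed.

Lemma is_prim_cvg1 F k : is_prim F k -> F t @[t --> 1^'-] --> F 1.
Proof. by move=> /is_prim_within /(continuous_within_itvP _ ltr01)[]. Qed.

Lemma is_prim_deriv F k : is_prim F k ->
  {ae mu, forall t, 0 < t < 1 -> is_derive t 1 F (k t)}.
Proof.
move=> [ik FE]; have := prim_deriv ik; apply: aeS => t H t01.
have [h1 h2] := H t01; have /andP[t0 t1] := t01.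
have E : \forall s \near t, (cst (F 0) + prim k) s = F s.
  near=> s; rewrite [RHS]FE//; apply/andP; split.
    by apply/ltW; near: s; exact: lt_nbhsr.
  by apply/ltW; near: s; exact: lt_nbhsl.
have dk : is_derive t 1 (prim k) (k t) by apply: DeriveDef => //; rewrite -derive1E.
apply: near_eq_is_derive E _; rewrite -[k t]add0r.
exact: (@is_deriveD _ _ _ _ _ _ _ _ _ (is_derive_cst _ _ _) dk).
Unshelve. all: by end_near. Qed.

(** Integration by parts: the product is absolutely continuous, and the product rule holds at almost
    every point. *)
Lemma is_primM F G k l : is_prim F k -> is_prim G l ->
  is_prim (fun t => F t * G t) (fun t => k t * G t + F t * l t).
Proof.
move=> pF pG; have [ik FE] := pF; have [il GE] := pG.
have [M M0 FM] := is_prim_bound pF; have [N N0 GN] := is_prim_bound pG.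
have W t : 0 <= t < 1 -> 0 <= t <= 1 by move=> /andP[-> /ltW].
have ikl : intg (fun t => k t * G t + F t * l t).
  apply: intgD.
    apply: (@eq_intg (fun t => G t * k t)) => [t _|]; first exact: mulrC.
    by apply: (@intgM_bounded _ _ N) => //; [exact: is_prim_measurable pG|move=> t /W/GN].
  by apply: (@intgM_bounded _ _ M) => //; [exact: is_prim_measurable pF|move=> t /W/FM].
split => // t /andP[t0 t1].
have acM : abs_cont 0 1 (fun t => F t * G t).
  apply: (@abs_contM _ _ _ _ (Num.max M N)).
  - by rewrite lt_max M0.
  - by move=> s s01; rewrite le_max FM.
  - by move=> s s01; rewrite le_max GN ?orbT.
  - exact: is_prim_ac pF.
  - exact: is_prim_ac pG.
apply: (@abs_cont_deriv_prim _ t (fun t => F t * G t)) => //; first by rewrite t0 t1.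
  exact: abs_contS acM.
have := aeI (is_prim_deriv pF) (is_prim_deriv pG); apply: aeS => s [HF HG].
move=> /andP[s0 st]; have s01 : 0 < s < 1 by rewrite s0 (lt_le_trans st).
have dF := HF s01; have dG := HG s01.
rewrite derive1E; transitivity ('D_1 (F * G) s); first by [].
by rewrite derive_val /GRing.scale/=; ring.
Qed.

Lemma is_primD F G k l : is_prim F k -> is_prim G l ->
  is_prim (fun t => F t + G t) (fun t => k t + l t).
Proof.
move=> [ik FE] [il GE]; split; first exact: intgD.
by move=> t t01; rewrite primD// FE// GE//; ring.
Qed.

Lemma is_primZ c F k : is_prim F k -> is_prim (fun t => c * F t) (fun t => c * k t).
Proof.
move=> [ik FE]; split; first exact: intgZ.
by move=> t t01; rewrite primZ// FE// mulrDr.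
Qed.

Lemma is_prim_cst c : is_prim (fun _ => c) (fun _ => 0).
Proof.
split; first exact: intg0.
move=> t _; rewrite /prim (@eq_Rintegral _ _ _ mu _ (cst 0)) ?Rintegral_cst ?mul0r ?addr0//.
by move=> s _; rewrite patchE /=; case: ifP.
Qed.

Lemma eq_is_prim F G k l : (forall t, 0 <= t <= 1 -> F t = G t) ->
  (forall t, 0 <= t < 1 -> k t = l t) -> is_prim F k -> is_prim G l.
Proof.
move=> FG kl [ik FE]; split; first exact: eq_intg ik.
by move=> t t01; rewrite -FG// FE// FG ?lexx ?ler01// (eq_prim kl).
Qed.

End IsPrim.

(** * Square-integrable complex functions and their primitives *)

Section L2.
Variable R : realType.
Implicit Types (x y k l : R -> R) (f g h : R -> R[i]).
Notation mu := (@lebesgue_measure R).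
Notation I01 := (`[0%R, 1%R[%classic : set R).
Notation C := R[i].
Local Notation Re := (@complex.Re R).
Local Notation Im := (@complex.Im R).

Lemma le_intg k l : measurable_fun I01 k ->
  (forall t, 0 <= t < 1 -> `|k t| <= l t) -> intg l -> intg k.
Proof.
move=> mk kl il; apply: (@le_integrable _ _ _ mu I01 (@measurableI01 R) _ (EFin \o l)) => //.
  exact/measurable_EFinP.
by move=> t; rewrite /= in_itv/= lee_fin => /kl h; apply: le_trans h (ler_norm _).
Qed.

Definition L2 x := measurable_fun I01 x /\ intg (fun t => x t ^+ 2).

Lemma eq_L2 x y : (forall t, 0 <= t < 1 -> x t = y t) -> L2 x -> L2 y.
Proof.
move=> xy [mx ix]; split; last by apply: eq_intg ix => t /xy ->.
apply: eq_measurable_fun mx => t; rewrite inE/= in_itv/=; exact: xy.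
Qed.

Lemma L2D x y : L2 x -> L2 y -> L2 (fun t => x t + y t).
Proof.
move=> [mx ix] [my iy]; have m : measurable_fun I01 (fun t => x t + y t).
  exact: measurable_funD.
split => //; apply: (@le_intg _ (fun t => 2 * (x t ^+ 2 + y t ^+ 2))).
- exact: measurable_funX.
- move=> t _; rewrite ger0_norm ?sqr_ge0//.
  by have := sqr_ge0 (x t - y t); nra.
- by apply: intgZ; exact: intgD.
Qed.

Definition bounded_mfun x := measurable_fun I01 x /\
  exists M, forall t, 0 <= t < 1 -> `|x t| <= M.

Lemma bounded_mfunD x y : bounded_mfun x -> bounded_mfun y -> bounded_mfun (fun t => x t + y t).
Proof.
move=> [mx [M xM]] [my [N yN]]; split; first exact: measurable_funD.
exists (M + N) => t t01; apply: le_trans (ler_normD _ _) _.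
by rewrite lerD ?xM ?yN.
Qed.

Lemma bounded_mfunM x y : bounded_mfun x -> bounded_mfun y -> bounded_mfun (fun t => x t * y t).
Proof.
move=> [mx [M xM]] [my [N yN]]; split; first exact: measurable_funM.
by exists (M * N) => t t01; rewrite normrM ler_pM ?xM ?yN.
Qed.

Lemma bounded_mfun_cst c : bounded_mfun (fun _ => c : R).
Proof. by split => //; exists `|c|. Qed.

Lemma bounded_mfun_prim F k : is_prim F k -> bounded_mfun F.
Proof.
move=> pF; split; first exact: is_prim_measurable pF.
have [M _ FM] := is_prim_bound pF; exists M => t /andP[t0 t1].
by rewrite FM// t0 ltW.
Qed.

Lemma bounded_mfun_L2 x : bounded_mfun x -> L2 x.
Proof.
move=> bx; have [m [M xM]] := bounded_mfunM bx bx; split; first by case: bx.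
exact: intg_bounded m xM.
Qed.

Lemma L2M x y : bounded_mfun x -> L2 y -> L2 (fun t => x t * y t).
Proof.
move=> bx [my iy]; split; first by apply: measurable_funM => //; case: bx.
have [m [M xM]] := bounded_mfunM bx bx.
apply: (@eq_intg _ (fun t => (x t * x t) * y t ^+ 2)) => [t _|]; first by ring.
exact: intgM_bounded m xM iy.
Qed.

Lemma L2_intgM x y : L2 x -> L2 y -> intg (fun t => x t * y t).
Proof.
move=> [mx ix] [my iy]; apply: (@le_intg _ (fun t => x t ^+ 2 + y t ^+ 2)).
- exact: measurable_funM.
- move=> t _; rewrite ler_norml; apply/andP; split.
    by have := sqr_ge0 (x t + y t); have := sqr_ge0 (x t); have := sqr_ge0 (y t); nra.
  by have := sqr_ge0 (x t - y t); have := sqr_ge0 (x t); have := sqr_ge0 (y t); nra.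
- exact: intgD.
Qed.

Lemma L2_intg x : L2 x -> intg x.
Proof.
move=> Lx; apply: (@eq_intg _ (fun t => x t * 1)) => [t _|]; first by rewrite mulr1.
by apply: L2_intgM => //; apply: bounded_mfun_L2; exact: bounded_mfun_cst.
Qed.

End L2.

Section ComplexFun.
Variable R : realType.
Implicit Types (x y : R -> R) (f g h k l : R -> R[i]).
Notation mu := (@lebesgue_measure R).
Notation I01 := (`[0%R, 1%R[%classic : set R).
Notation C := R[i].
Local Notation Re := (@complex.Re R).
Local Notation Im := (@complex.Im R).

Definition cL2 f := L2 (Re \o f) /\ L2 (Im \o f).
Definition cbm f := bounded_mfun (Re \o f) /\ bounded_mfun (Im \o f).
Definition cintg f := intg (Re \o f) /\ intg (Im \o f).
Definition cprim f k := is_prim (Re \o f) (Re \o k) /\ is_prim (Im \o f) (Im \o k).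
Definition cint f : C :=
  ((\int[mu]_(t in I01) Re (f t)) +i* (\int[mu]_(t in I01) Im (f t)))%C.

Lemma cReM (a b : C) : Re (a * b) = Re a * Re b - Im a * Im b.
Proof. by case: a; case: b. Qed.
Lemma cImM (a b : C) : Im (a * b) = Re a * Im b + Im a * Re b.
Proof. by case: a; case: b. Qed.
Lemma cReD (a b : C) : Re (a + b) = Re a + Re b.
Proof. by case: a; case: b. Qed.
Lemma cImD (a b : C) : Im (a + b) = Im a + Im b.
Proof. by case: a; case: b. Qed.
Lemma cReN (a : C) : Re (- a) = - Re a.
Proof. by case: a. Qed.
Lemma cImN (a : C) : Im (- a) = - Im a.
Proof. by case: a. Qed.
Lemma cReJ (a : C) : Re (a^*) = Re a.
Proof. by case: a. Qed.
Lemma cImJ (a : C) : Im (a^*) = - Im a.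
Proof. by case: a. Qed.

Definition cE := (cReM, cImM, cReD, cImD, cReN, cImN, cReJ, cImJ).

Lemma ceq (a b : C) : Re a = Re b -> Im a = Im b -> a = b.
Proof. by case: a; case: b => ? ? ? ? /= -> ->. Qed.

Lemma eq_cL2 f g : (forall t, 0 <= t < 1 -> f t = g t) -> cL2 f -> cL2 g.
Proof. by move=> fg [f1 f2]; split; [apply: eq_L2 f1|apply: eq_L2 f2] => t /fg /= ->. Qed.
Lemma eq_cintg f g : (forall t, 0 <= t < 1 -> f t = g t) -> cintg f -> cintg g.
Proof. by move=> fg [f1 f2]; split; [apply: eq_intg f1|apply: eq_intg f2] => t /fg /= ->. Qed.

Lemma cL2D f g : cL2 f -> cL2 g -> cL2 (fun t => f t + g t).
Proof.
by move=> [f1 f2] [g1 g2]; split;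
  [apply: eq_L2 (L2D f1 g1)|apply: eq_L2 (L2D f2 g2)] => t _ /=; rewrite cE.
Qed.

Lemma cbmD f g : cbm f -> cbm g -> cbm (fun t => f t + g t).
Proof.
move=> [f1 f2] [g1 g2]; split.
  rewrite (_ : _ \o _ = (fun t => Re (f t) + Re (g t))); first exact: bounded_mfunD.
  by apply/funext => t /=; rewrite cE.
rewrite (_ : _ \o _ = (fun t => Im (f t) + Im (g t))); first exact: bounded_mfunD.
by apply/funext => t /=; rewrite cE.
Qed.

Lemma bounded_mfunN x : bounded_mfun x -> bounded_mfun (fun t => - x t).
Proof.
move=> bx; rewrite (_ : (fun t => _) = (fun t => -1 * x t)).
  by apply: bounded_mfunM => //; exact: bounded_mfun_cst.
by apply/funext => t; rewrite mulN1r.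
Qed.

Lemma cbmM f g : cbm f -> cbm g -> cbm (fun t => f t * g t).
Proof.
move=> [f1 f2] [g1 g2]; split.
  rewrite (_ : _ \o _ = (fun t => Re (f t) * Re (g t) + - (Im (f t) * Im (g t)))).
    by apply: bounded_mfunD; [exact: bounded_mfunM|apply: bounded_mfunN; exact: bounded_mfunM].
  by apply/funext => t /=; rewrite cE.
rewrite (_ : _ \o _ = (fun t => Re (f t) * Im (g t) + (Im (f t) * Re (g t)))).
  by apply: bounded_mfunD; exact: bounded_mfunM.
by apply/funext => t /=; rewrite cE.
Qed.

Lemma cbmJ f : cbm f -> cbm (fun t => (f t)^*).
Proof.
move=> [f1 f2]; split.
  by rewrite (_ : _ \o _ = (fun t => Re (f t)))//; apply/funext => t /=; rewrite cE.
rewrite (_ : _ \o _ = (fun t => - (Im (f t)))); first exact: bounded_mfunN.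
by apply/funext => t /=; rewrite cE.
Qed.

Lemma cbm_cst c : cbm (fun _ => c).
Proof. by split; exact: bounded_mfun_cst. Qed.

Lemma cbm_L2 f : cbm f -> cL2 f.
Proof. by move=> [? ?]; split; exact: bounded_mfun_L2. Qed.

Lemma cprim_cbm f k : cprim f k -> cbm f.
Proof. by move=> [p1 p2]; split; [exact: bounded_mfun_prim p1|exact: bounded_mfun_prim p2]. Qed.

Lemma L2N x : L2 x -> L2 (fun t => - x t).
Proof.
move=> Lx; apply: (@eq_L2 _ (fun t => -1 * x t)) => [t _|]; first by rewrite mulN1r.
by apply: L2M => //; exact: bounded_mfun_cst.
Qed.

Lemma cL2M f g : cbm f -> cL2 g -> cL2 (fun t => f t * g t).
Proof.
move=> [f1 f2] [g1 g2]; split.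
  apply: (@eq_L2 _ (fun t => Re (f t) * Re (g t) + - (Im (f t) * Im (g t)))) => [t _ /=|].
    by rewrite cE.
  by apply: L2D; [exact: L2M|apply: L2N; exact: L2M].
apply: (@eq_L2 _ (fun t => Re (f t) * Im (g t) + (Im (f t) * Re (g t)))) => [t _ /=|].
  by rewrite cE.
by apply: L2D; exact: L2M.
Qed.

Lemma cL2Z c f : cL2 f -> cL2 (fun t => c * f t).
Proof. by apply: cL2M; exact: cbm_cst. Qed.

Lemma cL2B f g : cL2 f -> cL2 g -> cL2 (fun t => f t - g t).
Proof.
move=> Lf Lg; apply: cL2D => //.
by apply: eq_cL2 (cL2Z (-1) Lg) => t _; rewrite mulN1r.
Qed.

Lemma cL2J f : cL2 f -> cL2 (fun t => (f t)^*).
Proof.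
move=> [f1 f2]; split; first by apply: eq_L2 f1 => t _ /=; rewrite cE.
by apply: eq_L2 (L2N f2) => t _ /=; rewrite cE.
Qed.

Lemma cintgD f g : cintg f -> cintg g -> cintg (fun t => f t + g t).
Proof.
by move=> [f1 f2] [g1 g2]; split;
  [apply: eq_intg (intgD f1 g1)|apply: eq_intg (intgD f2 g2)] => t _ /=; rewrite cE.
Qed.

Lemma intgN x : intg x -> intg (fun t => - x t).
Proof.
move=> ix; apply: (@eq_intg _ (fun t => -1 * x t)) => [t _|]; first by rewrite mulN1r.
exact: intgZ.
Qed.

Lemma cintgM f g : cL2 f -> cL2 g -> cintg (fun t => f t * g t).
Proof.
move=> [f1 f2] [g1 g2]; split.
  apply: (@eq_intg _ (fun t => Re (f t) * Re (g t) + - (Im (f t) * Im (g t)))) => [t _ /=|].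
    by rewrite cE.
  by apply: intgD; [exact: L2_intgM|apply: intgN; exact: L2_intgM].
apply: (@eq_intg _ (fun t => Re (f t) * Im (g t) + (Im (f t) * Re (g t)))) => [t _ /=|].
  by rewrite cE.
by apply: intgD; exact: L2_intgM.
Qed.

Lemma cL2_cintg f : cL2 f -> cintg f.
Proof. by move=> [? ?]; split; exact: L2_intg. Qed.

Lemma cintgZ c f : cintg f -> cintg (fun t => c * f t).
Proof.
move=> [f1 f2]; split.
  apply: (@eq_intg _ (fun t => Re c * Re (f t) + (- Im c) * Im (f t))) => [t _ /=|].
    by rewrite cE mulNr.
  by apply: intgD; exact: intgZ.
apply: (@eq_intg _ (fun t => Re c * Im (f t) + Im c * Re (f t))) => [t _ /=|].
  by rewrite cE.
by apply: intgD; exact: intgZ.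
Qed.

Lemma cintD f g : cintg f -> cintg g -> cint (fun t => f t + g t) = cint f + cint g.
Proof.
move=> [f1 f2] [g1 g2]; rewrite /cint; apply: ceq => /=.
  rewrite -RintegralD//; first by apply: eq_Rintegral => t _; rewrite cE.
rewrite -RintegralD//; by apply: eq_Rintegral => t _; rewrite cE.
Qed.

Lemma cintZ c f : cintg f -> cint (fun t => c * f t) = c * cint f.
Proof.
move=> [f1 f2]; rewrite /cint; apply: ceq; rewrite /= cE/=.
  rewrite -!RintegralZl// -RintegralB//.
  - by apply: eq_Rintegral => t _; rewrite cE.
  - exact: (intgZ (Re c) f1).
  - exact: (intgZ (Im c) f2).
rewrite -!RintegralZl// -RintegralD//.
- by apply: eq_Rintegral => t _; rewrite cE.
- exact: (intgZ (Re c) f2).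
- exact: (intgZ (Im c) f1).
Qed.

Lemma cintJ f : cintg f -> cint (fun t => (f t)^*) = (cint f)^*.
Proof.
move=> [f1 f2]; rewrite /cint; apply: ceq; rewrite /= ?cE/=.
  by apply: eq_Rintegral => t _; rewrite cE.
rewrite -[RHS]mulN1r -RintegralZl//.
by apply: eq_Rintegral => t _; rewrite cE mulN1r.
Qed.

Lemma eq_cint f g : (forall t, 0 <= t < 1 -> f t = g t) -> cint f = cint g.
Proof.
by move=> fg; apply: ceq => /=; apply: eq_Rintegral => t;
  rewrite inE/= in_itv/= => /fg ->.
Qed.

Lemma cprim_cst c : cprim (fun _ => c) (fun _ => 0).
Proof. by split; exact: is_prim_cst. Qed.

Lemma eq_cprim f g k l : (forall t, 0 <= t <= 1 -> f t = g t) ->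
  (forall t, 0 <= t < 1 -> k t = l t) -> cprim f k -> cprim g l.
Proof.
by move=> fg kl [p1 p2]; split; [apply: eq_is_prim p1|apply: eq_is_prim p2];
  move=> t; [move=> /fg|move=> /kl|move=> /fg|move=> /kl] => /= ->.
Qed.

Lemma cprimD f g k l : cprim f k -> cprim g l ->
  cprim (fun t => f t + g t) (fun t => k t + l t).
Proof.
move=> [f1 f2] [g1 g2]; split.
  by apply: eq_is_prim (is_primD f1 g1) => t _ /=; rewrite cE.
by apply: eq_is_prim (is_primD f2 g2) => t _ /=; rewrite cE.
Qed.

Lemma cprimM f g k l : cprim f k -> cprim g l ->
  cprim (fun t => f t * g t) (fun t => k t * g t + f t * l t).
Proof.
move=> [f1 f2] [g1 g2]; split.
  apply: eq_is_prim (is_primD (is_primM f1 g1) (is_primZ (-1) (is_primM f2 g2))).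
    by move=> t _ /=; rewrite cE; ring.
  by move=> t _ /=; rewrite !cE; ring.
apply: eq_is_prim (is_primD (is_primM f1 g2) (is_primM f2 g1)).
  by move=> t _ /=; rewrite cE; ring.
by move=> t _ /=; rewrite !cE; ring.
Qed.

Lemma cprimZ c f k : cprim f k -> cprim (fun t => c * f t) (fun t => c * k t).
Proof.
move=> pf; apply: eq_cprim (cprimM (cprim_cst c) pf) => // t _.
by rewrite mul0r add0r.
Qed.

Lemma cprimJ f k : cprim f k -> cprim (fun t => (f t)^*) (fun t => (k t)^*).
Proof.
move=> [f1 f2]; split; first by apply: eq_is_prim f1 => t _ /=; rewrite cE.
by apply: eq_is_prim (is_primZ (-1) f2) => t _ /=; rewrite cE mulN1r.
Qed.

Lemma cprim_exists k c : cintg k -> exists2 f, f 0 = c & cprim f k.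
Proof.
move=> [k1 k2].
exists (fun t => ((Re c + prim (Re \o k) t) +i* (Im c + prim (Im \o k) t))%C).
  by rewrite !prim0 !addr0; apply: ceq.
by split; exact: is_prim_prim.
Qed.

Lemma cprim_cint f k : cprim f k -> f 1 = f 0 + cint k.
Proof.
move=> [[i1 E1] [i2 E2]]; apply: ceq; rewrite cE/=.
  by rewrite [LHS]E1 ?ler01 ?lexx//= prim1.
by rewrite [LHS]E2 ?ler01 ?lexx//= prim1.
Qed.

Lemma cprim_unique f g k : cprim f k -> cprim g k -> f 0 = g 0 ->
  forall t, 0 <= t <= 1 -> f t = g t.
Proof.
move=> [[_ f1] [_ f2]] [[_ g1] [_ g2]] fg t t01.
by apply: ceq; [rewrite [LHS]f1// [RHS]g1|rewrite [LHS]f2// [RHS]g2] => //=; rewrite fg.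
Qed.

End ComplexFun.

(** * The weighted Hilbert space *)

Lemma ord2P (P : 'I_2 -> Prop) : P 0 -> P 1 -> forall i, P i.
Proof.
by move=> P0 P1 [[|[|//]] ?]; [move: P0|move: P1]; congr P; exact/val_inj.
Qed.

Lemma cv2_eq (T : Type) (u v : 'cV[T]_2) : u 0 0 = v 0 0 -> u 1 0 = v 1 0 -> u = v.
Proof. by move=> h0 h1; apply/matrixP; apply: ord2P => j; rewrite (ord1 j). Qed.

Lemma cv20 (T : Type) (x y : T) : cv2 x y 0 0 = x.
Proof. by rewrite mxE. Qed.
Lemma cv21 (T : Type) (x y : T) : cv2 x y 1 0 = y.
Proof. by rewrite mxE. Qed.
Definition cv2E := (cv20, cv21).

Lemma lift01 : lift ord0 ord0 = 1 :> 'I_2.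
Proof. exact/val_inj. Qed.

Lemma ord00 n : ord0 = 0 :> 'I_n.+1.
Proof. exact/val_inj. Qed.

Section Weight.
Variable R : realType.
Notation C := R[i].
Notation mu := (@lebesgue_measure R).
Notation I01 := (`[0%R, 1%R[%classic : set R).
Local Notation Re := (@complex.Re R).
Local Notation Im := (@complex.Im R).
Implicit Types (c x y : C).

(** The norm on [R[i]] takes its values in [R[i]]; this squared modulus is real, so it can be
    integrated and estimated. *)
Definition nrm2 c : R := Re c ^+ 2 + Im c ^+ 2.

Lemma nrm2_ge0 c : 0 <= nrm2 c.
Proof. by rewrite addr_ge0 ?sqr_ge0. Qed.

Lemma nrm2E c : `|c| ^+ 2 = (nrm2 c)%:C%C.
Proof. by rewrite -add_Re2_Im2. Qed.

Lemma mul_conjE c : c * c^* = (nrm2 c)%:C%C.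
Proof. by rewrite -nrm2E normCK. Qed.

Lemma nrm2M c x : nrm2 (c * x) = nrm2 c * nrm2 x.
Proof. by rewrite /nrm2 !cE; ring. Qed.

Lemma nrm2J c : nrm2 (c^*) = nrm2 c.
Proof. by rewrite /nrm2 !cE; ring. Qed.

Lemma nrm2_eq0 c : (nrm2 c == 0) = (c == 0).
Proof. by rewrite paddr_eq0 ?sqr_ge0// !sqrf_eq0 eq_complex. Qed.

Lemma nrm2B_le c x : nrm2 (c - x) <= 2 * (nrm2 c + nrm2 x).
Proof.
rewrite /nrm2 !cE; have := sqr_ge0 (Re c + Re x); have := sqr_ge0 (Im c + Im x).
by nra.
Qed.

(* The components of [weight c *m cv2 x y]. *)
Definition W0 c x y : C := (2 * (1 - `|c| ^+ 2))^-1 * ((1 + `|c| ^+ 2) * x - 2 * c * y).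
Definition W1 c x y : C := (2 * (1 - `|c| ^+ 2))^-1 * ((1 + `|c| ^+ 2) * y - 2 * c^* * x).

Lemma wformE (b : R -> C) (g h : R -> 'cV[C]_2) t :
  wform b g h t = (g t 0 0)^* * W0 (b t) (h t 0 0) (h t 1 0)
    + (g t 1 0)^* * W1 (b t) (h t 0 0) (h t 1 0).
Proof.
rewrite /wform !mxE !big_ord_recl big_ord0 !mxE !big_ord_recl !big_ord0 !mxE /=.
rewrite lift01 ord00 /W0 /W1.
by ring.
Qed.

Lemma wform_herm (b : R -> C) (g h : R -> 'cV[C]_2) t :
  wform b g h t = (wform b h g t)^*.
Proof.
rewrite !wformE /W0 /W1 !nrm2E; set d := (2 * _)^-1; set r := (nrm2 _)%:C%C.
have rJ : r^* = r by rewrite /r -mul_conjE rmorphM/= conjCK mulrC.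
have dJ : d^* = d.
  by rewrite /d fmorphV rmorphM rmorphB rmorph1 rmorph_nat /= rJ.
rewrite !(rmorphD, rmorphM, rmorphN, rmorph1, rmorph_nat) /= !conjCK rJ dJ.
by ring.
Qed.

(** The sum of squares makes the positivity of the weight for |b| < 1 visible and yields both bounds
    below. *)
Lemma wform_diag (b : R -> C) (f : R -> 'cV[C]_2) t :
  Re (wform b f f t) =
  (nrm2 (f t 0 0 - b t * f t 1 0) + nrm2 ((b t)^* * f t 0 0 - f t 1 0))
    / (2 * (1 - nrm2 (b t))).
Proof.
have CE (x y z : R) : ((x + y) / (2 * (1 - z)))%:C%C =
    (x%:C%C + y%:C%C) / (2 * (1 - z%:C%C)) :> C.
  by rewrite !(rmorphM, rmorphD, fmorphV, rmorphB, rmorphN, rmorph1, rmorph_nat).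
rewrite -[RHS]/(Re (_%:C%C)); congr Re.
rewrite CE wformE /W0 /W1 nrm2E; set d := (2 * _)^-1.
rewrite -!mul_conjE !(rmorphD, rmorphN, rmorphM)/= !conjCK.
by ring.
Qed.

(** The two squared terms u and v determine f: (1 - |b|^2) f has the components u - b v and (conj b)
    u - v. The bound degenerates only as |b| tends to 1. *)
Lemma wform_diag_ge (b : R -> C) (f : R -> 'cV[C]_2) (rho : R) t :
  nrm2 (b t) <= rho -> rho < 1 ->
  (1 - rho) / 8 * (nrm2 (f t 0 0) + nrm2 (f t 1 0)) <= Re (wform b f f t).
Proof.
move=> br r1; have b0 := nrm2_ge0 (b t); rewrite wform_diag.
set u := f t 0 0 - b t * f t 1 0; set v := (b t)^* * f t 0 0 - f t 1 0.
set r := nrm2 (b t) in br b0 *.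
have rJ : r = nrm2 (b t)^* by rewrite nrm2J.
have E0 : (1 - (b t) * (b t)^*) * f t 0 0 = u - b t * v by rewrite /u /v; ring.
have E1 : (1 - (b t) * (b t)^*) * f t 1 0 = (b t)^* * u - v by rewrite /u /v; ring.
have nE : nrm2 (1 - (b t) * (b t)^*) = (1 - r) ^+ 2.
  rewrite mul_conjE -/r -[1](rmorph1 (real_complex R)) -rmorphB /nrm2 /=.
  by rewrite expr0n addr0.
have H0 : (1 - r) ^+ 2 * nrm2 (f t 0 0) <= 2 * (nrm2 u + r * nrm2 v).
  by rewrite -nE -nrm2M E0 /r -nrm2M; exact: nrm2B_le.
have H1 : (1 - r) ^+ 2 * nrm2 (f t 1 0) <= 2 * (r * nrm2 u + nrm2 v).
  by rewrite -nE -nrm2M E1 rJ -nrm2M; exact: nrm2B_le.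
have u0 := nrm2_ge0 u; have v0 := nrm2_ge0 v.
have f0 := nrm2_ge0 (f t 0 0); have f1 := nrm2_ge0 (f t 1 0).
set n0 := nrm2 (f t 0 0) in H0 f0 *; set n1 := nrm2 (f t 1 0) in H1 f1 *.
have r01 : 0 < 1 - r by lra.
rewrite ler_pdivlMr; last by lra.
apply: (@le_trans _ _ ((1 - r) ^+ 2 * (n0 + n1) / 4)); last by nra.
have -> : (1 - rho) / 8 * (n0 + n1) * (2 * (1 - r)) = ((1 - rho) * (1 - r)) * (n0 + n1) / 4 by field.
apply: ler_wpM2r; first by rewrite invr_ge0.
apply: ler_wpM2r; first by rewrite addr_ge0.
by rewrite expr2; apply: ler_wpM2r; [exact: ltW|lra].
Qed.

Lemma wform_diag_ge0 (b : R -> C) (f : R -> 'cV[C]_2) t : nrm2 (b t) < 1 ->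
  0 <= Re (wform b f f t).
Proof.
move=> b1; apply: le_trans (wform_diag_ge f (lexx _) b1).
apply: mulr_ge0; last by rewrite addr_ge0 ?nrm2_ge0.
by apply: divr_ge0 => //; rewrite subr_ge0 ltW.
Qed.

Lemma wform_diag_le (b : R -> C) (f : R -> 'cV[C]_2) (rho : R) t :
  nrm2 (b t) <= rho -> rho < 1 ->
  Re (wform b f f t) <= 2 / (1 - rho) * (nrm2 (f t 0 0) + nrm2 (f t 1 0)).
Proof.
move=> br r1; have b0 := nrm2_ge0 (b t); rewrite wform_diag.
set u := f t 0 0 - b t * f t 1 0; set v := (b t)^* * f t 0 0 - f t 1 0.
set r := nrm2 (b t) in br b0 *.
have rJ : r = nrm2 (b t)^* by rewrite nrm2J.
have f0 := nrm2_ge0 (f t 0 0); have f1 := nrm2_ge0 (f t 1 0).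
have Hu : nrm2 u <= 2 * (nrm2 (f t 0 0) + r * nrm2 (f t 1 0)).
  by rewrite /r -nrm2M; exact: nrm2B_le.
have Hv : nrm2 v <= 2 * (r * nrm2 (f t 0 0) + nrm2 (f t 1 0)).
  by rewrite rJ -nrm2M; exact: nrm2B_le.
set n0 := nrm2 (f t 0 0) in Hu Hv f0 *; set n1 := nrm2 (f t 1 0) in Hu Hv f1 *.
have r01 : 0 < 1 - r by lra.
have rho1 : 0 < 1 - rho by lra.
rewrite ler_pdivrMr; last by lra.
apply: (@le_trans _ _ (4 * (n0 + n1))); first by nra.
have -> : 2 / (1 - rho) * (n0 + n1) * (2 * (1 - r)) = 4 * (n0 + n1) * ((1 - r) / (1 - rho)).
  by field; rewrite gt_eqF.
rewrite ler_peMr//; first by rewrite mulr_ge0// addr_ge0.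
by rewrite ler_pdivlMr// mul1r; lra.
Qed.

(** [tau] is the inverse of [weight] times diag(-i, i) times the derivative, so solving for the
    derivative gives diag(i, -i) times [weight] times h. These coefficients stay bounded when |b|
    stays away from 1. *)
Lemma tau_inv (b : R -> C) (f : R -> 'cV[C]_2) (h : 'cV[C]_2) t : nrm2 (b t) < 1 ->
  (h = tau b f t <->
    vderiv f t 0 0 = 'i * W0 (b t) (h 0 0) (h 1 0) /\
    vderiv f t 1 0 = - 'i * W1 (b t) (h 0 0) (h 1 0)).
Proof.
move=> b1; have nz : 1 - (b t) * (b t)^* != 0.
  by rewrite mul_conjE -[1](rmorph1 (real_complex R)) -rmorphB fmorph_eq0 subr_eq0 gt_eqF.
have ii : 'i * 'i = -1 :> C by rewrite -expr2 sqrCi.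
have tauE : (tau b f t 0 0 = 2 / (1 - b t * (b t)^*) *
      (- 'i * ((1 + b t * (b t)^*) * vderiv f t 0 0 - 2 * b t * vderiv f t 1 0))) *
   (tau b f t 1 0 = 2 / (1 - b t * (b t)^*) *
      (- 'i * (2 * (b t)^* * vderiv f t 0 0 - (1 + b t * (b t)^*) * vderiv f t 1 0))).
  rewrite /tau; set v := vderiv f t; rewrite !normCK.
  split; rewrite !mxE !big_ord_recl big_ord0 !mxE !big_ord_recl !big_ord0 !mxE /=;
    by rewrite lift01 ord00; ring.
(* [field] treats i as an atom, so each use of i^2 = -1 is prepared by inserting this factor 1. *)
have iN : 'i * - 'i = 1 :> C by rewrite mulrN ii opprK.
set v0 := vderiv f t 0 0 in tauE *; set v1 := vderiv f t 1 0 in tauE *.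
rewrite /W0 /W1 !normCK; split=> [->|[v0E v1E]].
  rewrite !tauE; split.
    by rewrite -[LHS]mul1r -{1}iN; field.
  by rewrite -[LHS]mul1r -{1}iN; field.
apply: cv2_eq; rewrite tauE v0E v1E.
  by rewrite -[LHS]mul1r -{1}iN; field.
by rewrite -[LHS]mul1r -{1}iN; field.
Qed.

End Weight.

Section Hilb.
Variable R : realType.
Notation C := R[i].
Notation mu := (@lebesgue_measure R).
Notation I01 := (`[0%R, 1%R[%classic : set R).
Local Notation Re := (@complex.Re R).
Local Notation Im := (@complex.Im R).
Implicit Types (f g h u w : R -> 'cV[C]_2).

Variables (b : R -> C) (rho : R).
Hypotheses (mb : forall phi : C -> R, measurable_fun I01 (phi \o b)).
Hypotheses (rho1 : rho < 1) (b_rho : forall t, 0 <= t < 1 -> nrm2 (b t) <= rho).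

Let b_lt1 t : 0 <= t < 1 -> nrm2 (b t) < 1.
Proof. by move=> /b_rho h; exact: le_lt_trans rho1. Qed.

Lemma ge0_intgP (k : R -> R) : measurable_fun I01 k ->
  (forall t, 0 <= t < 1 -> 0 <= k t) ->
  intg k <-> (\int[mu]_(t in I01) (k t)%:E < +oo)%E.
Proof.
move=> mk k0; have E : (\int[mu]_(t in I01) `|(EFin \o k) t| = \int[mu]_(t in I01) (k t)%:E)%E.
  apply: eq_integral => t; rewrite inE/= in_itv/= => /k0 kt0.
  by rewrite ger0_norm.
split=> [/integrableP[_]|]; first by rewrite E.
by move=> h; apply/integrableP; split; [exact/measurable_EFinP|rewrite E].
Qed.

Let cm (x : R -> C) := measurable_fun I01 (Re \o x) /\ measurable_fun I01 (Im \o x).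

Let cmD x y : cm x -> cm y -> cm (fun t => x t + y t).
Proof.
move=> [x1 x2] [y1 y2]; split.
  rewrite (_ : _ \o _ = (fun t => Re (x t) + Re (y t))); first exact: measurable_funD.
  by apply/funext => t /=; rewrite cE.
rewrite (_ : _ \o _ = (fun t => Im (x t) + Im (y t))); first exact: measurable_funD.
by apply/funext => t /=; rewrite cE.
Qed.

Let cmM x y : cm x -> cm y -> cm (fun t => x t * y t).
Proof.
move=> [x1 x2] [y1 y2]; split.
  rewrite (_ : _ \o _ = (fun t => Re (x t) * Re (y t) - Im (x t) * Im (y t))).
    by apply: measurable_funB; exact: measurable_funM.
  by apply/funext => t /=; rewrite cE.
rewrite (_ : _ \o _ = (fun t => Re (x t) * Im (y t) + Im (x t) * Re (y t))).
  by apply: measurable_funD; exact: measurable_funM.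
by apply/funext => t /=; rewrite cE.
Qed.

Let cbm_cm x : cbm x -> cm x.
Proof. by move=> [[? _] [? _]]. Qed.

Let cmJ x : cm x -> cm (fun t => (x t)^*).
Proof.
move=> [x1 x2]; split.
  by rewrite (_ : _ \o _ = (fun t => Re (x t)))//; apply/funext => t /=; rewrite cE.
rewrite (_ : _ \o _ = (fun t => - (Im (x t)))); first exact: measurableT_comp.
by apply/funext => t /=; rewrite cE.
Qed.

Definition cpt f (i : 'I_2) t : C := f t i 0.

Definition vL2 f := cL2 (cpt f 0) /\ cL2 (cpt f 1).

Lemma b_cbm : cbm b.
Proof.
have M x y : x ^+ 2 + y ^+ 2 <= rho -> `|x| <= 1.
  move=> xy; rewrite -(@ler_pXn2r _ 2)// ?nnegrE// expr1n real_normK ?num_real//.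
  apply: le_trans (ltW rho1); apply: le_trans xy; rewrite lerDl; exact: sqr_ge0.
split; split; try exact: mb; exists 1 => t /b_rho; rewrite /nrm2.
  exact: M.
by rewrite addrC; exact: M.
Qed.

Lemma d_cbm : cbm (fun t => (2 * (1 - `|b t| ^+ 2))^-1).
Proof.
have dE t : (2 * (1 - `|b t| ^+ 2))^-1 = ((2 * (1 - nrm2 (b t)))^-1)%:C%C :> C.
  by rewrite nrm2E !(rmorphM, fmorphV, rmorphB, rmorphN, rmorph1, rmorph_nat).
split; last first.
  by rewrite (_ : _ \o _ = (fun _ => 0)); [exact: bounded_mfun_cst|apply/funext => t; rewrite /comp dE].
rewrite (_ : _ \o _ = (fun t => (2 * (1 - nrm2 (b t)))^-1)); last first.
  by apply/funext => t; rewrite /comp dE.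
split; last first.
  exists ((2 * (1 - rho))^-1) => t t01; have h1 := b_rho t01; have h2 := b_lt1 t01.
  rewrite ger0_norm ?invr_ge0 ?mulr_ge0// ?subr_ge0 ?(ltW h2)//.
  by rewrite lef_pV2 ?posrE ?mulr_gt0 ?subr_gt0// ler_pM2l// lerB.
exact: (mb (fun c => (2 * (1 - nrm2 c))^-1)).
Qed.

Lemma b2_cbm : cbm (fun t => `|b t| ^+ 2).
Proof.
rewrite (_ : (fun t => _) = (fun t => b t * (b t)^*)).
  by have cb := b_cbm; apply: cbmM => //; exact: cbmJ.
by apply/funext => t; rewrite normCK.
Qed.

Lemma W0_L2 x y : cL2 x -> cL2 y -> cL2 (fun t => W0 (b t) (x t) (y t)).
Proof.
have cb := b_cbm; have cd := d_cbm; have cb2 := b2_cbm.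
move=> Lx Ly; apply: cL2M => //; apply: cL2B.
  by apply: cL2M => //; apply: cbmD => //; exact: cbm_cst.
by apply: cL2M => //; apply: cbmM => //; exact: cbm_cst.
Qed.

Lemma W1_L2 x y : cL2 x -> cL2 y -> cL2 (fun t => W1 (b t) (x t) (y t)).
Proof.
have cb := b_cbm; have cd := d_cbm; have cb2 := b2_cbm.
move=> Lx Ly; apply: cL2M => //; apply: cL2B.
  by apply: cL2M => //; apply: cbmD => //; exact: cbm_cst.
by apply: cL2M => //; apply: cbmM; [exact: cbm_cst|exact: cbmJ].
Qed.

Lemma wform_cintg g h : vL2 g -> vL2 h -> cintg (wform b g h).
Proof.
move=> [g0 g1] [h0 h1].
apply: (@eq_cintg _ (fun t => (cpt g 0 t)^* * W0 (b t) (cpt h 0 t) (cpt h 1 t)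
    + (cpt g 1 t)^* * W1 (b t) (cpt h 0 t) (cpt h 1 t))) => [t _|].
  by rewrite wformE.
by apply: cintgD; apply: cintgM; rewrite ?cL2J//; [exact: cL2J|exact: W0_L2|exact: cL2J|exact: W1_L2].
Qed.

Let wform_measurable f : cm (cpt f 0) -> cm (cpt f 1) ->
  measurable_fun I01 (Re \o wform b f f).
Proof.
move=> c0 c1.
have -> : wform b f f = (fun t => (cpt f 0 t)^* *
    ((2 * (1 - `|b t| ^+ 2))^-1 * ((1 + `|b t| ^+ 2) * cpt f 0 t + (- 2 * b t) * cpt f 1 t))
  + (cpt f 1 t)^* *
    ((2 * (1 - `|b t| ^+ 2))^-1 * ((1 + `|b t| ^+ 2) * cpt f 1 t + (- 2 * (b t)^*) * cpt f 0 t))).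
  by apply/funext => t; rewrite wformE /W0 /W1 !mulNr.
have cst2 c : cm (fun _ => c) by apply: cbm_cm; exact: cbm_cst.
have cb := cbm_cm b_cbm; have cd := cbm_cm d_cbm; have cb2 := cbm_cm b2_cbm.
have [m _] : cm (fun t => (cpt f 0 t)^* *
    ((2 * (1 - `|b t| ^+ 2))^-1 * ((1 + `|b t| ^+ 2) * cpt f 0 t + (- 2 * b t) * cpt f 1 t))
  + (cpt f 1 t)^* *
    ((2 * (1 - `|b t| ^+ 2))^-1 * ((1 + `|b t| ^+ 2) * cpt f 1 t + (- 2 * (b t)^*) * cpt f 0 t))).
  apply: cmD.
    apply: cmM; first exact: cmJ.
    apply: cmM => //; apply: cmD; first by apply: cmM => //; exact: cmD.
    by apply: cmM => //; exact: cmM.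
  apply: cmM; first exact: cmJ.
  apply: cmM => //; apply: cmD; first by apply: cmM => //; exact: cmD.
  by apply: cmM => //; apply: cmM => //; exact: cmJ.
exact: m.
Qed.

(** Since |b|^2 is at most rho < 1, the weighted norm is equivalent to the unweighted one. *)
Lemma hilbP f : hilb b f <-> vL2 f.
Proof.
split=> [[mf fi]|fL].
  have c0 : cm (cpt f 0) by exact: (mf 0).
  have c1 : cm (cpt f 1) by exact: (mf 1).
  have iw : intg (Re \o wform b f f).
    apply/(ge0_intgP (wform_measurable c0 c1)) => // t /b_lt1 h.
    exact: wform_diag_ge0.
  have i8 := intgZ ((8 / (1 - rho))) iw.
  have dom t : 0 <= t < 1 ->
     nrm2 (f t 0 0) + nrm2 (f t 1 0) <= 8 / (1 - rho) * Re (wform b f f t).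
    move=> /b_rho h; have := wform_diag_ge f h rho1.
    have r0 : 0 < 1 - rho by rewrite subr_gt0.
    set q := _ + _ => hq; rewrite mulrAC ler_pdivlMr//.
    by move: hq; rewrite mulrAC ler_pdivrMr//; lra.
  have K (x : R -> R) : measurable_fun I01 x -> (forall t, 0 <= t < 1 ->
      x t ^+ 2 <= nrm2 (f t 0 0) + nrm2 (f t 1 0)) -> L2 x.
    move=> mx xq; split => //; apply: le_intg i8; first exact: measurable_funX.
    by move=> t t01; rewrite ger0_norm ?sqr_ge0//; apply: le_trans (dom _ t01); exact: xq.
  case: c0 c1 => [r0 i0] [r1 i1].
  split; split; apply: K => // t _; rewrite /nrm2 /= /cpt;
    have := sqr_ge0 (Re (f t 0 0)); have := sqr_ge0 (Im (f t 0 0));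
    have := sqr_ge0 (Re (f t 1 0)); have := sqr_ge0 (Im (f t 1 0)); lra.
have [iw _] := wform_cintg fL fL.
case: (fL) => [[[m1 _] [m2 _]] [[m3 _] [m4 _]]].
split; first by apply: ord2P.
apply/(ge0_intgP _) => //; first exact: intg_measurable iw.
by move=> t /b_lt1 h; exact: wform_diag_ge0.
Qed.

End Hilb.

(** * The Dirac operator *)

Section AE.
Variable R : realType.
Notation C := R[i].
Notation mu := (@lebesgue_measure R).
Notation I01 := (`[0%R, 1%R[%classic : set R).

Lemma ae_neq (a : R) : {ae mu, forall t, t != a}.
Proof.
have ma : measurable ([set a] : set (measurableTypeR R)) by exact: measurable_set1.
exists [set a]; split => //; first exact: lebesgue_measure_set1.
by move=> t /=; have [->//|_] := eqVneq t a; case.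
Qed.

Lemma aeW01 (P : R -> Prop) : {ae mu, forall t, 0 < t < 1 -> P t} ->
  {ae mu, forall t, 0 <= t < 1 -> P t}.
Proof.
move=> H; have := aeI H (ae_neq 0); apply: aeS => t [Ht t0] /andP[t0' t1].
by apply: Ht; rewrite lt_neqAle eq_sym t0 t0' t1.
Qed.

Lemma ae01_absurd (P : R -> Prop) : {ae mu, forall t, 0 <= t < 1 -> ~ P t} ->
  {ae mu, forall t, 0 <= t < 1 -> P t} -> False.
Proof.
move=> h1 h2; have [N [mN N0 sN]] := aeI h1 h2.
have : (mu I01 <= mu N)%E.
  apply: le_measure; rewrite ?inE//.
  move=> t; rewrite /= in_itv/= => t01; apply: sN => /= -[k1 k2].
  exact: k1 t01 (k2 t01).
rewrite N0 lebesgue_measure_itv/= lte01 -EFinB lee_fin subr0.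
by rewrite leNgt ltr01.
Qed.

Lemma ae_eq_cint (f g : R -> C) : cintg f -> cintg g ->
  {ae mu, forall t, 0 <= t < 1 -> f t = g t} -> cint f = cint g.
Proof.
move=> [f1 f2] [g1 g2] fg; apply: ceq; rewrite /cint/= -!prim1//.
  by apply: ae_eq_prim => //; apply: aeS fg => t H /H /= ->.
by apply: ae_eq_prim => //; apply: aeS fg => t H /H /= ->.
Qed.

Lemma abs_cont_prim (F k : R -> R) : (forall c, 0 <= c < 1 -> abs_cont 0 c F) ->
  intg k -> {ae mu, forall t, 0 <= t < 1 -> derive1 F t = k t} ->
  forall t, 0 <= t < 1 -> F t = F 0 + prim k t.
Proof.
move=> acF ik Fk t /andP[t0 t1]; apply: abs_cont_deriv_prim => //.
- by rewrite t0 ltW.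
- by apply: acF; rewrite t0 t1.
- by apply: aeS Fk => s H /andP[s0 st]; apply: H; rewrite ltW//= (lt_trans st).
Qed.

End AE.

Section Inner.
Variable R : realType.
Notation C := R[i].
Notation mu := (@lebesgue_measure R).
Notation I01 := (`[0%R, 1%R[%classic : set R).
Local Notation Re := (@complex.Re R).
Local Notation Im := (@complex.Im R).
Implicit Types (f g h u w : R -> 'cV[C]_2).

Variables (b : R -> C) (rho : R).
Hypotheses (mb : forall phi : C -> R, measurable_fun I01 (phi \o b)).
Hypotheses (rho1 : rho < 1) (b_rho : forall t, 0 <= t < 1 -> nrm2 (b t) <= rho).

Let b_lt1 t : 0 <= t < 1 -> nrm2 (b t) < 1.
Proof. by move=> /b_rho h; exact: le_lt_trans rho1. Qed.

Lemma vL2B f g : vL2 f -> vL2 g -> vL2 (fun t => f t - g t).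
Proof.
move=> [f0 f1] [g0 g1]; split; [apply: eq_cL2 (cL2B f0 g0)|apply: eq_cL2 (cL2B f1 g1)];
  by move=> t _; rewrite /cpt !mxE.
Qed.

Lemma vL2Z c f : vL2 f -> vL2 (fun t => c *: f t).
Proof.
move=> [f0 f1]; split; [apply: eq_cL2 (cL2Z c f0)|apply: eq_cL2 (cL2Z c f1)];
  by move=> t _; rewrite /cpt !mxE.
Qed.

Lemma vL2D f g : vL2 f -> vL2 g -> vL2 (fun t => f t + g t).
Proof.
move=> [f0 f1] [g0 g1]; split; [apply: eq_cL2 (cL2D f0 g0)|apply: eq_cL2 (cL2D f1 g1)];
  by move=> t _; rewrite /cpt !mxE.
Qed.

Lemma wformBr f g h t : wform b f (fun t => g t - h t) t = wform b f g t - wform b f h t.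
Proof. by rewrite /wform mulmxBr !mxE. Qed.

Lemma wformZr c f g t : wform b f (fun t => c *: g t) t = c * wform b f g t.
Proof. by rewrite /wform -scalemxAr mxE. Qed.

Lemma innerE f g : inner b f g = cint (wform b f g).
Proof. by []. Qed.

Lemma inner_herm f g : vL2 f -> vL2 g -> inner b f g = (inner b g f)^*.
Proof.
move=> Lf Lg; rewrite !innerE -cintJ; last exact: (wform_cintg mb rho1 b_rho).
by apply: eq_cint => t _; rewrite wform_herm.
Qed.

Lemma innerBr f g h : vL2 f -> vL2 g -> vL2 h ->
  inner b f (fun t => g t - h t) = inner b f g - inner b f h.
Proof.
move=> Lf Lg Lh; have ig := wform_cintg mb rho1 b_rho Lf Lg.
have ih := wform_cintg mb rho1 b_rho Lf Lh.
rewrite !innerE -[in RHS](mulN1r (cint (wform b f h))) -cintZ// -cintD//.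
  by apply: eq_cint => t _; rewrite wformBr mulN1r.
exact: cintgZ.
Qed.

Lemma innerZr c f g : vL2 f -> vL2 g -> inner b f (fun t => c *: g t) = c * inner b f g.
Proof.
move=> Lf Lg; rewrite !innerE -cintZ; last exact: (wform_cintg mb rho1 b_rho).
by apply: eq_cint => t _; rewrite wformZr.
Qed.

Lemma innerBl f g h : vL2 f -> vL2 g -> vL2 h ->
  inner b (fun t => g t - h t) f = inner b g f - inner b h f.
Proof.
move=> Lf Lg Lh; rewrite inner_herm//; last exact: vL2B.
by rewrite innerBr// rmorphB/= -!inner_herm.
Qed.

Lemma innerZl c f g : vL2 f -> vL2 g -> inner b (fun t => c *: g t) f = c^* * inner b g f.
Proof.
move=> Lf Lg; rewrite inner_herm//; last exact: vL2Z.
by rewrite innerZr// rmorphM/= -!inner_herm.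
Qed.

Lemma inner_aer f g h : vL2 f -> vL2 g -> vL2 h -> ae_eq01 g h ->
  inner b f g = inner b f h.
Proof.
move=> Lf Lg Lh gh; rewrite !innerE; apply: ae_eq_cint.
- exact: (wform_cintg mb rho1 b_rho).
- exact: (wform_cintg mb rho1 b_rho).
by apply: aeS gh => t H /H; rewrite /wform => ->.
Qed.

Lemma inner_ael f g h : vL2 f -> vL2 g -> vL2 h -> ae_eq01 g h ->
  inner b g f = inner b h f.
Proof.
by move=> Lf Lg Lh gh; rewrite inner_herm// (inner_aer Lf Lg Lh gh) -inner_herm.
Qed.

Lemma inner_diag_eq0 f : vL2 f -> inner b f f = 0 -> ae_eq01 f (fun _ => 0).
Proof.
move=> Lf /(congr1 Re) /= f0.
have [iw _] := wform_cintg mb rho1 b_rho Lf Lf.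
have mw : measurable_fun I01 (EFin \o (Re \o wform b f f)).
  by move/integrableP : iw => [].
have w0 t : 0 <= t < 1 -> 0 <= Re (wform b f f t).
  by move=> /b_lt1; exact: wform_diag_ge0.
have : (\int[mu]_(t in I01) `|(EFin \o (Re \o wform b f f)) t| = 0)%E.
  transitivity (\int[mu]_(t in I01) (Re (wform b f f t))%:E)%E.
    apply: eq_integral => t; rewrite inE/= in_itv/= => /w0 h.
    by rewrite ger0_norm.
  rewrite -[LHS]fineK; last exact: integrable_fin_num.
  by congr (_%:E).
move/(ae_eq_integral_abs mu (@measurableI01 R) mw) => ae0.
apply: aeS ae0 => t H t01; have {}H : Re (wform b f f t) = 0.
  by have := H _; rewrite /= in_itv/= t01 => /(_ isT) [].
have := wform_diag_ge f (b_rho t01) rho1; rewrite H.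
have r0 : 0 < (1 - rho) / 8 by rewrite divr_gt0// subr_gt0.
rewrite pmulr_rle0// => q0.
have n0 := nrm2_ge0 (f t 0 0); have n1 := nrm2_ge0 (f t 1 0).
by apply: cv2_eq; rewrite mxE; apply/eqP; rewrite -nrm2_eq0 eq_le ?n0 ?n1 andbT; lra.
Qed.

Definition vec (x y : R -> C) (t : R) : 'cV[C]_2 := cv2 (x t) (y t).

Lemma vec0 x y t : vec x y t 0 0 = x t. Proof. exact: cv20. Qed.
Lemma vec1 x y t : vec x y t 1 0 = y t. Proof. exact: cv21. Qed.

Variable b1 : C.

(* tau g = h together with the boundary conditions, for g = (x, y), in integrated form. *)
Definition dirac_integral (x y : R -> C) h : Prop :=
  [/\ cprim x (fun t => 'i * W0 (b t) (h t 0 0) (h t 1 0)),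
      cprim y (fun t => - 'i * W1 (b t) (h t 0 0) (h t 1 0)),
      x 0 = y 0 & x 1 = b1 * y 1].

(** For locally absolutely continuous f the equation tau f = h fixes the derivative almost
    everywhere as a square-integrable function. It is integrable up to 1, so f extends to a
    primitive on [0, 1] and its limit is a value. Conversely, a primitive is absolutely continuous
    with the prescribed derivative almost everywhere. *)
Lemma dirac_opP g h : dirac_op b (cv2 1 1) (cv2 b1 1) g h <->
  [/\ vL2 g, vL2 h & exists x y, dirac_integral x y h /\ ae_eq01 g (vec x y)].
Proof.
have hP := hilbP mb rho1 b_rho.
split=> [[f [fac fL [k kL kE] [c0 f0E] [l fl [c1 lE]]] [/hP gL /hP hL gf hE]]|].
  split => //.
  have fder : {ae mu, forall t, 0 <= t < 1 ->
      vderiv f t 0 0 = 'i * W0 (b t) (h t 0 0) (h t 1 0) /\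
      vderiv f t 1 0 = - 'i * W1 (b t) (h t 0 0) (h t 1 0)}.
    by apply: aeS hE => t H t01; apply/(tau_inv _ _ (b_lt1 t01)); exact: H.
  have [hL0 hL1] := hL.
  have i0 : cintg (fun t => 'i * W0 (b t) (h t 0 0) (h t 1 0)).
    by apply: cintgZ; apply: cL2_cintg; apply: (W0_L2 mb rho1 b_rho hL0 hL1).
  have i1 : cintg (fun t => - 'i * W1 (b t) (h t 0 0) (h t 1 0)).
    by apply: cintgZ; apply: cL2_cintg; apply: (W1_L2 mb rho1 b_rho hL0 hL1).
  have [x x0 px] := cprim_exists (f 0 0 0) i0.
  have [y y0 py] := cprim_exists (f 0 1 0) i1.
  (* One component: it agrees on [0, 1) with the primitive of its derivative, and uniqueness of
     limits identifies the value of that primitive at 1 with the component of [l]. *)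
  have E (i : 'I_2) z q : cintg q -> z 0 = f 0 i 0 -> cprim z q ->
      {ae mu, forall t, 0 <= t < 1 -> vderiv f t i 0 = q t} ->
      (forall t, 0 <= t < 1 -> f t i 0 = z t) /\ z 1 = l i 0.
    move=> [q1 q2] z0 pz fq; have [[_ zE1] [_ zE2]] := pz.
    have e1 t : 0 <= t < 1 -> f t i 0 = z t.
      move=> t01; have t01' : 0 <= t <= 1 by have /andP[-> /ltW] := t01.
      apply: ceq.
        rewrite [RHS]zE1//= z0; apply: (@abs_cont_prim _ (re_comp f i)) => //.
          by move=> c /fac/(_ i)[].
        by apply: aeS fq => s H /H; rewrite mxE /= => <-.
      rewrite [RHS]zE2//= z0; apply: (@abs_cont_prim _ (im_comp f i)) => //.
        by move=> c /fac/(_ i)[].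
      by apply: aeS fq => s H /H; rewrite mxE /= => <-.
    split => //; have [l1 l2] := fl i; have [p1 p2] := pz.
    have near01 : \forall t \near (1:R)^'-, 0 <= t < 1.
      near=> t; apply/andP; split; last by near: t; exact: nbhs_left_lt.
      by near: t; apply: nbhs_left_ge.
    apply: ceq.
      apply: (@cvg_unique _ (@Rhausdorff R) (re_comp f i t @[t --> (1:R)^'-])) l1.
      have := is_prim_cvg1 p1; apply: cvg_trans; apply: near_eq_cvg.
      by apply: filterS near01 => t /e1; rewrite /re_comp/= => ->.
    apply: (@cvg_unique _ (@Rhausdorff R) (im_comp f i t @[t --> (1:R)^'-])) l2.
    have := is_prim_cvg1 p2; apply: cvg_trans; apply: near_eq_cvg.
    by apply: filterS near01 => t /e1; rewrite /im_comp/= => ->.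
  have [ex x1] : (forall t, 0 <= t < 1 -> f t 0 0 = x t) /\ x 1 = l 0 0.
    by apply: E i0 x0 px _; apply: aeS fder => t H /H[].
  have [ey y1] : (forall t, 0 <= t < 1 -> f t 1 0 = y t) /\ y 1 = l 1 0.
    by apply: E i1 y0 py _; apply: aeS fder => t H /H[].
  exists x, y; split; last first.
    apply: aeS gf => t H t01; rewrite H//; apply: cv2_eq; rewrite ?vec0 ?vec1.
      exact: ex.
    exact: ey.
  split => //; first by rewrite x0 y0 f0E !mxE/=.
  by rewrite x1 y1 lE !mxE/= mulr1 mulrC.
move=> [gL hL [x [y [[px py xy0 xy1] gE]]]].
have [px1 px2] := px; have [py1 py2] := py.
have vE0 : (re_comp (vec x y) 0 = Re \o x) * (im_comp (vec x y) 0 = Im \o x).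
  by split; apply/funext => t; rewrite /re_comp /im_comp vec0.
have vE1 : (re_comp (vec x y) 1 = Re \o y) * (im_comp (vec x y) 1 = Im \o y).
  by split; apply/funext => t; rewrite /re_comp /im_comp vec1.
have Lxy : vL2 (vec x y).
  split; first by apply: (@eq_cL2 _ x) => [t _|]; [rewrite /cpt vec0|exact/cbm_L2/(cprim_cbm px)].
  by apply: (@eq_cL2 _ y) => [t _|]; [rewrite /cpt vec1|exact/cbm_L2/(cprim_cbm py)].
have hE : ae_eq01 h (tau b (vec x y)).
  have := aeI (aeI (is_prim_deriv px1) (is_prim_deriv px2))
    (aeI (is_prim_deriv py1) (is_prim_deriv py2)).
  move=> D; apply: aeW01; apply: aeS D => t [[d1 d2] [d3 d4]] t01.
  have t01' : 0 <= t < 1 by have /andP[/ltW -> ->] := t01.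
  have {}d1 := d1 t01; have {}d2 := d2 t01; have {}d3 := d3 t01; have {}d4 := d4 t01.
  apply/(tau_inv _ _ (b_lt1 t01')); rewrite !mxE !vE0 !vE1 !derive1E !derive_val.
  by split; apply: ceq.
exists (vec x y); last by split; [exact/hP|exact/hP| |].
split.
- move=> c /andP[c0 c1]; have c1' := ltW c1.
  apply: ord2P; rewrite ?vE0 ?vE1.
    by split; apply: abs_contS c1' _; [exact: is_prim_ac px1|exact: is_prim_ac px2].
  by split; apply: abs_contS c1' _; [exact: is_prim_ac py1|exact: is_prim_ac py2].
- exact/hP.
- by exists h => //; exact/hP.
- by exists (x 0); apply: cv2_eq; rewrite !mxE/= mulr1.
- exists (vec x y 1).
    apply: ord2P; rewrite ?vE0 ?vE1 ?vec0 ?vec1.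
      by split; [exact: is_prim_cvg1 px1|exact: is_prim_cvg1 px2].
    by split; [exact: is_prim_cvg1 py1|exact: is_prim_cvg1 py2].
  by exists (y 1); apply: cv2_eq; rewrite !mxE/= ?mulr1// xy1 mulrC.
Unshelve. all: by end_near. Qed.

Hypothesis b1_nrm : b1 * b1^* = 1.

(** The difference of the two inner products is the increment over [0, 1] of -i (conj x x' - conj y
    y'). This expression vanishes at 0 because x = y there, and at 1 because |b1| = 1. *)
Lemma dirac_op_sym g h g' h' :
  dirac_op b (cv2 1 1) (cv2 b1 1) g h -> dirac_op b (cv2 1 1) (cv2 b1 1) g' h' ->
  inner b g h' = inner b h g'.
Proof.
move=> /dirac_opP[gL hL [x [y [[px py xy0 xy1] gE]]]].
move=> /dirac_opP[gL' hL' [x' [y' [[px' py' xy0' xy1'] gE']]]].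
have Lv (u v k l : R -> C) : cprim u k -> cprim v l -> vL2 (vec u v).
  move=> pu pv; split.
    by apply: (@eq_cL2 _ u) => [t _|]; [rewrite /cpt vec0|exact/cbm_L2/(cprim_cbm pu)].
  by apply: (@eq_cL2 _ v) => [t _|]; [rewrite /cpt vec1|exact/cbm_L2/(cprim_cbm pv)].
have Lxy := Lv _ _ _ _ px py; have Lxy' := Lv _ _ _ _ px' py'.
rewrite (inner_ael hL' gL Lxy gE) (inner_aer hL gL' Lxy' gE').
have pF := cprimZ (- 'i) (cprimD (cprimM (cprimJ px) px')
   (cprimZ (-1) (cprimM (cprimJ py) py'))).
have := cprim_cint pF; rewrite /= xy0 xy1 xy0' xy1' !rmorphM/= !mulN1r subrr mulr0 add0r.
rewrite (_ : _ + _ = (b1 * b1^* - 1) * ((y 1)^* * y' 1)); last by ring.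
rewrite b1_nrm subrr mul0r mulr0 => /esym cF.
apply/eqP; rewrite -subr_eq0; apply/eqP; rewrite -[RHS]cF !innerE.
have w1 := wform_cintg mb rho1 b_rho Lxy hL'.
have w2 := wform_cintg mb rho1 b_rho hL Lxy'.
rewrite -[- cint (wform b h _)]mulN1r -cintZ// -cintD//; last exact: cintgZ.
apply: eq_cint => t _; rewrite [in X in _ + X]wform_herm !wformE !vec0 !vec1.
move: (W0 _ (h' t 0 0) _) (W1 _ (h' t 0 0) _) => A B.
move: (W0 _ (h t 0 0) _) (W1 _ (h t 0 0) _) => A' B'.
rewrite !(rmorphD, rmorphM, rmorphN)/= !conjCK conjCi.
have ii : 'i * 'i = -1 :> C by rewrite -expr2 sqrCi.
apply/eqP; rewrite -subr_eq0; apply/eqP.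
(* [ring] does not know i^2 = -1, so the difference of the two sides is exhibited as a multiple of
   i^2 + 1. *)
transitivity (('i * 'i + 1) * ((x t)^* * A + (y t)^* * B - (x' t * A'^* + y' t * B'^*))).
  by ring.
by rewrite ii addNr mul0r.
Qed.
End Inner.

(** * Density of the domain *)

Section Density.
Variable R : realType.
Notation mu := (@lebesgue_measure R).
Notation I01 := (`[0%R, 1%R[%classic : set R).
Implicit Types (x y F k : R -> R).

Lemma derive_lip F L (t d : R) : is_derive t 1 F d ->
  (\forall s \near t, `|F s - F t| <= L * `|s - t|) -> `|d| <= L.
Proof.
move=> [dF <-] FL.
have H : h^-1 *: (F (h + t) - F t) @[h --> 0^'] --> 'D_1 F t.
  have K : h^-1 *: (F (h *: (1 : R) + t) - F t) @[h --> 0^'] --> 'D_1 F t by exact: dF.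
  rewrite (_ : (fun h => _) = (fun h => h^-1 *: (F (h *: (1 : R) + t) - F t)))//.
  by apply/funext => h; rewrite /GRing.scale/= mulr1.
apply: cvgr_to_le (cvg_norm H) _.
rewrite near_withinE; move: FL; rewrite (near_shift 0 t) subr0; apply: filterS => h /= FL h0.
rewrite normrZ normfV ler_pdivrMl ?normr_gt0// mulrC.
by apply: le_trans FL _; rewrite addrK.
Unshelve. all: by end_near. Qed.

(** The density obtained from absolute continuity is bounded by L only almost everywhere; clipping
    it at |L| bounds it everywhere and leaves the primitive unchanged. *)
Lemma lip_is_prim F L : (forall s t, 0 <= s -> s <= t -> t <= 1 -> `|F t - F s| <= L * (t - s)) ->
  exists2 k, is_prim F k & bounded_mfun k.
Proof.
move=> FL; have acF := abs_cont_lip FL.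
have [k0 ik0 k0E] := abs_cont_primitive ler01 acF.
have ik : intg k0 by apply: integrableS ik0.
have pF : is_prim F k0.
  split => // t /andP[t0 t1]; rewrite -[LHS](subrKC (F 0)) k0E ?t0//; congr (_ + _).
  have iT : mu.-integrable `[0, t[%classic (EFin \o k0) by apply: integrableS ik0.
  rewrite /prim -Rintegral_itv_bndo_bndc// -[RHS]Rintegral_itv_bndo_bndc//; last first.
    by apply: integrableS (intg_restrict ik).
  apply: eq_Rintegral => s; rewrite inE/= in_itv/= => /andP[s0 st].
  by rewrite restrictI01// s0 (lt_le_trans st).
have kL : {ae mu, forall t, 0 <= t < 1 -> `|k0 t| <= L}.
  apply: aeW01; apply: aeS (is_prim_deriv pF) => t H t01.
  apply: (derive_lip (H t01)); have /andP[t0 t1] := t01.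
  near=> s; have s0 : 0 <= s by apply/ltW; near: s; exact: lt_nbhsr.
  have s1 : s <= 1 by apply/ltW; near: s; exact: lt_nbhsl.
  have [st|/ltW ts] := leP s t.
    by rewrite distrC [X in L * X]distrC [X in L * X]ger0_norm ?subr_ge0//; apply: FL => //; exact: ltW.
  by rewrite [X in L * X]ger0_norm ?subr_ge0//; apply: FL => //; exact: ltW.
pose k t := Num.max (- `|L|) (Num.min (k0 t) `|L|).
have mk : measurable_fun I01 k.
  apply: measurable_maxr => //; apply: measurable_minr => //.
  exact: intg_measurable ik.
have kb t : `|k t| <= `|L|.
  rewrite ler_norml /k le_max lexx/= ge_max ge_min lexx orbT andbT.
  by rewrite (le_trans _ (normr_ge0 L))// oppr_le0.
have bk : bounded_mfun k by split => //; exists `|L| => t _.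
exists k => //; have ik' : intg k by apply: L2_intg; exact: bounded_mfun_L2.
have kk : {ae mu, forall t, 0 <= t < 1 -> k0 t = k t}.
  apply: aeS kL => t H t01; have := le_trans (H t01) (ler_norm L).
  by rewrite ler_norml /k => /andP[h1 h2]; rewrite (min_idPl h2) (max_idPr h1).
split => // t t01; have [_ ->] := pF; last exact: t01.
by rewrite (ae_eq_prim ik ik' kk).
Unshelve. all: by end_near. Qed.

Lemma dct_small (z : nat -> R -> R) (g : R -> R) (e : R) : 0 < e ->
  (forall n, measurable_fun I01 (z n)) ->
  {ae mu, forall t, 0 <= t < 1 -> z ^~ t @ \oo --> 0} -> intg g ->
  (forall n t, 0 <= t < 1 -> `|z n t| <= g t) ->
  \forall n \near \oo, \int[mu]_(t in I01) z n t < e.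
Proof.
move=> e0 mz z0 ig zg.
have [|||||_ _] := @dominated_convergence _ _ _ mu I01 (@measurableI01 R)
  (fun n t => (z n t)%:E) (fun _ => 0%E) (EFin \o g).
- by move=> n; apply/measurable_EFinP; exact: mz.
- exact: measurable_cst.
- apply: aeS z0 => t H; rewrite /= in_itv/= => /H zt.
  by apply: cvg_EFin zt; near=> n.
- by [].
- by apply: aeW => t n; rewrite /= in_itv/= => t01; rewrite lee_fin zg.
rewrite integral0 => /fine_cvgP[_ H].
exact: (cvgr_lt _ H _ e0).
Unshelve. all: by end_near. Qed.

(** Besides large values it cuts off neighbourhoods of 0 and 1, which makes the approximants below
    vanish at both end points. *)
Definition trunc x (n : nat) (t : R) : R :=
  if (`|x t| <= n%:R) && (n.+1%:R^-1 <= t) && (t <= 1 - n.+1%:R^-1) then x t else 0.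

Lemma trunc_approx x (e : R) : 0 < e -> L2 x -> exists n, measurable_fun I01 (trunc x n) /\
  \int[mu]_(t in I01) (x t - trunc x n t) ^+ 2 < e.
Proof.
move=> e0 Lx; have [mx ix] := Lx.
have mtr n : measurable_fun I01 (trunc x n).
  apply: measurable_fun_if => //; last exact: measurable_funS mx.
  apply: measurable_and; last by apply: measurable_fun_ler.
  apply: measurable_and; last by apply: measurable_fun_ler.
  by apply: measurable_fun_ler => //; exact: measurableT_comp.
have tre n t : trunc x n t = x t \/ trunc x n t = 0.
  by rewrite /trunc; case: ifP => _; [left|right].
have ev : \forall n \near \oo, \int[mu]_(t in I01) (x t - trunc x n t) ^+ 2 < e.
  apply: (@dct_small (fun n t => (x t - trunc x n t) ^+ 2) (fun t => x t ^+ 2)) => //.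
  - by move=> n; apply: measurable_funX; exact: measurable_funB.
  - apply: aeW01; apply: aeW => t /andP[t0 t1].
    have t1' : 0 < 1 - t by rewrite subr_gt0.
    have : \forall n \near \oo, 0 = (x t - trunc x n t) ^+ 2 :> R.
      near=> n; rewrite /trunc ifT ?subrr ?expr0n//.
      apply/andP; split; first (apply/andP; split).
      + by near: n; exact: nbhs_infty_ger.
      + by apply/ltW; near: n; exact: (near_infty_natSinv_lt (PosNum t0)).
      + rewrite lerBrDr -lerBrDl; apply/ltW.
        by near: n; exact: (near_infty_natSinv_lt (PosNum t1')).
    by move=> /near_eq_cvg h; apply: cvg_trans h _; exact: cvg_cst.
  - move=> n t _; rewrite ger0_norm ?sqr_ge0//.
    by case: (tre n t) => ->; rewrite ?subrr ?subr0// expr0n sqr_ge0.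
have [n ne] := filter_ex ev; by exists n.
Unshelve. all: by end_near. Qed.

(** The approximants are forward averages over windows of length 1/(m + 1) of a truncation y of x.
    They are Lipschitz, converge to y almost everywhere by Lebesgue differentiation, and dominated
    convergence turns this into convergence in norm. Vanishing at 0 and 1 makes them meet any
    boundary condition. *)
Lemma L2_dense x (e : R) : 0 < e -> L2 x -> exists F k,
  [/\ is_prim F k, L2 k, F 0 = 0, F 1 = 0 & \int[mu]_(t in I01) (x t - F t) ^+ 2 < e].
Proof.
(* Two errors below e / 4, truncation and averaging, are combined by |u + v|^2 <= 2 (|u|^2 +
   |v|^2). *)
move=> e0 Lx; have e40 : 0 < e / 4 by rewrite divr_gt0.
have [n [mtr trx]] := trunc_approx e40 Lx.
pose y := trunc x n; pose d : R := n.+1%:R^-1.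
have d0 : 0 < d by rewrite invr_gt0.
have yn t : `|y t| <= n%:R.
  by rewrite /y /trunc; case: ifP => [/andP[/andP[]]//|_]; rewrite normr0.
have y0 t : t < d -> y t = 0.
  by move=> td; rewrite /y /trunc [_ <= t]leNgt td andbF.
have y1 t : 1 - d < t -> y t = 0.
  by move=> td; rewrite /y /trunc [t <= _]leNgt td andbF.
have by_ : bounded_mfun y by split => //; exists n%:R => t _.
have iy : intg y by apply: L2_intg; exact: bounded_mfun_L2.
pose G := prim y.
have iT := intg_restrict iy.
have yr s : `|(y \_ I01) s| <= n%:R.
  by rewrite patchE; case: ifP => _; rewrite ?yn// /point/= normr0.
have GL s t : 0 <= s -> s <= t -> `|G t - G s| <= n%:R * (t - s).
  move=> s0 st; rewrite /G /prim (Rintegral_itv_split s0 st iT) addrAC subrr add0r.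
  have mst : measurable (`]s, t]%classic : set (measurableTypeR R)) by exact: measurable_itv.
  have iST : mu.-integrable `]s, t]%classic (EFin \o (y \_ I01)) by apply: integrableS iT.
  apply: le_trans; first exact: le_normr_Rintegral.
  have mfin : mu (`]s, t]%classic) = (t - s)%:E.
    rewrite lebesgue_measure_itv/= lte_fin; case: ltP => [_|ts]; first by rewrite EFinB.
    by rewrite (@le_anti _ _ s t) ?st// subrr.
  have ic : mu.-integrable `]s, t]%classic (EFin \o (fun _ => n%:R : R)).
    have mfy : (mu (`]s, t]%classic) < +oo)%E by rewrite mfin ltry.
    apply: (measurable_bounded_integrable mst mfy) => //.
    by exists n%:R; split => // r r1 u _ /=; rewrite ger0_norm// ltW.
  apply: le_trans; first by apply: (le_Rintegral _ _ ic) => //; exact: integrable_norm.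
  by rewrite Rintegral_cst// -[leRHS]/(_ * fine (t - s)%:E) -mfin.
have G0 t : t < d -> G t = 0.
  move=> td; rewrite /G /prim (@eq_Rintegral _ _ _ mu _ (cst 0)).
    by rewrite Rintegral_cst ?mul0r//; exact: measurable_itv.
  move=> s; rewrite inE/= in_itv/= => /andP[_ st]; rewrite patchE y0 ?(le_lt_trans st)//.
  by case: ifP.
have G1 t : 1 <= t -> G t = G 1.
  move=> t1; rewrite /G /prim (Rintegral_itv_split ler01 t1 iT).
  rewrite [X in _ + X](@eq_Rintegral _ _ _ mu _ (cst 0)).
    by rewrite Rintegral_cst ?mul0r ?addr0//; exact: measurable_itv.
  move=> s; rewrite inE/= in_itv/= => /andP[s1 st]; rewrite patchE y1 ?(lt_trans _ s1)//.
    by case: ifP.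
  by rewrite ltrBlDr ltrDl.
pose f (m : nat) t := m.+1%:R * (G (t + m.+1%:R^-1) - G t).
have fy : {ae mu, forall t, 0 <= t < 1 -> (fun m => (y t - f m t) ^+ 2) @ \oo --> 0}.
  apply: aeW01; apply: aeS (prim_deriv iy) => t H t01; have [dG dGE] := H t01.
  have K : h^-1 *: (G (h *: (1 : R) + t) - G t) @[h --> 0^'] --> y t.
    by rewrite -dGE derive1E; exact: dG.
  have hm : (fun m => m.+1%:R^-1 : R) @ \oo --> 0^'.
    move=> A /= A0; have /nbhs_ballP[r /= r0 rA] : \forall u \near (0 : R), u != 0 -> A u.
      exact: A0.
    have := near_infty_natSinv_lt (PosNum r0); apply: filterS => m mr.
    by apply: rA; rewrite ?invr_eq0 ?pnatr_eq0// /ball/= sub0r normrN ger0_norm.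
  have F : f ^~ t @ \oo --> y t.
    have := cvg_comp _ _ hm K; apply: cvg_trans; apply: near_eq_cvg; apply: nearW => m /=.
    by rewrite /f /GRing.scale/= invrK mulr1 [t + _]addrC.
  have D : (fun m => y t - f m t) @ \oo --> 0.
    by rewrite -(subrr (y t)); apply: cvgB => //; exact: cvg_cst.
  by rewrite -(mulr0 0); apply: cvgM.
have flip m s t : 0 <= s -> s <= t -> t <= 1 ->
    `|f m t - f m s| <= (m.+1%:R * (n%:R * 2)) * (t - s).
  move=> s0 st t1; rewrite /f -mulrBr normrM ger0_norm// -mulrA ler_wpM2l//.
  set u := m.+1%:R^-1; have u0 : 0 <= u by rewrite invr_ge0.
  have -> : G (t + u) - G t - (G (s + u) - G s) = (G (t + u) - G (s + u)) - (G t - G s) by ring.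
  apply: le_trans (ler_normB _ _) _.
  rewrite (_ : n%:R * 2 * (t - s) = n%:R * (t - s) + n%:R * (t - s)); last by ring.
  apply: lerD; last exact: GL.
  have -> : t - s = (t + u) - (s + u) by ring.
  by apply: GL; rewrite ?lerD2r// addr_ge0.
have fb m t : 0 <= t -> `|f m t| <= n%:R.
  move=> t0; rewrite /f normrM ger0_norm// mulrC -ler_pdivlMr//.
  apply: le_trans (GL _ _ t0 _) _; first by rewrite lerDl.
  by rewrite [t + _]addrC addrK.
have ev : \forall m \near \oo, \int[mu]_(t in I01) (y t - f m t) ^+ 2 < e / 4.
  apply: (@dct_small (fun m t => (y t - f m t) ^+ 2) (fun t => (n%:R * 2) ^+ 2)) => //.
  - move=> m; have [k pf _] := lip_is_prim (flip m).
    by apply: measurable_funX; apply: measurable_funB => //; exact: is_prim_measurable pf.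
  - by apply: L2_intg; apply: bounded_mfun_L2; exact: bounded_mfun_cst.
  - move=> m t /andP[t0 _]; rewrite ger0_norm ?sqr_ge0// -ler_sqrt ?sqr_ge0// !sqrtr_sqr.
    rewrite [leRHS]ger0_norm// mulr_natr mulr2n.
    by apply: le_trans (ler_normB _ _) _; apply: lerD => //; exact: fb.
have dm : \forall m \near \oo, m.+1%:R^-1 < d by exact: near_infty_natSinv_lt (PosNum d0).
(* With 1/(m + 1) < d the averaging window at 0 lies where y vanishes; the window at 1 lies beyond
   1, where [G] is constant. *)
have [m [mev md]] := filter_ex (filterI ev dm).
have [k pf bk] := lip_is_prim (flip m).
exists (f m), k; split => //.
- exact: bounded_mfun_L2.
- by rewrite /f add0r !G0// subrr mulr0.
- by rewrite /f G1 ?subrr ?mulr0// lerDl.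
have Lf : L2 (f m) by apply: bounded_mfun_L2; exact: bounded_mfun_prim pf.
have LB u v : L2 u -> L2 v -> intg (fun t => (u t - v t) ^+ 2).
  by move=> Lu Lv; have [_] := L2D Lu (L2N Lv).
have Ly : L2 y by exact: bounded_mfun_L2.
apply: (@le_lt_trans _ _ (\int[mu]_(t in I01) (2 * ((x t - y t) ^+ 2 + (y t - f m t) ^+ 2)))).
  apply: le_Rintegral => //.
  - exact: LB.
  - by apply: intgZ; apply: intgD; exact: LB.
  - by move=> t _; have := sqr_ge0 ((x t - y t) - (y t - f m t)); nra.
rewrite RintegralZl//; last by apply: intgD; exact: LB.
rewrite RintegralD//; [|exact: LB|exact: LB].
have := ltrD trx mev; rewrite -/y; lra.
Qed.

End Density.

(** * Norm estimates for primitives and for the weight *)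

Section Bounds.
Variable R : realType.
Notation C := R[i].
Notation mu := (@lebesgue_measure R).
Notation I01 := (`[0%R, 1%R[%classic : set R).
Local Notation Re := (@complex.Re R).
Local Notation Im := (@complex.Im R).

(** Cauchy-Schwarz on an interval of length 1, in the form that the variance of |r| is
    nonnegative. *)
Lemma sqr_prim_le (r : R -> R) t : L2 r -> 0 <= t <= 1 ->
  prim r t ^+ 2 <= \int[mu]_(s in I01) (r s ^+ 2).
Proof.
move=> Lr t01; have ir := L2_intg Lr; have [mr ir2] := Lr.
have ia : intg (fun s => `|r s|) by exact: (integrable_norm ir).
set m := \int[mu]_(s in I01) `|r s|.
have i1 : intg (fun _ => 1 : R) by apply: L2_intg; apply: bounded_mfun_L2; exact: bounded_mfun_cst.
have m1 : \int[mu]_(s in I01) 1 = 1 :> R.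
  rewrite Rintegral_cst ?mul1r; last exact: measurableI01.
  by rewrite [X in fine X]lebesgue_measure_itv/= lte01 -EFinB subr0.
have m0 : 0 <= m by apply: Rintegral_ge0.
apply: (@le_trans _ _ (m ^+ 2)).
  by rewrite -[leLHS]real_normK ?num_real// ler_pXn2r ?nnegrE//; exact: prim_bound.
rewrite -subr_ge0.
have -> : \int[mu]_(s in I01) (r s ^+ 2) - m ^+ 2 =
   \int[mu]_(s in I01) ((`|r s| - m) ^+ 2).
  transitivity (\int[mu]_(s in I01) (r s ^+ 2 + (- (2 * m) * `|r s| + m ^+ 2 * 1))).
    have mI := @measurableI01 R.
    have iA := intgZ (- (2 * m)) ia; have iB := intgZ (m ^+ 2) i1.
    rewrite (RintegralD mI ir2 (intgD iA iB)) (RintegralD mI iA iB).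
    rewrite (RintegralZl _ mI ia) (RintegralZl _ mI i1).
    by rewrite m1 -/m; ring.
  apply: eq_Rintegral => s _; rewrite -[r s ^+ 2]real_normK ?num_real//; ring.
by apply: Rintegral_ge0 => s _; exact: sqr_ge0.
Qed.

Lemma intg_nrm2 (f : R -> C) : cL2 f -> intg (fun t => nrm2 (f t)).
Proof. by move=> [[_ f1] [_ f2]]; exact: intgD. Qed.

Lemma nrm2_prim_le (f k : R -> C) t : cprim f k -> cL2 k -> f 0 = 0 -> 0 <= t <= 1 ->
  nrm2 (f t) <= \int[mu]_(s in I01) nrm2 (k s).
Proof.
move=> [[i1 E1] [i2 E2]] [k1 k2] f0 t01; rewrite /nrm2.
have [_ i3] := k1; have [_ i4] := k2.
rewrite (RintegralD (@measurableI01 R) i3 i4).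
have := E1 t t01; have := E2 t t01; rewrite /= f0/= !add0r => -> ->.
by apply: lerD; exact: sqr_prim_le.
Qed.

Lemma nrm2D_le (x y : C) : nrm2 (x + y) <= 2 * (nrm2 x + nrm2 y).
Proof.
have := nrm2B_le x (- y); rewrite opprK; congr (_ <= 2 * (_ + _)).
by rewrite /nrm2 !cE; ring.
Qed.

Lemma cprim_nrm2_bound (f k : R -> C) : cprim f k ->
  exists B, forall t, 0 <= t <= 1 -> nrm2 (f t) <= B.
Proof.
move=> [p1 p2]; have [M M0 FM] := is_prim_bound p1; have [N N0 FN] := is_prim_bound p2.
exists (M ^+ 2 + N ^+ 2) => t t01; rewrite /nrm2; apply: lerD.
  rewrite -real_normK ?num_real// ler_pXn2r ?nnegrE ?(ltW M0)//; exact: FM.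
rewrite -real_normK ?num_real// ler_pXn2r ?nnegrE ?(ltW N0)//; exact: FN.
Qed.

(** As |c| < 1, the squared moduli of the numerators are at most 8 times the sum; division by (2 (1
    - rho))^2 leaves the constant. *)
Lemma W_nrm2_le (rho : R) (c x y : C) : rho < 1 -> nrm2 c <= rho ->
  nrm2 (W0 c x y) <= 2 / (1 - rho) ^+ 2 * (nrm2 x + nrm2 y) /\
  nrm2 (W1 c x y) <= 2 / (1 - rho) ^+ 2 * (nrm2 x + nrm2 y).
Proof.
move=> r1 cr; have c0 := nrm2_ge0 c.
have r0 : 0 < 1 - rho by rewrite subr_gt0.
have d0 : 0 < 1 - nrm2 c by lra.
have dE : (2 * (1 - `|c| ^+ 2))^-1 = ((2 * (1 - nrm2 c))^-1)%:C%C :> C.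
  by rewrite nrm2E !(rmorphM, fmorphV, rmorphB, rmorphN, rmorph1, rmorph_nat).
have rE (a : R) : nrm2 (a%:C%C) = a ^+ 2 by rewrite /nrm2 /= expr0n addr0.
have sE : 1 + `|c| ^+ 2 = (1 + nrm2 c)%:C%C :> C.
  by rewrite nrm2E -[1 in LHS](rmorph1 (real_complex R)) -rmorphD.
have K u v w : nrm2 u = nrm2 c ->
    nrm2 ((1 + nrm2 c)%:C%C * v - 2 * u * w) <= 8 * (nrm2 v + nrm2 w).
  move=> uc; apply: le_trans (nrm2B_le _ _) _; rewrite !nrm2M uc rE.
  have -> : nrm2 (2 : C) = 4 by rewrite -[2](rmorph_nat (real_complex R)) rE; ring.
  set r := nrm2 c in c0 d0 *; have v0 := nrm2_ge0 v; have w0 := nrm2_ge0 w.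
  have h1 : (1 + r) ^+ 2 * nrm2 v <= 4 * nrm2 v by apply: ler_wpM2r => //; nra.
  have h2 : r * nrm2 w <= 1 * nrm2 w by apply: ler_wpM2r => //; lra.
  lra.
have D u : nrm2 u <= 8 * (nrm2 x + nrm2 y) ->
    nrm2 (((2 * (1 - nrm2 c))^-1)%:C%C * u) <= 2 / (1 - rho) ^+ 2 * (nrm2 x + nrm2 y).
  move=> uq; rewrite nrm2M rE exprVn.
  have q0 : 0 <= nrm2 x + nrm2 y by rewrite addr_ge0 ?nrm2_ge0.
  rewrite mulrC ler_pdivrMr ?exprn_gt0 ?mulr_gt0//.
  apply: (le_trans uq); set q := nrm2 x + nrm2 y in q0 *.
  have -> : 2 / (1 - rho) ^+ 2 * q * (2 * (1 - nrm2 c)) ^+ 2 =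
      8 * q * ((1 - nrm2 c) ^+ 2 / (1 - rho) ^+ 2) by field; rewrite gt_eqF.
  rewrite ler_peMr ?mulr_ge0// ler_pdivlMr ?exprn_gt0// mul1r.
  by rewrite ler_pXn2r ?nnegrE ?(ltW r0) ?(ltW d0)// lerB.
rewrite /W0 /W1 dE sE; split; apply: D; first exact: K.
by rewrite [in leRHS]addrC; apply: K; rewrite nrm2J.
Qed.

End Bounds.

(** * Resolvent *)

Section Spectrum.
Variable R : realType.
Notation C := R[i].
Notation mu := (@lebesgue_measure R).
Notation I01 := (`[0%R, 1%R[%classic : set R).
Local Notation Re := (@complex.Re R).
Local Notation Im := (@complex.Im R).
Implicit Types (f g h u w : R -> 'cV[C]_2) (z : C).

Variables (b : R -> C) (rho : R) (b1 : C).
Hypotheses (mb : forall phi : C -> R, measurable_fun I01 (phi \o b)).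
Hypotheses (rho1 : rho < 1) (b_rho : forall t, 0 <= t < 1 -> nrm2 (b t) <= rho).
Hypothesis b1_nrm : b1 * b1^* = 1.

Let T := dirac_op b (cv2 1 1) (cv2 b1 1).

Definition dirac_solution z (x y : R -> C) : Prop :=
  cprim x (fun t => z * ('i * W0 (b t) (x t) (y t))) /\
  cprim y (fun t => z * (- 'i * W1 (b t) (x t) (y t))).

Lemma W0D c x y x' y' : W0 c (x + x') (y + y') = W0 c x y + W0 c x' y' :> C.
Proof. by rewrite /W0; ring. Qed.
Lemma W1D c x y x' y' : W1 c (x + x') (y + y') = W1 c x y + W1 c x' y' :> C.
Proof. by rewrite /W1; ring. Qed.
Lemma W0Z c a x y : W0 c (a * x) (a * y) = a * W0 c x y :> C.
Proof. by rewrite /W0; ring. Qed.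
Lemma W1Z c a x y : W1 c (a * x) (a * y) = a * W1 c x y :> C.
Proof. by rewrite /W1; ring. Qed.

Lemma nrm2N z : nrm2 (- z) = nrm2 z.
Proof. by rewrite /nrm2 !cE !sqrrN. Qed.

Lemma vec_vL2 (x y : R -> C) : cL2 x -> cL2 y -> vL2 (vec x y).
Proof.
move=> Lx Ly; split; first by apply: (@eq_cL2 _ x) => // t _; rewrite /cpt vec0.
by apply: (@eq_cL2 _ y) => // t _; rewrite /cpt vec1.
Qed.

Lemma hnorm_le f (q : R) : vL2 f ->
  \int[mu]_(t in I01) (nrm2 (f t 0 0) + nrm2 (f t 1 0)) <= q ->
  Re (inner b f f) <= 2 / (1 - rho) * q.
Proof.
move=> Lf fq; have [iw _] := wform_cintg mb rho1 b_rho Lf Lf.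
have [L0 L1] := Lf.
have i01 := intgD (intg_nrm2 L0) (intg_nrm2 L1).
have r0 : 0 <= 2 / (1 - rho) by rewrite divr_ge0// subr_ge0 ltW.
apply: le_trans (ler_wpM2l r0 fq); rewrite -(RintegralZl _ (@measurableI01 R) i01).
apply: (le_Rintegral (@measurableI01 R) iw (intgZ _ i01)) => t; rewrite /= in_itv/= => t01.
exact: wform_diag_le (b_rho t01) rho1.
Qed.

Lemma hnorm_ge f : vL2 f ->
  \int[mu]_(t in I01) (nrm2 (f t 0 0) + nrm2 (f t 1 0)) <= 8 / (1 - rho) * Re (inner b f f).
Proof.
move=> Lf; have [iw _] := wform_cintg mb rho1 b_rho Lf Lf.
have [L0 L1] := Lf.
have i01 := intgD (intg_nrm2 L0) (intg_nrm2 L1).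
have r0 : 0 < 1 - rho by rewrite subr_gt0.
rewrite -(RintegralZl _ (@measurableI01 R) iw).
apply: (le_Rintegral (@measurableI01 R) i01 (intgZ _ iw)) => t; rewrite /= in_itv/= => t01.
have := wform_diag_ge f (b_rho t01) rho1; set q := _ + _.
rewrite -[(1 - rho) / 8]invf_div ler_pdivrMl ?divr_gt0//.
Qed.

Section resolvent.
Variables (z : C) (y00 y10 y01 y11 : R -> C).
Hypotheses (fund0 : dirac_solution z y00 y10) (fund1 : dirac_solution z y01 y11).
Hypotheses (y00_0 : y00 0 = 1) (y10_0 : y10 0 = 0) (y01_0 : y01 0 = 0) (y11_0 : y11 0 = 1).

(** Liouville's formula: the system has trace zero, so the Wronskian keeps its initial value. Hence
    the adjugate of the fundamental matrix is its inverse. *)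
Let det1 t : 0 <= t <= 1 -> y00 t * y11 t - y01 t * y10 t = 1.
Proof.
have [p00 p10] := fund0; have [p01 p11] := fund1.
have pd := cprimD (cprimM p00 p11) (cprimZ (-1) (cprimM p01 p10)).
have pd0 : cprim (fun t => y00 t * y11 t + -1 * (y01 t * y10 t)) (fun _ => 0).
  by apply: eq_cprim pd => // s _; rewrite /W0 /W1; ring.
move=> t01; rewrite -mulN1r.
apply: (cprim_unique pd0 (cprim_cst 1)) t01.
by rewrite y00_0 y11_0 y01_0 !mul1r mul0r mulr0 addr0.
Qed.

(* Vanishes iff the solution started at (1, 1) satisfies the end condition. *)
Let delta := y00 1 + y01 1 - b1 * (y10 1 + y11 1).

(** With the fundamental matrix Y, the solution is g = Y (c (1, 1) + u), where u is the integral of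
    Y^-1 (q0, q1). The constants [A1], [A2], [A3], [A4] bound, in this order, the squared moduli of
    u, c, c + u and g in terms of the integral of |f|^2; [M2] passes to the weighted norms on both
    sides. *)
Lemma resolvent_onto : delta != 0 -> exists M : R, forall f, hilb b f -> exists g h,
  [/\ T g h, ae_eq01 (fun t => h t - z *: g t) f & hnorm b g <= M * hnorm b f].
Proof.
move=> delta0; have [p00 p10] := fund0; have [p01 p11] := fund1.
have [B00 B00P] := cprim_nrm2_bound p00; have [B10 B10P] := cprim_nrm2_bound p10.
have [B01 B01P] := cprim_nrm2_bound p01; have [B11 B11P] := cprim_nrm2_bound p11.
pose B := Num.max (Num.max B00 B10) (Num.max B01 B11).
have BP t : 0 <= t <= 1 -> [/\ nrm2 (y00 t) <= B, nrm2 (y10 t) <= B,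
    nrm2 (y01 t) <= B & nrm2 (y11 t) <= B].
  by move=> t01; rewrite /B !le_max B00P// B10P// B01P// B11P// !orbT.
have B0 : 0 <= B.
  have [h _ _ _] := BP 0 (ltac:(by rewrite lexx ler01)).
  exact: le_trans (nrm2_ge0 _) h.
pose kap := 2 / (1 - rho) ^+ 2.
have kap0 : 0 <= kap by rewrite divr_ge0// exprn_ge0// subr_ge0 ltW.
pose A1 := 4 * B * kap.
have A10 : 0 <= A1 by apply: mulr_ge0 => //; exact: mulr_ge0.
(* Variation of constants; e0 and e1 adjust the initial value, a multiple of (1, 1),
   to the condition at the end point. *)
pose e0 := - (y00 1 - b1 * y10 1) / delta.
pose e1 := - (y01 1 - b1 * y11 1) / delta.
pose A2 := 2 * (nrm2 e0 * A1 + nrm2 e1 * A1).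
have A20 : 0 <= A2 by rewrite /A2 mulr_ge0// addr_ge0// mulr_ge0// nrm2_ge0.
pose A3 := 2 * (A2 + A1).
have A30 : 0 <= A3 by rewrite /A3 mulr_ge0// addr_ge0.
pose A4 := 2 * (B * A3 + B * A3).
have A40 : 0 <= A4 by rewrite /A4 mulr_ge0// addr_ge0// mulr_ge0.
pose M2 := 2 / (1 - rho) * ((A4 + A4) * (8 / (1 - rho))).
have r0 : 0 < 1 - rho by rewrite subr_gt0.
have M20 : 0 <= M2.
  by rewrite /M2 !mulr_ge0 ?divr_ge0 ?addr_ge0// ?invr_ge0 ltW.
exists (Num.sqrt M2) => f /(hilbP mb rho1 b_rho) Lf; have [L0 L1] := Lf.
pose q0 (t : R) : C := 'i * W0 (b t) (f t 0 0) (f t 1 0).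
pose q1 (t : R) : C := - 'i * W1 (b t) (f t 0 0) (f t 1 0).
have Lq0 : cL2 q0 by apply: cL2Z; exact: (W0_L2 mb rho1 b_rho L0 L1).
have Lq1 : cL2 q1 by apply: cL2Z; exact: (W1_L2 mb rho1 b_rho L0 L1).
(* [s0] and [s1] are the components of Y^-1 (q0, q1), written with the adjugate by [det1]. *)
pose s0 t := y11 t * q0 t + -1 * (y01 t * q1 t).
pose s1 t := y00 t * q1 t + -1 * (y10 t * q0 t).
have Ls0 : cL2 s0.
  by apply: cL2D; [|apply: cL2Z]; apply: cL2M => //; [exact: cprim_cbm p11|exact: cprim_cbm p01].
have Ls1 : cL2 s1.
  by apply: cL2D; [|apply: cL2Z]; apply: cL2M => //; [exact: cprim_cbm p00|exact: cprim_cbm p10].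
have [u0 u00 pu0] := cprim_exists 0 (cL2_cintg Ls0).
have [u1 u10 pu1] := cprim_exists 0 (cL2_cintg Ls1).
pose c := e0 * u0 1 + e1 * u1 1.
have pv0 := cprimD (cprim_cst c) pu0; have pv1 := cprimD (cprim_cst c) pu1.
have px := cprimD (cprimM p00 pv0) (cprimM p01 pv1).
have py := cprimD (cprimM p10 pv0) (cprimM p11 pv1).
rewrite /= in px py.
pose x t := y00 t * (c + u0 t) + y01 t * (c + u1 t).
pose y t := y10 t * (c + u0 t) + y11 t * (c + u1 t).
have W t : 0 <= t < 1 -> 0 <= t <= 1 by move=> /andP[-> /ltW].
have Lx : cL2 x by apply/cbm_L2; exact: cprim_cbm px.
have Ly : cL2 y by apply/cbm_L2; exact: cprim_cbm py.
have Lg := vec_vL2 Lx Ly.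
pose h t := z *: vec x y t + f t.
have Lh : vL2 h by apply: vL2D => //; exact: vL2Z.
exists (vec x y), h; split.
- apply/(dirac_opP mb rho1 b_rho); split => //; exists x, y; split; last exact: aeW.
  have h0 t : h t 0 0 = z * x t + f t 0 0 by rewrite !mxE.
  have h1 t : h t 1 0 = z * y t + f t 1 0 by rewrite !mxE.
  split.
  + apply: eq_cprim px => // t /W /det1 dt.
    rewrite h0 h1 W0D W0Z.
    transitivity (z * ('i * W0 (b t) (x t) (y t)) + (y00 t * y11 t - y01 t * y10 t) * q0 t).
      by rewrite /s0 /s1 /x /y /W0; ring.
    by rewrite dt /q0; ring.
  + apply: eq_cprim py => // t /W /det1 dt.
    rewrite h0 h1 W1D W1Z.
    transitivity (z * (- 'i * W1 (b t) (x t) (y t)) + (y00 t * y11 t - y01 t * y10 t) * q1 t).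
      by rewrite /s0 /s1 /x /y /W1; ring.
    by rewrite dt /q1; ring.
  + by rewrite /x /y y00_0 y01_0 y10_0 y11_0 u00 u10; ring.
  + apply/eqP; rewrite -subr_eq0; apply/eqP.
    transitivity (c * delta + ((y00 1 - b1 * y10 1) * u0 1 + (y01 1 - b1 * y11 1) * u1 1)).
      by rewrite /x /y /delta; ring.
    by rewrite /c /e0 /e1; field.
- by apply: aeW => t _; rewrite /h addrAC subrr add0r.
pose q t := nrm2 (f t 0 0) + nrm2 (f t 1 0).
have iq : intg q by apply: intgD; exact: intg_nrm2.
pose Q := \int[mu]_(t in I01) q t.
have Q0 : 0 <= Q by apply: Rintegral_ge0 => t _; rewrite addr_ge0 ?nrm2_ge0.
have ni : nrm2 ('i : C) = 1 by rewrite -complexiE /nrm2 /= expr0n add0r expr1n.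
have nNi : nrm2 (- 'i : C) = 1 by rewrite nrm2N.
have q0q t : 0 <= t < 1 -> nrm2 (q0 t) <= kap * q t.
  move=> t01; rewrite nrm2M ni mul1r.
  by have [] := W_nrm2_le (f t 0 0) (f t 1 0) rho1 (b_rho t01).
have q1q t : 0 <= t < 1 -> nrm2 (q1 t) <= kap * q t.
  move=> t01; rewrite nrm2M nNi mul1r.
  by have [] := W_nrm2_le (f t 0 0) (f t 1 0) rho1 (b_rho t01).
have comb (x1 x2 k1 k2 : C) (X K : R) : nrm2 x1 <= X -> nrm2 x2 <= X ->
    nrm2 k1 <= K -> nrm2 k2 <= K -> nrm2 (x1 * k1 + x2 * k2) <= 4 * X * K.
  move=> h1 h2 h3 h4; apply: le_trans (nrm2D_le _ _) _; rewrite !nrm2M.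
  have le1 : nrm2 x1 * nrm2 k1 <= X * K by apply: ler_pM; rewrite ?nrm2_ge0.
  have le2 : nrm2 x2 * nrm2 k2 <= X * K by apply: ler_pM; rewrite ?nrm2_ge0.
  lra.
have qT t : 0 <= kap * q t by rewrite mulr_ge0// addr_ge0 ?nrm2_ge0.
have s0q t : 0 <= t < 1 -> nrm2 (s0 t) <= A1 * q t.
  move=> t01; have [h1 h2 h3 h4] := BP t (ltac:(exact/W)).
  rewrite /A1 -mulrA /s0 mulN1r -mulNr.
  by apply: comb; rewrite ?nrm2N ?q0q ?q1q.
have s1q t : 0 <= t < 1 -> nrm2 (s1 t) <= A1 * q t.
  move=> t01; have [h1 h2 h3 h4] := BP t (ltac:(exact/W)).
  rewrite /A1 -mulrA /s1 mulN1r -mulNr.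
  by apply: comb; rewrite ?nrm2N ?q0q ?q1q.
have intA (s : R -> C) : cL2 s -> (forall t, 0 <= t < 1 -> nrm2 (s t) <= A1 * q t) ->
    \int[mu]_(t in I01) nrm2 (s t) <= A1 * Q.
  move=> Ls sq; rewrite /Q -(RintegralZl _ (@measurableI01 R) iq).
  apply: (le_Rintegral (@measurableI01 R) (intg_nrm2 Ls) (intgZ _ iq)) => t.
  by rewrite /= in_itv/=; exact: sq.
have u0Q t : 0 <= t <= 1 -> nrm2 (u0 t) <= A1 * Q.
  by move=> t01; apply: le_trans (intA _ Ls0 s0q); exact: nrm2_prim_le.
have u1Q t : 0 <= t <= 1 -> nrm2 (u1 t) <= A1 * Q.
  by move=> t01; apply: le_trans (intA _ Ls1 s1q); exact: nrm2_prim_le.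
have I1 : (0 <= (1 : R)) && ((1 : R) <= 1) by rewrite ler01 lexx.
have cQ : nrm2 c <= A2 * Q.
  apply: le_trans (nrm2D_le _ _) _; rewrite (nrm2M e0) (nrm2M e1).
  rewrite (_ : A2 * Q = 2 * (nrm2 e0 * (A1 * Q) + nrm2 e1 * (A1 * Q))); last by rewrite /A2; ring.
  rewrite ler_pM2l//; apply: lerD; apply: ler_wpM2l; rewrite ?nrm2_ge0//.
    exact: u0Q.
  exact: u1Q.
have vQ (u : C) : nrm2 u <= A1 * Q -> nrm2 (c + u) <= A3 * Q.
  by move=> uQ; apply: le_trans (nrm2D_le _ _) _; rewrite (_ : A3 * Q = 2 * (A2 * Q + A1 * Q)) ?ler_pM2l ?lerD// /A3; ring.
have xQ (k1 k2 l1 l2 : C) : nrm2 k1 <= B -> nrm2 k2 <= B -> nrm2 l1 <= A3 * Q ->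
    nrm2 l2 <= A3 * Q -> nrm2 (k1 * l1 + k2 * l2) <= A4 * Q.
  move=> h1 h2 h3 h4; apply: le_trans (nrm2D_le _ _) _; rewrite !nrm2M.
  rewrite (_ : A4 * Q = 2 * (B * (A3 * Q) + B * (A3 * Q))); last by rewrite /A4; ring.
  by rewrite ler_pM2l//; apply: lerD; apply: ler_pM; rewrite ?nrm2_ge0.
have xyQ t : 0 <= t < 1 -> nrm2 (vec x y t 0 0) + nrm2 (vec x y t 1 0) <= (A4 + A4) * Q.
  move=> /W t01; have [h1 h2 h3 h4] := BP t t01; rewrite vec0 vec1 mulrDl.
  by apply: lerD; apply: xQ => //; apply: vQ; rewrite ?u0Q ?u1Q.
have QE : Q <= 8 / (1 - rho) * Re (inner b f f) by exact: hnorm_ge.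
have HG : Re (inner b (vec x y) (vec x y)) <= M2 * Re (inner b f f).
  rewrite /M2 -!mulrA; rewrite mulrA.
  apply: hnorm_le => //; rewrite [X in _ <= (_ * X)]mulrA.
  apply: le_trans (ler_wpM2l _ QE); last by rewrite addr_ge0.
  have [Lg0 Lg1] := Lg.
  have i01 := intgD (intg_nrm2 Lg0) (intg_nrm2 Lg1).
  have i1 : intg (fun _ => (A4 + A4) * Q : R).
    by apply: L2_intg; apply: bounded_mfun_L2; exact: bounded_mfun_cst.
  apply: (le_trans (le_Rintegral (@measurableI01 R) i01 i1 _)).
    by move=> t; rewrite /= in_itv/=; exact: xyQ.
  rewrite Rintegral_cst; last exact: measurableI01.
  by rewrite [X in fine X]lebesgue_measure_itv/= lte01 -EFinB subr0 mulr1.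
by rewrite /hnorm -sqrtrM// ler_wsqrtr.
Qed.

End resolvent.
End Spectrum.

(** * Self-adjointness and spectrum of a Dirac operator with bounded path *)

Section Abstract.
Variable R : realType.
Notation C := R[i].
Notation mu := (@lebesgue_measure R).
Notation I01 := (`[0%R, 1%R[%classic : set R).
Local Notation Re := (@complex.Re R).
Local Notation Im := (@complex.Im R).
Implicit Types (f g h u w : R -> 'cV[C]_2) (z : C).

Variables (b : R -> C) (rho : R) (b1 : C).
Hypotheses (mb : forall phi : C -> R, measurable_fun I01 (phi \o b)).
Hypotheses (rho1 : rho < 1) (b_rho : forall t, 0 <= t < 1 -> nrm2 (b t) <= rho).
Hypothesis b1_nrm : b1 * b1^* = 1.

Let T := dirac_op b (cv2 1 1) (cv2 b1 1).
Let hP := hilbP mb rho1 b_rho.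

(** Each of the four real components is approximated by a primitive that vanishes at 0 and 1; the
    image under tau is computed algebraically from the densities. *)
Lemma dirac_dense : dense_dom b T.
Proof.
move=> f /hP Lf eps eps0; have [[La Lb] [Lc Ld]] := Lf.
have r0 : 0 < 1 - rho by rewrite subr_gt0.
(* The comparison with the unweighted norm has the factor 2 / (1 - rho), which turns [e] into eps^2
   / 4; each real component may contribute e / 4. *)
pose e := eps ^+ 2 * (1 - rho) / 8.
have e0 : 0 < e / 4 by rewrite !divr_gt0 ?mulr_gt0 ?exprn_gt0.
have [F1 [k1 [p1 l1 F10 F11 F1e]]] := L2_dense e0 La.
have [F2 [k2 [p2 l2 F20 F21 F2e]]] := L2_dense e0 Lb.
have [F3 [k3 [p3 l3 F30 F31 F3e]]] := L2_dense e0 Lc.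
have [F4 [k4 [p4 l4 F40 F41 F4e]]] := L2_dense e0 Ld.
pose x (t : R) : C := (F1 t +i* F2 t)%C; pose y (t : R) : C := (F3 t +i* F4 t)%C.
pose kx (t : R) : C := (k1 t +i* k2 t)%C; pose ky (t : R) : C := (k3 t +i* k4 t)%C.
have px : cprim x kx by split.
have py : cprim y ky by split.
have Lkx : cL2 kx by split.
have Lky : cL2 ky by split.
have Lxy : vL2 (vec x y) by apply: vec_vL2; apply/cbm_L2; [exact: cprim_cbm px|exact: cprim_cbm py].
pose d (t : R) : C := 4 * (2 * (1 - `|b t| ^+ 2))^-1.
pose h0 t := d t * (- 'i * ((1 + `|b t| ^+ 2) * kx t - 2 * b t * ky t)).
pose h1 t := d t * (- 'i * (2 * (b t)^* * kx t - (1 + `|b t| ^+ 2) * ky t)).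
have cb := b_cbm mb rho1 b_rho; have cd := d_cbm mb rho1 b_rho; have cb2 := b2_cbm mb rho1 b_rho.
have cd' : cbm d by apply: cbmM => //; exact: cbm_cst.
have c1b2 : cbm (fun t => 1 + `|b t| ^+ 2) by apply: cbmD => //; exact: cbm_cst.
have Lh : vL2 (vec h0 h1).
  apply: vec_vL2; apply: cL2M => //; apply: cL2Z; apply: cL2B; apply: cL2M => //;
    apply: cbmM; by [exact: cbm_cst|exact: cbmJ|].
exists (vec x y); split.
  exists (vec h0 h1); apply/(dirac_opP mb rho1 b_rho); split => //; exists x, y; split; last exact: aeW.
  have ii : 'i * 'i = -1 :> C by rewrite -expr2 sqrCi.
  have nz t : 0 <= t < 1 -> 1 - b t * (b t)^* != 0.
    move=> t01; rewrite mul_conjE -[1](rmorph1 (real_complex R)) -rmorphB fmorph_eq0.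
    by rewrite subr_eq0 gt_eqF// (le_lt_trans (b_rho t01)).
  split.
  - apply: eq_cprim px => // t t01; rewrite vec0 vec1 /h0 /h1 /W0 /d !normCK.
    rewrite -[LHS]mul1r -[1 in LHS]opprK -ii; field; exact: nz.
  - apply: eq_cprim py => // t t01; rewrite vec0 vec1 /h0 /h1 /W1 /d !normCK.
    rewrite -[LHS]mul1r -[1 in LHS]opprK -ii; field; exact: nz.
  - by rewrite /x /y F10 F20 F30 F40.
  - by rewrite /x /y F11 F21 F31 F41 mulr0.
have Lfg : vL2 (fun t => f t - vec x y t) by exact: vL2B.
have LB (u v : R -> R) : L2 u -> L2 v -> intg (fun t => (u t - v t) ^+ 2).
  by move=> Lu Lv; have [_] := L2D Lu (L2N Lv).
have bF (F k : R -> R) : is_prim F k -> L2 F by move=> pF; apply: bounded_mfun_L2; exact: bounded_mfun_prim pF.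
have i1 := LB _ _ La (bF _ _ p1); have i2 := LB _ _ Lb (bF _ _ p2).
have i3 := LB _ _ Lc (bF _ _ p3); have i4 := LB _ _ Ld (bF _ _ p4).
have Ie : \int[mu]_(t in I01) (nrm2 ((f t - vec x y t) 0 0) + nrm2 ((f t - vec x y t) 1 0)) < e.
  have mI := @measurableI01 R.
  have -> : \int[mu]_(t in I01) (nrm2 ((f t - vec x y t) 0 0) + nrm2 ((f t - vec x y t) 1 0)) =
    \int[mu]_(t in I01) (((Re (cpt f 0 t) - F1 t) ^+ 2 + (Im (cpt f 0 t) - F2 t) ^+ 2) +
     ((Re (cpt f 1 t) - F3 t) ^+ 2 + (Im (cpt f 1 t) - F4 t) ^+ 2)).
    by apply: eq_Rintegral => t _; rewrite !mxE /nrm2 !cE.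
  rewrite (RintegralD mI (intgD i1 i2) (intgD i3 i4)) (RintegralD mI i1 i2) (RintegralD mI i3 i4).
  move: F1e F2e F3e F4e; rewrite /=; lra.
have := hnorm_le mb rho1 b_rho Lfg (ltW Ie).
have -> : 2 / (1 - rho) * e = eps ^+ 2 / 4 by rewrite /e; field; rewrite gt_eqF.
move=> H; rewrite /hnorm -[ltRHS]gtr0_norm// -sqrtr_sqr ltr_sqrt ?exprn_gt0//.
apply: (le_lt_trans H); rewrite ltr_pdivrMr// ltr_pMr ?exprn_gt0//.
by rewrite ltr1n.
Qed.

(** The candidate for the spectrum; [S_solution] describes it as the zero set of the characteristic
    function of the boundary problem. *)
Variable S : set C.
Hypothesis S_real : forall z, S z -> z^* = z.
Hypothesis S_neq0 : ~ S 0.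
Hypothesis S_solution : forall z, exists y00 y10 y01 y11 : R -> C,
  [/\ dirac_solution b z y00 y10, dirac_solution b z y01 y11,
    [/\ y00 0 = 1, y10 0 = 0, y01 0 = 0 & y11 0 = 1] &
    y00 1 + y01 1 - b1 * (y10 1 + y11 1) = 0 <-> S z].

Lemma dirac_onto z : ~ S z -> exists M : R, forall f, hilb b f -> exists g h,
  [/\ T g h, ae_eq01 (fun t => h t - z *: g t) f & hnorm b g <= M * hnorm b f].
Proof.
move=> Sz; have [y00 [y10 [y01 [y11 [f0 f1 [e1 e2 e3 e4] ds]]]]] := S_solution z.
apply: (resolvent_onto mb rho1 b_rho f0 f1 e1 e2 e3 e4).
by apply/eqP => /ds.
Qed.

(** If T g = z g, surjectivity at conj z, which lies outside S because S is real, gives g' with T g'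
    - (conj z) g' = g. By symmetry <g, g> = <T g - z g, g'> = 0. *)
Lemma dirac_resolvent z : ~ S z -> resolvent b T z.
Proof.
move=> Sz; split; last exact: dirac_onto.
move=> g h Tgh hz.
have SzJ : ~ S (z^*).
  by move=> SJ; apply: Sz; have := S_real SJ; rewrite conjCK => ->.
have /(dirac_opP mb rho1 b_rho)[Lg Lh _] := Tgh.
have [M /(_ g ((hP g).2 Lg))[g' [h' [Tgh' gE _]]]] := dirac_onto SzJ.
have /(dirac_opP mb rho1 b_rho)[Lg' Lh' _] := Tgh'.
have Lzg' : vL2 (fun t => z^* *: g' t) by exact: vL2Z.
apply: (inner_diag_eq0 mb rho1 b_rho Lg).
rewrite -(inner_aer mb rho1 b_rho Lg (vL2B Lh' Lzg') Lg gE).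
rewrite (innerBr mb rho1 b_rho Lg Lh' Lzg') (innerZr mb rho1 b_rho _ Lg Lg').
rewrite (dirac_op_sym mb rho1 b_rho b1_nrm Tgh Tgh').
rewrite (inner_ael mb rho1 b_rho Lg' Lh (vL2Z z Lg) hz).
by rewrite (innerZl mb rho1 b_rho _ Lg' Lg) subrr.
Qed.

(** For (u, w) in the graph of the adjoint choose v with T v = w and g with T g = u - v; both exist
    because 0 is not in S. Then <u - v, T g> = <w, g> - <w, g> = 0, so u = v. *)
Lemma dirac_self_adjoint : self_adjoint b T.
Proof.
split; first exact: dirac_dense.
have [M onto] := dirac_onto S_neq0.
have onto0 f : vL2 f -> exists g, T g f.
  move=> Lf; have [g [h [Tgh hf _]]] := onto f ((hP f).2 Lf); exists g.
  have [f0 df0 [Lg Lh gf hE]] := Tgh; exists f0 => //; split => //; first exact/hP.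
  by have := aeI hf hE; apply: aeS => t [H1 H2] t01; rewrite -H2// -H1// scale0r subr0.
move=> u w; split.
  move=> [/hP Lu /hP Lw adj]; have [v Tv] := onto0 w Lw.
  have /(dirac_opP mb rho1 b_rho)[Lv _ [x [y [dxy vE]]]] := Tv.
  have Luv := vL2B Lu Lv; have [g Tg] := onto0 _ Luv.
  have /(dirac_opP mb rho1 b_rho)[Lg _ _] := Tg.
  have uv0 : ae_eq01 (fun t => u t - v t) (fun _ => 0).
    apply: (inner_diag_eq0 mb rho1 b_rho Luv).
    rewrite (innerBl mb rho1 b_rho Luv Lu Lv) (adj _ _ Tg).
    by rewrite (dirac_op_sym mb rho1 b_rho b1_nrm Tv Tg) subrr.
  apply/(dirac_opP mb rho1 b_rho); split => //; exists x, y; split => //.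
  have := aeI uv0 vE; apply: aeS => t [H1 H2] t01; rewrite -H2//.
  by apply/eqP; rewrite -subr_eq0; apply/eqP; exact: H1.
move=> Tuw; have /(dirac_opP mb rho1 b_rho)[Lu Lw _] := Tuw.
split; [exact/hP|exact/hP|move=> g h Tgh].
exact: (dirac_op_sym mb rho1 b_rho b1_nrm Tuw Tgh).
Qed.

Lemma dirac_spectrum : spectrum b T = S.
Proof.
apply/seteqP; split=> z.
  by move=> nr; apply: contrapT => Sz; apply: nr; exact: dirac_resolvent.
move=> Sz [inj _].
have [y00 [y10 [y01 [y11 [[f00 f10] [f01 f11] [e1 e2 e3 e4] ds]]]]] := S_solution z.
have {ds}d0 := ds.2 Sz.
have px := cprimD f00 f01; have py := cprimD f10 f11; rewrite /= in px py.
pose x t := y00 t + y01 t; pose y t := y10 t + y11 t.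
have Lxy : vL2 (vec x y) by apply: vec_vL2; apply/cbm_L2; [exact: cprim_cbm px|exact: cprim_cbm py].
have Txy : T (vec x y) (fun t => z *: vec x y t).
  apply/(dirac_opP mb rho1 b_rho); split => //; first exact: vL2Z.
  exists x, y; split; last exact: aeW.
  have E0 t : (z *: vec x y t) 0 0 = z * x t by rewrite !mxE.
  have E1 t : (z *: vec x y t) 1 0 = z * y t by rewrite !mxE.
  split.
  - by apply: eq_cprim px => // t _; rewrite E0 E1 W0Z /x /y W0D; ring.
  - by apply: eq_cprim py => // t _; rewrite E0 E1 W1Z /x /y W1D; ring.
  - by rewrite /x /y e1 e2 e3 e4 add0r addr0.
  - by apply/eqP; rewrite -subr_eq0 d0.
have xy0 : ae_eq01 (vec x y) (fun _ => 0) by apply: inj Txy _; exact: aeW.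
(* The eigenfunction is a nonzero class: were it zero almost everywhere, so would be its density,
   and its first component would keep the value 1 which it has at 0. *)
have [[ix xE] _] := px.
apply: (@ae01_absurd _ (fun t => vec x y t = 0) _ xy0).
apply: aeW => t t01 xyt; have t01' : 0 <= t <= 1 by have /andP[-> /ltW] := t01.
have := xE t t01'; rewrite (ae_eq_prim ix (intg0 R) _ t).
  have [_ /(_ t t01')] := is_prim_cst (0 : R); rewrite add0r => <-.
  rewrite /= -/(x t) -/(x 0) -(vec0 x y t) xyt mxE /x e1 e3 !addr0 /= => /eqP.
  by rewrite eq_sym oner_eq0.
apply: aeS xy0 => s H s01 /=.
have x0 : x s = 0 by rewrite -(vec0 x y) H// mxE.
have y0 : y s = 0 by rewrite -(vec1 x y) H// mxE.
rewrite -mulrDr -mulrDr -W0D -/(x s) -/(y s) x0 y0 /W0.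
by rewrite !(mulr0, subr0).
Qed.

End Abstract.

(** * Orthogonal polynomials on the unit circle *)

Section Vdot.
Local Open Scope sesquilinear_scope.
Variables (R : realType) (n : nat).
Notation C := R[i].
Implicit Types (u v w : 'cV[C]_n) (V : 'M[C]_n).

Lemma vdotDr u v w : vdot u (v + w) = vdot u v + vdot u w.
Proof. by rewrite /vdot mulmxDr mxE. Qed.

Lemma vdotZr c u v : vdot u (c *: v) = c * vdot u v.
Proof. by rewrite /vdot -scalemxAr mxE. Qed.

Lemma vdotBr u v w : vdot u (v - w) = vdot u v - vdot u w.
Proof. by rewrite -scaleN1r vdotDr vdotZr mulN1r. Qed.

Lemma vdot_sumr (I : Type) (r : seq I) (P : pred I) (F : I -> 'cV[C]_n) u :
  vdot u (\sum_(i <- r | P i) F i) = \sum_(i <- r | P i) vdot u (F i).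
Proof. by rewrite /vdot mulmx_sumr summxE. Qed.

Lemma vdotE u v : vdot u v = \sum_i (u i 0)^* * v i 0.
Proof. by rewrite /vdot mxE; apply: eq_bigr => i _; rewrite !mxE. Qed.

Lemma vdot_herm u v : vdot u v = (vdot v u)^*.
Proof.
rewrite !vdotE rmorph_sum; apply: eq_bigr => i _.
by rewrite rmorphM/= conjCK mulrC.
Qed.

Lemma vdotZl c u v : vdot (c *: u) v = c^* * vdot u v.
Proof. by rewrite vdot_herm vdotZr rmorphM/= -vdot_herm. Qed.

Lemma vdotBl u v w : vdot (u - v) w = vdot u w - vdot v w.
Proof. by rewrite vdot_herm vdotBr rmorphB/= -!vdot_herm. Qed.

Lemma vdot_eq0 u : (vdot u u == 0) = (u == 0).
Proof.
apply/idP/eqP => [|->]; last by rewrite vdotE big1// => i _; rewrite mxE mulr0.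
rewrite vdotE psumr_eq0 => [/allP h|i _]; last by rewrite mulrC -normCK exprn_ge0.
apply/matrixP => i j; rewrite (ord1 j) mxE; apply/eqP.
by have := h i (mem_index_enum i); rewrite /= mulrC -normCK expf_eq0 normr_eq0.
Qed.

Lemma vdot_ge0 u : 0 <= vdot u u.
Proof. by rewrite vdotE sumr_ge0// => i _; rewrite mulrC -normCK exprn_ge0. Qed.

Lemma vdot_unitary V u v : V \is unitarymx -> vdot (V *m u) (V *m v) = vdot u v.
Proof.
move=> /unitarymxP VV; have {}VV : V^t* *m V = 1%:M by apply: mulmx1C.
by rewrite /vdot trmx_mul map_mxM mulmxA -[_ *m _ *m V]mulmxA VV mulmx1.
Qed.

End Vdot.

Section Opuc.
Variables (R : realType) (n : nat) (V : 'M[R[i]]_n) (e : 'cV[R[i]]_n).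
Notation C := R[i].
Implicit Types (p q : {poly C}).
Local Notation pv := (poly_vec V e).

Lemma poly_vecE m p : (size p <= m)%N -> pv p = \sum_(i < m) p`_i *: (V ^+ i *m e).
Proof.
move=> pm; rewrite /poly_vec (big_ord_widen m (fun i => p`_i *: (V ^+ i *m e)))//.
rewrite big_mkcond/=; apply: eq_bigr => i _; case: ltnP => // pi.
by rewrite nth_default// scale0r.
Qed.

Lemma poly_vecD p q : pv (p + q) = pv p + pv q.
Proof.
pose m := maxn (size p) (size q).
rewrite (@poly_vecE m (p + q)) ?(leq_trans (size_polyD _ _))//.
rewrite (@poly_vecE m p) ?leq_maxl// (@poly_vecE m q) ?leq_maxr// -big_split/=.
by apply: eq_bigr => i _; rewrite coefD scalerDl.
Qed.

Lemma poly_vecZ c p : pv (c *: p) = c *: pv p.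
Proof.
rewrite (@poly_vecE (size p) (c *: p)) ?size_scale_leq// /poly_vec scaler_sumr.
by apply: eq_bigr => i _; rewrite coefZ scalerA.
Qed.

Lemma poly_vec0 : pv 0 = 0.
Proof. by rewrite /poly_vec size_poly0 big_ord0. Qed.

Lemma poly_vecB p q : pv (p - q) = pv p - pv q.
Proof. by rewrite -scaleN1r poly_vecD poly_vecZ scaleN1r. Qed.

Lemma poly_vec_sum (r : seq {poly C}) (c : {poly C} -> C) :
  pv (\sum_(p <- r) c p *: p) = \sum_(p <- r) c p *: pv p.
Proof.
elim: r => [|p r IH]; first by rewrite !big_nil poly_vec0.
by rewrite !big_cons poly_vecD IH poly_vecZ.
Qed.

Lemma vdot_poly_vec_sum u (r : seq {poly C}) (c : {poly C} -> C) :
  vdot u (pv (\sum_(p <- r) c p *: p)) = \sum_(p <- r) c p * vdot u (pv p).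
Proof. by rewrite poly_vec_sum vdot_sumr; apply: eq_bigr => p _; rewrite vdotZr. Qed.

Lemma poly_vecX p : pv ('X * p) = V *m pv p.
Proof.
have sX : (size ('X * p)%R <= (size p).+1)%N.
  by apply: leq_trans (size_polyMleq _ _) _; rewrite size_polyX.
rewrite (poly_vecE sX) /poly_vec big_ord_recl coefXM/= scale0r add0r mulmx_sumr.
by apply: eq_bigr => i _; rewrite coefXM/= exprS -scalemxAr mulmxA.
Qed.

Local Notation gs := (gram_schmidt V e).

(** Agrees with [opuc] below n, but continues Gram-Schmidt where [opuc] switches to the
    characteristic polynomial. *)
Definition gs_poly k := nth 0 (gs k.+1) k.

Lemma size_gs k : size (gs k) = k.
Proof. by elim: k => //= k IH; rewrite size_rcons IH. Qed.

Lemma gsE k : gs k = [seq gs_poly i | i <- iota 0 k].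
Proof.
elim: k => // k IH; rewrite -[in RHS]addn1 iotaD map_cat -IH /= cats1.
by rewrite /gs_poly /= nth_rcons size_gs ltnn eqxx.
Qed.

Lemma gs_polyE k : gs_poly k = 'X^k - \sum_(p <- gs k)
      (vdot (pv p) (pv 'X^k) / vdot (pv p) (pv p)) *: p.
Proof. by rewrite /gs_poly /= nth_rcons size_gs ltnn eqxx. Qed.

Lemma size_gs_poly k : size (gs_poly k) = k.+1.
Proof.
elim/ltn_ind: k => k IH; rewrite gs_polyE size_polyDl ?size_polyXn// size_polyN.
rewrite ltnS gsE big_map big_seq.
apply: (big_ind (fun p : {poly C} => (size p <= k)%N)); first by rewrite size_poly0.
  by move=> p q pk qk; rewrite (leq_trans (size_polyD _ _))// geq_max pk qk.
move=> i; rewrite mem_iota add0n /= => ik.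
by rewrite (leq_trans (size_scale_leq _ _))// IH.
Qed.

Lemma gs_orth j k : (j < k)%N -> vdot (pv (gs_poly j)) (pv (gs_poly k)) = 0.
Proof.
elim/ltn_ind: k j => k IH j jk.
rewrite [gs_poly k]gs_polyE poly_vecB vdotBr vdot_poly_vec_sum gsE big_map.
rewrite (bigD1_seq j) ?mem_iota ?iota_uniq//= big1_seq ?addr0.
  (* If the norm vanishes, the quotient has the default value 0, but the vector is then zero and
     both terms vanish. *)
  have [/eqP|nz] := eqVneq (vdot (pv (gs_poly j)) (pv (gs_poly j))) 0.
    rewrite vdot_eq0 => /eqP ->.
    by rewrite -[0 in LHS](scale0r (0 : 'cV[C]_n)) !vdotZl rmorph0 !mul0r ?mulr0 subrr.
  by rewrite divfK// subrr.
move=> i /andP[ij]; rewrite mem_iota add0n => /= ik.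
have [lt|gt|E] := ltngtP i j; last by rewrite E eqxx in ij.
  by rewrite (vdot_herm (pv (gs_poly j)) (pv (gs_poly i))) (IH _ jk)// rmorph0 mulr0.
by rewrite (IH _ ik j gt) mulr0.
Qed.

Lemma gs_orthX j k : (j < k)%N -> vdot (pv 'X^j) (pv (gs_poly k)) = 0.
Proof.
move=> jk; have -> : 'X^j = gs_poly j + \sum_(p <- gs j)
      (vdot (pv p) (pv 'X^j) / vdot (pv p) (pv p)) *: p.
  by rewrite gs_polyE subrK.
rewrite vdot_herm poly_vecD vdotDr vdot_poly_vec_sum vdot_herm gs_orth//.
rewrite rmorph0 add0r gsE big_map big1_seq ?rmorph0// => i; rewrite mem_iota /= add0n => ij.
by rewrite (vdot_herm (pv (gs_poly k)) (pv (gs_poly i))) (gs_orth (ltn_trans ij jk)) rmorph0 mulr0.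
Qed.

Lemma gs_orth_poly q k : (size q <= k)%N -> vdot (pv q) (pv (gs_poly k)) = 0.
Proof.
move=> qk; rewrite vdot_herm -[q]coefK poly_def.
have -> : pv (\sum_(i < size q) q`_i *: 'X^i) = \sum_(i < size q) q`_i *: pv 'X^i.
  apply: (big_ind2 (fun p v => pv p = v)); first exact: poly_vec0.
    by move=> p u p' u' <- <-; rewrite poly_vecD.
  by move=> i _; rewrite poly_vecZ.
rewrite vdot_sumr big1 ?rmorph0// => i _.
by rewrite vdotZr vdot_herm gs_orthX ?rmorph0 ?mulr0// (leq_trans (ltn_ord i)).
Qed.

End Opuc.

(** * The Szego recursion and the Verblunsky coefficients *)

Section Szego.
Local Open Scope sesquilinear_scope.
Variables (R : realType) (n : nat) (n_gt0 : (0 < n)%N).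
Notation C := R[i].
Variables (V : 'M[C]_n) (V_unitary : V \is unitarymx) (lam : 'I_n -> R).
Hypotheses (eigen_distinct : injective (fun k => cexpi (lam k)))
  (eigen_V : forall z : C, eigenvalue V z <-> exists k, z = cexpi (lam k))
  (eigen_neq1 : ~~ eigenvalue V 1).
Variable e : 'cV[C]_n.
Hypothesis e_cyclic : forall (z : C) (v : 'cV[C]_n),
     v != 0 -> V *m v = z *: v -> vdot v e != 0.
Variable alpha : nat -> C.
Hypothesis alphaP : verblunsky V e alpha.

Local Notation pv := (poly_vec V e).
Local Notation Phi := (opuc V e).
Local Notation Phis := (opuc_star V e).

Lemma cexpi_conj (x : R) : cexpi x * (cexpi x)^* = 1 :> C.
Proof. by rewrite mul_conjE /nrm2 /= cos2Dsin2. Qed.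

Lemma mul_poly_vec (v : 'rV[C]_n) z (q : {poly C}) : v *m V = z *: v -> v *m pv q = q.[z] *: (v *m e).
Proof.
move=> vz; have vX i : v *m (V ^+ i *m e) = z ^+ i *: (v *m e).
  elim: i => [|i IH]; first by rewrite !expr0 mul1mx scale1r.
  by rewrite exprS -mulmxA mulmxA vz -scalemxAl IH scalerA -exprS.
rewrite /poly_vec mulmx_sumr horner_coef scaler_suml; apply: eq_bigr => i _.
by rewrite -scalemxAr vX scalerA.
Qed.

(** A left eigenvector v for z satisfies v q(V) e = q(z) v e, and v e is nonzero by cyclicity,
    because the adjoint of v is a right eigenvector. So q(V) e = 0 would give q as many as n
    distinct roots. *)
Lemma poly_vec_neq0 (q : {poly C}) : q != 0 -> (size q <= n)%N -> pv q != 0.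
Proof.
move=> q0 qn; apply/negP => /eqP pq0.
pose rs := [seq cexpi (lam k) | k <- enum 'I_n].
have urs : uniq rs by rewrite map_inj_uniq ?enum_uniq//; exact: eigen_distinct.
have : all (root q) rs.
  apply/allP => _ /mapP[k _ ->]; set z := cexpi (lam k).
  have zz : z * z^* = 1 by exact: cexpi_conj.
  have /eigenvalueP[v vz v0] : eigenvalue V z by apply/eigen_V; exists k.
  have := mul_poly_vec q vz; rewrite pq0 mulmx0 => /esym/eqP.
  rewrite scaler_eq0 => /orP[|/eqP ve0]; first by rewrite /root.
  exfalso; have vt0 : v^t* != 0.
    apply: contra v0 => /eqP v0; apply/eqP/matrixP => i j.
    by have := congr1 (fun M : 'cV[C]_n => M j i) v0; rewrite !mxE => /eqP; rewrite conjC_eq0 => /eqP.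
  have := @e_cyclic z _ vt0.
  (* Take the adjoint of v V = z v and multiply by V from the left; |z| = 1 moves conj z to the
     other side as z. *)
  have : V *m v^t* = z *: v^t*.
    have E : (v *m V)^t* = z^* *: v^t* by rewrite vz; apply/matrixP => i j; rewrite !mxE rmorphM.
    rewrite trmx_mul map_mxM in E.
    have := congr1 (mulmx V) E; rewrite mulmxA (unitarymxP V_unitary) mul1mx -scalemxAr => E'.
    by rewrite [in RHS]E' scalerA zz scale1r.
  move=> vz' /(_ vz'); rewrite /vdot.
  have -> : (v^t*)^t* = v by apply/matrixP => i j; rewrite !mxE conjCK.
  by rewrite ve0 mxE eqxx.
move=> /max_poly_roots -/(_ q0 urs); rewrite size_map size_enum_ord.
by rewrite ltnNge qn.
Qed.

Lemma szego_rec k : (k < n)%N ->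
  Phi k.+1 = 'X * Phi k - (alpha k)^* *: Phis k /\
  Phis k.+1 = Phis k - alpha k *: ('X * Phi k).
Proof.
move=> /alphaP H; have H0 := congr1 (fun M : 'cV_2 => M 0 0) H.
have H1 := congr1 (fun M : 'cV_2 => M 1 0) H.
move: H0 H1; rewrite !mxE !big_ord_recl !big_ord0 !mxE !big_ord_recl !big_ord0 !mxE /=.
move=> -> ->; rewrite -!mul_polyC; split; ring.
Qed.

Let hE := (@hornerD, @hornerN, @hornerZ, @hornerM, @hornerX, @hornerC).

Lemma opuc0 : Phi 0 = 1.
Proof. by rewrite /opuc n_gt0 /= big_nil subr0 expr0. Qed.

Lemma opuc_star0 : Phis 0 = 1.
Proof.
rewrite /opuc_star /revpoly opuc0; apply/polyP => i.
rewrite coef_poly coefC ltnS; case: i => [|i] /=; rewrite coefC//=; exact: conjc1.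
Qed.

Lemma opuc_star_at0 k : (k <= n)%N -> (Phis k).[0] = 1.
Proof.
elim: k => [_|k IH kn]; first by rewrite opuc_star0 hornerC.
have [_ ->] := szego_rec kn.
by rewrite !hE IH ?(ltnW kn)// mul0r mulr0 subr0.
Qed.

(** At z = 1 the two rows of the recursion are conjugate to each other. This is why gamma_k and
    alpha_k have the same modulus. *)
Lemma opuc_star_at1 k : (k <= n)%N -> (Phis k).[1] = ((Phi k).[1])^*.
Proof.
elim: k => [_|k IH kn]; first by rewrite opuc_star0 opuc0 hornerC rmorph1.
have [-> ->] := szego_rec kn; rewrite !hE IH ?(ltnW kn)// !mul1r.
by rewrite rmorphB rmorphM/= !conjCK.
Qed.

Lemma opucE k : (k < n)%N -> Phi k = gs_poly V e k.
Proof. by rewrite /opuc => ->. Qed.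

(** Both rows of the recursion expand to the same cross terms, V being unitary, so equality of the
    norms propagates. *)
Lemma norm_opuc_star k : (k <= n)%N ->
  vdot (pv (Phis k)) (pv (Phis k)) = vdot (pv (Phi k)) (pv (Phi k)).
Proof.
elim: k => [_|k IH kn]; first by rewrite opuc_star0 opuc0.
have [-> ->] := szego_rec kn; have {IH} := IH (ltnW kn).
rewrite !poly_vecB !poly_vecZ poly_vecX.
rewrite !(vdotBl, vdotBr, vdotZl, vdotZr) !vdot_unitary// conjCK => ->.
by ring.
Qed.

(** The reversed polynomial has degree at most k, hence is orthogonal to Phi_(k+1). Pythagoras gives
    |Phi_(k+1)|^2 = (1 - |alpha_k|^2) |Phi_k|^2, and the left side is positive. *)
Lemma alpha_lt1 k : (k.+1 < n)%N -> nrm2 (alpha k) < 1.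
Proof.
move=> kn; have kn' := ltn_trans (ltnSn k) kn; have [r1 r2] := szego_rec kn'.
have orth : vdot (pv (Phis k)) (pv (Phi k.+1)) = 0.
  by rewrite (opucE kn); apply: gs_orth_poly; exact: size_poly.
set u := pv (Phi k); set s := pv (Phis k); set u' := pv (Phi k.+1).
have u'E : u' = V *m u - (alpha k)^* *: s by rewrite /u' r1 poly_vecB poly_vecZ poly_vecX.
have nu : vdot s s = vdot u u by rewrite norm_opuc_star// ltnW.
have u'0 : vdot u' u' != 0.
  rewrite vdot_eq0 /u' (opucE kn) poly_vec_neq0 ?size_gs_poly//.
  by rewrite -size_poly_eq0 size_gs_poly.
have E : vdot u' u' = (1 - alpha k * (alpha k)^*) * vdot u u.
  have o1 : vdot s (V *m u) = (alpha k)^* * vdot s s.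
    by apply/eqP; rewrite -subr_eq0 -vdotZr -vdotBr -u'E; apply/eqP.
  have o2 : vdot u' s = 0 by rewrite vdot_herm orth rmorph0.
  rewrite [in X in vdot _ X]u'E vdotBr vdotZr o2 mulr0 subr0 u'E vdotBl vdotZl.
  by rewrite conjCK o1 nu vdot_unitary//; ring.
have ge0 := vdot_ge0 u'; have ugt0 := vdot_ge0 u.
have : 0 < vdot u' u' by rewrite lt_neqAle eq_sym u'0.
rewrite E mul_conjE => H; have u0 : 0 < vdot u u.
  by rewrite lt_neqAle ugt0 andbT; apply/eqP => u00; move: H; rewrite -u00 mulr0 ltxx.
move: H; rewrite pmulr_lgt0// subr_gt0.
by rewrite -[X in _ < X](rmorph1 (real_complex R)) ltcR.
Qed.

(** At z = 0 the recursion gives Phi_n(0) = - conj alpha_(n-1), while Phi_n(0) is up to sign the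
    determinant of a unitary matrix. *)
Lemma alpha_last : nrm2 (alpha n.-1) = 1.
Proof.
have nn : (n.-1 < n)%N by rewrite prednK.
have [r1 _] := szego_rec nn; rewrite prednK// in r1.
have cpE : Phi n = char_poly V by rewrite /opuc ltnn.
have : (char_poly V).[0] = - (alpha n.-1)^*.
  by rewrite -cpE r1 !hE opuc_star_at0 ?leq_pred// mul0r mulr1 sub0r.
rewrite horner_coef0 char_poly_det => H.
have dd : \det V * (\det V)^* = 1.
  have := congr1 determinant (unitarymxP V_unitary); rewrite det_mulmx det1.
  by rewrite det_map_mx det_tr.
have := congr1 (fun x : C => x * x^*) H.
rewrite rmorphM rmorphXn rmorphN rmorph1 rmorphN/= conjCK mulrACA dd mulr1 -expr2 sqrr_sign.
rewrite mulrNN mulrC mul_conjE => /(congr1 (@complex.Re R)) /=.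
by move=> <-.
Qed.

Variable gamma : nat -> C.
Hypothesis gammaE : forall k, (k < n)%N ->
  gamma k = (alpha k)^* * (Phis k).[1] / (Phi k).[1].

Lemma gamma_nrm2 k : (k < n)%N -> (Phi k).[1] != 0 -> nrm2 (gamma k) = nrm2 (alpha k).
Proof.
move=> kn P0; rewrite gammaE// opuc_star_at1 ?(ltnW kn)//.
have E : nrm2 ((alpha k)^* * ((Phi k).[1])^* / (Phi k).[1]) * nrm2 ((Phi k).[1]) =
   nrm2 (alpha k) * nrm2 ((Phi k).[1]).
  by rewrite -nrm2M divfK// nrm2M !nrm2J.
by apply/(mulIf _ E); rewrite nrm2_eq0.
Qed.

Lemma opuc_rec1 k : (k < n)%N -> (Phi k).[1] != 0 ->
  (Phi k.+1).[1] = (Phi k).[1] * (1 - gamma k).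
Proof.
move=> kn P0; have [-> _] := szego_rec kn; rewrite !hE gammaE//.
by field.
Qed.

Lemma opuc_neq0 k : (k < n)%N -> (Phi k).[1] != 0.
Proof.
elim: k => [_|k IH kn]; first by rewrite opuc0 hornerC oner_neq0.
have kn' := ltn_trans (ltnSn k) kn; have P0 := IH kn'.
rewrite opuc_rec1// mulf_neq0// subr_eq0; apply/eqP => g1.
have := alpha_lt1 kn; rewrite -(gamma_nrm2 kn' P0) -g1 /nrm2 /= expr1n expr0n addr0.
by rewrite ltxx.
Qed.

(** The value 1 would force Phi_(k+1)(1) = 0: excluded below n by the previous lemma, and at n
    because 1 is not an eigenvalue. *)
Lemma gamma_neq1 k : (k < n)%N -> gamma k != 1.
Proof.
move=> kn; have P0 := opuc_neq0 kn; have := opuc_rec1 kn P0 => E.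
apply/eqP => g1; move: E; rewrite g1 subrr mulr0.
have [kn1|kn1] := ltnP k.+1 n; first by move/eqP; rewrite (negPf (opuc_neq0 kn1)).
have -> : k.+1 = n by apply/eqP; rewrite eqn_leq kn1 kn.
rewrite /opuc ltnn => /eqP H; move: eigen_neq1.
by rewrite eigenvalue_root_char /root H.
Qed.

Lemma gamma_lt1 k : (k.+1 < n)%N -> nrm2 (gamma k) < 1.
Proof.
move=> kn; have kn' := ltn_trans (ltnSn k) kn.
by rewrite gamma_nrm2 ?opuc_neq0//; exact: alpha_lt1.
Qed.

Lemma gamma_last : nrm2 (gamma n.-1) = 1.
Proof.
have nn : (n.-1 < n)%N by rewrite prednK.
by rewrite gamma_nrm2 ?opuc_neq0//; exact: alpha_last.
Qed.

(* The Szego recursion after normalisation by the values at 1, see psiE. *)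
Fixpoint psi (z : C) k : 'cV[C]_2 :=
  if k is j.+1 then Atilde (gamma j) *m cv2 (z * psi z j 0 0) (psi z j 1 0)
  else cv2 1 1.

Lemma psiE z k : (k < n)%N ->
  psi z k = cv2 ((Phi k).[z] / (Phi k).[1]) ((Phis k).[z] / (Phis k).[1]).
Proof.
elim: k => [_|k IH kn].
  by rewrite opuc0 opuc_star0 !hornerC divr1.
have kn' := ltn_trans (ltnSn k) kn; have P0 := opuc_neq0 kn'; have P1 := opuc_neq0 kn.
have S1 := opuc_star_at1 (ltnW kn').
have [r1 r2] := szego_rec kn'; have g1 := gamma_neq1 kn'.
have P1E := opuc_rec1 kn' P0.
have S1E : (Phis k.+1).[1] = (Phis k).[1] * (1 - (gamma k)^*).
  by rewrite (opuc_star_at1 (ltnW kn)) P1E rmorphM rmorphB rmorph1 S1.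
have Ps0 : (Phis k).[1] != 0 by rewrite S1 conjC_eq0.
have h1 : 1 - gamma k != 0 by rewrite subr_eq0 eq_sym.
have h2 : 1 - (gamma k)^* != 0 by rewrite -(rmorph1 (@Num.conj_op C)) -rmorphB conjC_eq0.
have ga : gamma k * (Phi k).[1] = (alpha k)^* * (Phis k).[1] by rewrite gammaE// divfK.
have gaJ : (gamma k)^* * (Phis k).[1] = alpha k * (Phi k).[1].
  have := congr1 (@Num.conj_op C) ga; rewrite !rmorphM/= S1 !conjCK => ->.
  by [].
rewrite /= (IH kn') !cv2E.
apply: cv2_eq; rewrite cv2E ?P1E ?S1E mxE !big_ord_recl big_ord0 !mxE /= ?r1 ?r2 !hE.
  have -> : (alpha k)^* = gamma k * (Phi k).[1] / (Phis k).[1] by rewrite ga mulfK.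
  by field; rewrite P0 Ps0 h1.
have -> : alpha k = (gamma k)^* * (Phis k).[1] / (Phi k).[1] by rewrite gaJ mulfK.
by field; rewrite P0 Ps0 h2.
Qed.

(** Only the first row of the last recursion step is used, as it produces the characteristic
    polynomial; the matrix [Atilde (gamma n.-1)] itself is singular, since |gamma_(n-1)| = 1. *)
Lemma eigenvalue_psi z : eigenvalue V z <->
  z * psi z n.-1 0 0 = gamma n.-1 * psi z n.-1 1 0.
Proof.
have nn : (n.-1 < n)%N by rewrite prednK.
have P0 := opuc_neq0 nn; have S1 := opuc_star_at1 (ltnW nn).
have Ps0 : (Phis n.-1).[1] != 0 by rewrite S1 conjC_eq0.
rewrite psiE// !cv2E eigenvalue_root_char /root.
have [r1 _] := szego_rec nn; rewrite prednK// in r1.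
have <- : Phi n = char_poly V by rewrite /opuc ltnn.
rewrite r1 !hE gammaE//.
have -> : z * (Phi n.-1).[z] - (alpha n.-1)^* * (Phis n.-1).[z] =
  (Phi n.-1).[1] * (z * ((Phi n.-1).[z] / (Phi n.-1).[1]) -
   (alpha n.-1)^* * (Phis n.-1).[1] / (Phi n.-1).[1] * ((Phis n.-1).[z] / (Phis n.-1).[1])).
  by field; rewrite P0 Ps0.
rewrite mulf_eq0 (negPf P0) /= subr_eq0; split=> /eqP //.
Qed.

End Szego.

(** * The path in the hyperbolic plane *)

Section Path.
Variable R : realType.
Notation C := R[i].
Implicit Types (p q g x y : C).

Definition su p q : 'M[C]_2 := mx2 p q q^* p^*.

Lemma mx2_mul (a b c d a' b' c' d' : C) : mx2 a b c d *m mx2 a' b' c' d' =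
  mx2 (a * a' + b * c') (a * b' + b * d') (c * a' + d * c') (c * b' + d * d').
Proof.
apply/matrixP; apply: ord2P; apply: ord2P;
  by rewrite !mxE !big_ord_recl big_ord0 !mxE /= addr0.
Qed.

Lemma mx2_cv2 (a b c d x y : C) : mx2 a b c d *m cv2 x y = cv2 (a * x + b * y) (c * x + d * y).
Proof.
by apply: cv2_eq; rewrite !mxE !big_ord_recl big_ord0 !mxE /= addr0.
Qed.

Lemma mx2_1 : mx2 1 0 0 1 = 1 :> 'M[C]_2.
Proof. by apply/matrixP; apply: ord2P; apply: ord2P; rewrite !mxE. Qed.

Lemma su_mul p q p' q' : su p q *m su p' q' = su (p * p' + q * q'^*) (p * q' + q * p'^*).
Proof. by rewrite /su mx2_mul !(rmorphD, rmorphM)/= !conjCK; congr mx2; ring. Qed.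

(** [nrm2 p - nrm2 q] is the determinant of [su p q]; its positivity keeps the points of the path
    inside the unit disc. *)
Lemma nrm2_su p q p' q' :
  nrm2 (p * p' + q * q'^*) - nrm2 (p * q' + q * p'^*) =
  (nrm2 p - nrm2 q) * (nrm2 p' - nrm2 q').
Proof. by rewrite /nrm2 !cE; ring. Qed.

Definition su_inv g : 'M[C]_2 :=
  su ((1 - g) / (1 - g * g^*)) (g * (1 - g^*) / (1 - g * g^*)).

(** An inverse of the shape [su] with positive determinant puts all the products [Qmx] into the same
    class. *)
Lemma Atilde_inv g : g != 1 -> nrm2 g < 1 ->
  [/\ Atilde g \in unitmx, invmx (Atilde g) = su_inv g,
      su_inv g *m Atilde g = 1 &
      nrm2 (g * (1 - g^*) / (1 - g * g^*)) < nrm2 ((1 - g) / (1 - g * g^*))].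
Proof.
move=> g1 gn; have n0 : 1 - g * g^* != 0.
  by rewrite mul_conjE -[1](rmorph1 (real_complex R)) -rmorphB fmorph_eq0 subr_eq0 gt_eqF.
have h1 : 1 - g != 0 by rewrite subr_eq0 eq_sym.
have h2 : 1 - g^* != 0 by rewrite -(rmorph1 (@Num.conj_op C)) -rmorphB conjC_eq0.
have nJ : (1 - g * g^*)^* = 1 - g * g^* by rewrite rmorphB rmorphM rmorph1/= conjCK mulrC.
have E : su_inv g *m Atilde g = 1.
  rewrite /su_inv /su !fmorph_div !(rmorphM, rmorphB, rmorph1)/= !conjCK.
  rewrite /Atilde mx2_mul -mx2_1.
  by congr mx2; field; rewrite ?n0 ?h1 ?h2 // [g^* * g]mulrC n0.
have E' := mulmx1C E; have [_ u] := mulmx1_unit E.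
split => //; first by rewrite -[LHS]mul1mx -[1%:M]E -mulmxA mulmxV// mulmx1.
rewrite !nrm2M; rewrite -subr_gt0 -mulrBl mulr_gt0//; last first.
  by rewrite lt_neqAle nrm2_ge0 andbT eq_sym nrm2_eq0 invr_eq0.
have -> : nrm2 (1 - g^*) = nrm2 (1 - g) by rewrite -[RHS]nrm2J rmorphB rmorph1.
rewrite -[X in X - _]mul1r -mulrBl mulr_gt0 ?subr_gt0//.
by rewrite lt_neqAle nrm2_ge0 andbT eq_sym nrm2_eq0.
Qed.

(** Multiplied by diag(i, -i), the right sides are Q (i x / 2, - i y / 2); so the system decouples
    in the coordinates Q^-1 g. *)
Lemma su_W p q x y : nrm2 q < nrm2 p ->
  W0 (q / p^*) (p * x + q * y) (q^* * x + p^* * y) = 2^-1 * (p * x - q * y) /\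
  W1 (q / p^*) (p * x + q * y) (q^* * x + p^* * y) = - 2^-1 * (q^* * x - p^* * y).
Proof.
move=> qp; have p0 : p != 0 by rewrite -nrm2_eq0 gt_eqF// (le_lt_trans (nrm2_ge0 q)).
have pJ0 : p^* != 0 by rewrite conjC_eq0.
have D0 : p * p^* - q * q^* != 0.
  by rewrite !mul_conjE -rmorphB fmorph_eq0 subr_eq0 gt_eqF.
rewrite /W0 /W1 normCK !fmorph_div /= conjCK.
by split; field; rewrite p0 pJ0 [p^* * p]mulrC D0.
Qed.

Variables (n : nat) (n_gt0 : (0 < n)%N) (gamma : nat -> C).
Hypotheses (gamma_neq1 : forall k, (k < n)%N -> gamma k != 1)
  (gamma_lt1 : forall k, (k.+1 < n)%N -> nrm2 (gamma k) < 1)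
  (gamma_last : nrm2 (gamma n.-1) = 1).

Definition Qmx k : 'M[C]_2 := \prod_(j < k) invmx (Atilde (gamma j)).

Definition Qp k := Qmx k 0 0.
Definition Qq k := Qmx k 0 1.

Lemma QmxS k : Qmx k.+1 = Qmx k *m invmx (Atilde (gamma k)).
Proof. by rewrite /Qmx big_ord_recr. Qed.

Lemma QmxE k : (k < n)%N -> Qmx k = su (Qp k) (Qq k) /\ nrm2 (Qq k) < nrm2 (Qp k).
Proof.
have suP p q : su p q = su (su p q 0 0) (su p q 0 1) by rewrite !mxE.
suff H : (k < n)%N -> exists p q, Qmx k = su p q /\ nrm2 q < nrm2 p.
  by move=> /H[p [q [E h]]]; rewrite /Qp /Qq E !mxE.
elim: k => [_|k IH kn].
  exists 1, 0; rewrite /Qmx big_ord0 /su rmorph0 rmorph1 mx2_1; split => //.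
  by rewrite /nrm2 /= !expr0n expr1n !addr0 ltr01.
have kn' := ltn_trans (ltnSn k) kn; have [p [q [E h]]] := IH kn'.
have [_ iE _ h'] := Atilde_inv (gamma_neq1 kn') (gamma_lt1 kn).
rewrite QmxS E iE /su_inv su_mul; eexists; eexists; split; first reflexivity.
by rewrite -subr_gt0 nrm2_su mulr_gt0// subr_gt0.
Qed.

Lemma Qp_neq0 k : (k < n)%N -> Qp k != 0.
Proof.
by move=> /QmxE[_ h]; rewrite -nrm2_eq0 gt_eqF// (le_lt_trans (nrm2_ge0 (Qq k))).
Qed.

Lemma path_vec_lt k : (k < n)%N -> path_vec n gamma k = cv2 (Qq k) (Qp k)^*.
Proof.
move=> kn; rewrite /path_vec kn -/(Qmx k); have [-> _] := QmxE kn.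
by rewrite /su mx2_cv2 !mulr0 !add0r !mulr1.
Qed.

Lemma path_vec_last : path_vec n gamma n = cv2 (Qp n.-1 * gamma n.-1 + Qq n.-1)
   ((Qq n.-1)^* * gamma n.-1 + (Qp n.-1)^*).
Proof.
have nn : (n.-1 < n)%N by rewrite prednK.
rewrite /path_vec ltnn -/(Qmx n.-1); have [-> _] := QmxE nn.
by rewrite /su mx2_cv2 !mulr1.
Qed.

Lemma path_pt_lt k : (k < n)%N -> path_pt n gamma k = Qq k / (Qp k)^*.
Proof. by move=> kn; rewrite /path_pt /proj_ratio path_vec_lt// !cv2E. Qed.

Lemma path_pt_nrm2 k : (k < n)%N -> nrm2 (path_pt n gamma k) < 1.
Proof.
move=> kn; rewrite path_pt_lt//; have [_ h] := QmxE kn.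
have p0 : 0 < nrm2 (Qp k) by exact: le_lt_trans (nrm2_ge0 _) h.
rewrite -(ltr_pM2r p0) mul1r -(nrm2J (Qp k)) -nrm2M divfK ?nrm2J//.
by rewrite conjC_eq0 Qp_neq0.
Qed.

(** The first term has modulus |q|, the second |p| > |q|. *)
Lemma path_last_neq0 : (Qq n.-1)^* * gamma n.-1 + (Qp n.-1)^* != 0.
Proof.
have nn : (n.-1 < n)%N by rewrite prednK.
have [_ h] := QmxE nn; apply/eqP => /eqP; rewrite addr_eq0 => /eqP E.
have := congr1 (@nrm2 R) E; rewrite nrm2M gamma_last mulr1 nrm2N !nrm2J => E'.
by rewrite E' ltxx in h.
Qed.

Lemma path_pt_last : path_pt n gamma n =
  (Qp n.-1 * gamma n.-1 + Qq n.-1) / ((Qq n.-1)^* * gamma n.-1 + (Qp n.-1)^*).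
Proof. by rewrite /path_pt /proj_ratio path_vec_last !cv2E. Qed.

(** A matrix of the class [su] preserves the unit circle, on which gamma_(n-1) lies: the numerator
    is gamma_(n-1) times the conjugate of the denominator. *)
Lemma path_pt_last_norm : path_pt n gamma n * (path_pt n gamma n)^* = 1.
Proof.
rewrite path_pt_last; set p := Qp _; set q := Qq _; set g := gamma _.
have gg : g * g^* = 1 by rewrite mul_conjE gamma_last.
have d0 : q^* * g + p^* != 0 := path_last_neq0.
have g0 : g != 0 by rewrite -nrm2_eq0 gamma_last oner_neq0.
have -> : p * g + q = g * (q^* * g + p^*)^*.
  rewrite rmorphD rmorphM/= !conjCK mulrDr mulrCA gg; ring.
move: (_ + p^*) d0 => d d0; have dJ0 : d^* != 0 by rewrite conjC_eq0.
rewrite fmorph_div rmorphM/= conjCK -[RHS]gg.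
by field; rewrite d0 dJ0.
Qed.

End Path.

(** * Fundamental solution *)

Section Exponential.
Variable R : realType.
Notation C := R[i].
Notation mu := (@lebesgue_measure R).
Notation I01 := (`[0%R, 1%R[%classic : set R).
Local Notation Re := (@complex.Re R).
Local Notation Im := (@complex.Im R).
Implicit Types (a c t : R) (z w : C).

(** Time stands still before a and after c. The clamped function is Lipschitz, hence a primitive,
    and its density is identified almost everywhere, the corners a and c being excluded. *)
Lemma is_prim_clamp (f f' : R -> R) a c : 0 <= a -> a <= c -> c <= 1 ->
  (forall x : R, is_derive x 1 f (f' x)) -> continuous f' ->
  is_prim (fun t => f (clamp 0 (c - a) (t - a)))
    (fun t => if a <= t < c then f' (clamp 0 (c - a) (t - a)) else 0).
Proof.
move=> a0 ac c1 df cf'; set th := fun t => clamp 0 (c - a) (t - a).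
have ca0 : 0 <= c - a by rewrite subr_ge0.
have th_itv t : 0 <= th t <= c - a by exact: clamp_itv.
have cf : continuous f.
  by move=> x; apply: differentiable_continuous; apply/derivable1_diffP; case: (df x).
have [L L0 f'L] : exists2 L, 0 <= L & forall x, 0 <= x <= c - a -> `|f' x| <= L.
  have cK : {within `[0, c - a], continuous (fun x => `|f' x|)}.
    by apply: continuous_subspaceT => x; apply: continuous_comp; [exact: cf'|exact: norm_continuous].
  have [m _ mP] := EVT_max ca0 cK; exists `|f' m| => //.
have Flip s t : 0 <= s -> s <= t -> t <= 1 -> `|f (th t) - f (th s)| <= L * (t - s).
  move=> _ st _; have tst : th s <= th t by rewrite le_clamp// lerB.
  have [x] := @MVT_segment _ f f' _ _ tst (fun x _ => df x) (continuous_subspaceT cf).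
  rewrite in_itv/= => /andP[sx xt] ->; rewrite normrM ler_pM//.
    apply: f'L; have /andP[h1 _] := th_itv s; have /andP[_ h2] := th_itv t.
    by rewrite (le_trans h1 sx) (le_trans xt).
  rewrite ger0_norm ?subr_ge0//; apply: le_trans (clamp_lip ca0 _) _; first exact: lerB.
  lra.
have [k pF bk] := lip_is_prim Flip; have [ik FE] := pF.
set k' := (X in is_prim _ X).
have mth : measurable_fun setT th by apply: measurable_maxr => //; apply: measurable_minr => //; exact: measurable_funB.
have ik' : intg k'.
  apply: (@intg_bounded _ _ L) => [|t _]; last first.
    by rewrite /k' /=; case: ifP => _; [exact: f'L (th_itv t)|rewrite normr0].
  apply: measurable_funTS; apply: measurable_fun_ifT => //.
    apply: measurable_and.
      exact: measurable_fun_ler.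
    exact: measurable_fun_ltr.
  apply: measurableT_comp => //; exact: continuous_measurable_fun.
split => // t t01; rewrite FE//; congr (_ + _); apply: ae_eq_prim => //.
apply: aeW01; apply: aeS (aeI (is_prim_deriv pF) (aeI (ae_neq a) (ae_neq c))).
move=> s [dF [sa sc]] s01; have {}dF := dF s01.
suff dF' : is_derive s 1 (fun t => f (th t)) (k' s).
  by rewrite -(@derive_val _ _ _ _ _ _ _ dF) -(@derive_val _ _ _ _ _ _ _ dF').
have [sla|] := ltP s a.
  rewrite /k' leNgt sla/=; apply: (near_eq_is_derive _ (is_derive_cst (f 0) s 1)).
  near=> u; rewrite /th /clamp (max_idPl _)// ge_min subr_le0 ltW//.
  by near: u; exact: lt_nbhsl.
rewrite le_eqVlt eq_sym (negPf sa)/= => las.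
have [scl|] := ltP s c; last first.
  rewrite le_eqVlt eq_sym (negPf sc)/= => lcs.
  rewrite /k' [s < c]ltNge (ltW lcs) andbF.
  apply: (near_eq_is_derive _ (is_derive_cst (f (c - a)) s 1)).
  near=> u; rewrite /th /clamp (min_idPr _) ?(max_idPr _)// lerB// ltW//.
  by near: u; exact: lt_nbhsr.
rewrite /k' (ltW las) scl/=.
have ths : th s = s - a by rewrite /th clamp_id// subr_ge0 (ltW las)/= lerB// ltW.
rewrite -/(th s) ths; apply: (near_eq_is_derive (f := f \o (fun u => u - a))).
  near=> u; rewrite /= /th clamp_id// subr_ge0; apply/andP; split.
    by apply/ltW; near: u; exact: lt_nbhsr.
  by rewrite lerB// ltW//; near: u; exact: lt_nbhsl.
rewrite -[f' _]mulr1; apply: is_derive1_comp.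
by apply: is_derive_eq; rewrite subr0.
Unshelve. all: by end_near. Qed.

Definition cexp z : C := (expR (Re z))%:C%C * cexpi (Im z).

Lemma cexpE z : cexp z = ((expR (Re z) * cos (Im z)) +i* (expR (Re z) * sin (Im z)))%C.
Proof. by apply: ceq; rewrite /cexp cE /= mul0r ?subr0 ?addr0. Qed.

Lemma cexpD z w : cexp (z + w) = cexp z * cexp w.
Proof.
rewrite !cexpE !cE expRD cosD sinD; apply: ceq; rewrite cE/=; ring.
Qed.

Lemma cexp0 : cexp 0 = 1.
Proof. by rewrite cexpE/= expR0 cos0 sin0 mulr0 mulr1. Qed.

Lemma cprim_cexp (m : C) a c : 0 <= a -> a <= c -> c <= 1 ->
  let th t := clamp 0 (c - a) (t - a) in
  cprim (fun t => cexp (m * (th t)%:C%C))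
    (fun t => if a <= t < c then m * cexp (m * (th t)%:C%C) else 0).
Proof.
move=> a0 ac c1 th; pose m1 := Re m; pose m2 := Im m.
pose f x := expR (m1 * x) * cos (m2 * x); pose g x := expR (m1 * x) * sin (m2 * x).
have df (x : R) : is_derive x 1 f (m1 * f x - m2 * g x).
  by apply: is_derive_eq; rewrite /GRing.scale/= /f /g; ring.
have dg (x : R) : is_derive x 1 g (m1 * g x + m2 * f x).
  by apply: is_derive_eq; rewrite /GRing.scale/= /f /g; ring.
have dc (h h' : R -> R) : (forall x : R, is_derive x 1 h (h' x)) -> continuous h.
  move=> dh x; apply: differentiable_continuous.
  by apply/derivable1_diffP; case: (dh x).
have cf := dc _ _ df; have cg := dc _ _ dg.
have E t : cexp (m * (th t)%:C%C) = (f (th t) +i* g (th t))%C.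
  by rewrite cexpE !cE /= !mulr0 subr0 add0r.
split.
  apply: eq_is_prim (is_prim_clamp a0 ac c1 df _) => [t _|t _|x].
  - by rewrite /comp E.
  - by rewrite /comp; case: ifP => //; rewrite E cE.
  apply: cvgB; apply: cvgM => //; first [exact: cvg_cst|exact: cf|exact: cg].
apply: eq_is_prim (is_prim_clamp a0 ac c1 dg _) => [t _|t _|x].
- by rewrite /comp E.
- by rewrite /comp; case: ifP => //; rewrite E cE.
apply: cvgD; apply: cvgM => //; first [exact: cvg_cst|exact: cf|exact: cg].
Qed.

End Exponential.

Section Fundamental.
Variable R : realType.
Notation C := R[i].
Notation mu := (@lebesgue_measure R).
Implicit Types (a c t : R) (p q z w v : C).

Definition su_adj p q : 'M[C]_2 :=
  (p * p^* - q * q^*)^-1 *: mx2 p^* (- q) (- q^*) p.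

Lemma su_det_neq0 p q : nrm2 q < nrm2 p -> p * p^* - q * q^* != 0.
Proof. by move=> qp; rewrite !mul_conjE -rmorphB fmorph_eq0 subr_eq0 gt_eqF. Qed.

Lemma su_adjE p q : nrm2 q < nrm2 p -> su_adj p q *m su p q = 1.
Proof.
move=> /su_det_neq0 D0; rewrite /su_adj /su -scalemxAl mx2_mul -mx2_1.
apply/matrixP; apply: ord2P; apply: ord2P; rewrite !mxE/=; field; rewrite D0//.
Qed.

(* Transfer matrix of an interval of length l on which b = q / p^*, for
   w = e^(izl/2) and v = e^(-izl/2). *)
Definition rot p q w v : 'M[C]_2 := su p q *m mx2 w 0 0 v *m su_adj p q.

Lemma rotE p q w v x y : rot p q w v *m cv2 x y =
  let D := p * p^* - q * q^* in
  cv2 (D^-1 * (p * (w * (p^* * x - q * y)) + q * (v * (p * y - q^* * x))))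
      (D^-1 * (q^* * (w * (p^* * x - q * y)) + p^* * (v * (p * y - q^* * x)))).
Proof.
rewrite /rot /su_adj /su -scalemxAr -scalemxAl -!mulmxA !mx2_cv2 /=.
by apply: cv2_eq; rewrite !mxE /=; ring.
Qed.

Lemma rot_su p q w v (u : 'cV[C]_2) : nrm2 q < nrm2 p ->
  rot p q w v *m (su p q *m u) = su p q *m (mx2 w 0 0 v *m u).
Proof.
by move=> h; rewrite /rot -!mulmxA (mulmxA (su_adj p q)) su_adjE// mul1mx.
Qed.

Lemma rot1 p q : nrm2 q < nrm2 p -> rot p q 1 1 = 1.
Proof.
move=> h; rewrite /rot mx2_1 -[1]/(1%:M) mulmx1; apply: mulmx1C; exact: su_adjE.
Qed.

(** Prolongs a solution from [0, a] to [0, c]. The given pair is constant after a, and [rot] is the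
    identity before a and constant after c, so a single product covers the three pieces. *)
Lemma rot_cprim p q z a c (b x y : R -> C) : nrm2 q < nrm2 p ->
  0 <= a -> a <= c -> c <= 1 -> (forall t, a <= t < c -> b t = q / p^*) ->
  cprim x (fun t => if t < a then z * ('i * W0 (b t) (x t) (y t)) else 0) ->
  cprim y (fun t => if t < a then z * (- 'i * W1 (b t) (x t) (y t)) else 0) ->
  let w t := cexp (z * 'i / 2 * (clamp 0 (c - a) (t - a))%:C%C) in
  let v t := cexp (- (z * 'i / 2) * (clamp 0 (c - a) (t - a))%:C%C) in
  let x' t := (rot p q (w t) (v t) *m cv2 (x t) (y t)) 0 0 in
  let y' t := (rot p q (w t) (v t) *m cv2 (x t) (y t)) 1 0 in
  cprim x' (fun t => if t < c then z * ('i * W0 (b t) (x' t) (y' t)) else 0) /\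
  cprim y' (fun t => if t < c then z * (- 'i * W1 (b t) (x' t) (y' t)) else 0).
Proof.
move=> qp a0 ac c1 bE; set dx := (X in cprim x X); set dy := (X in cprim y X) => px py w v x' y'.
have D0 := su_det_neq0 qp; set D := p * p^* - q * q^* in D0.
have pw : cprim w _ := cprim_cexp (z * 'i / 2) a0 ac c1.
have pv : cprim v _ := cprim_cexp (- (z * 'i / 2)) a0 ac c1.
set dw := (X in cprim w X) in pw; set dv := (X in cprim v X) in pv.
have th0 t : t < a -> w t = 1 /\ v t = 1.
  move=> ta; rewrite /w /v /clamp (max_idPl _) ?mulr0 ?cexp0//.
  by rewrite ge_min subr_le0 ltW.
have pA := cprimM pw (cprimD (cprimZ p^* px) (cprimZ (- q) py)).
have pB := cprimM pv (cprimD (cprimZ p py) (cprimZ (- q^*) px)).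
have x'E t : x' t = D^-1 * (p * (w t * (p^* * x t + - q * y t)) +
    q * (v t * (p * y t + - q^* * x t))).
  by rewrite /x' rotE cv20 -/D; ring.
have y'E t : y' t = D^-1 * (q^* * (w t * (p^* * x t + - q * y t)) +
    p^* * (v t * (p * y t + - q^* * x t))).
  by rewrite /y' rotE cv21 -/D; ring.
(* On [a, c) the new pair is Q applied to the two products in brackets, up to the factor 1/D, so
   [su_W] evaluates the weight. *)
have WE t : a <= t < c ->
    W0 (b t) (x' t) (y' t) = 2^-1 * D^-1 * (p * (w t * (p^* * x t + - q * y t)) -
       q * (v t * (p * y t + - q^* * x t))) /\
    W1 (b t) (x' t) (y' t) = - 2^-1 * D^-1 * (q^* * (w t * (p^* * x t + - q * y t)) -
       p^* * (v t * (p * y t + - q^* * x t))).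
  move=> tac; rewrite bE//.
  have [] := su_W (D^-1 * (w t * (p^* * x t + - q * y t)))
    (D^-1 * (v t * (p * y t + - q^* * x t))) qp.
  rewrite x'E y'E; move: (w t * _) (v t * _) => A B.
  rewrite !(mulrCA _ D^-1) -!(mulrDr D^-1) => -> ->; split; ring.
have x'lt t : t < a -> x' t = x t /\ y' t = y t.
  by move=> /th0[w1 v1]; rewrite /x' /y' w1 v1 rot1// mul1mx !cv2E.
split.
  apply: eq_cprim (cprimZ D^-1 (cprimD (cprimZ p pA) (cprimZ q pB))) => t t01.
    by rewrite x'E.
  rewrite /=; have [ta|at_] := ltP t a.
    have [w1 v1] := th0 _ ta; rewrite (lt_le_trans ta ac).
    have [-> ->] := x'lt _ ta; rewrite /dw /dv /dx /dy ta leNgt ta/= w1 v1 /D.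
    by field; rewrite D0.
  rewrite /dx /dy ltNge at_/= /dw /dv at_/= -/(w t) -/(v t); case: ifP => tc; last by ring.
  have [|-> _] := WE t; first by rewrite at_.
  by field.
apply: eq_cprim (cprimZ D^-1 (cprimD (cprimZ q^* pA) (cprimZ p^* pB))) => t t01.
  by rewrite y'E.
rewrite /=; have [ta|at_] := ltP t a.
  have [w1 v1] := th0 _ ta; rewrite (lt_le_trans ta ac).
  have [-> ->] := x'lt _ ta; rewrite /dw /dv /dx /dy ta leNgt ta/= w1 v1 /D.
  by field; rewrite D0.
rewrite /dx /dy ltNge at_/= /dw /dv at_/= -/(w t) -/(v t); case: ifP => tc; last by ring.
have [|_ ->] := WE t; first by rewrite at_.
by field.
Qed.

Variables (n : nat) (n_gt0 : (0 < n)%N) (gamma : nat -> C).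
Hypotheses (gamma_neq1 : forall k, (k < n)%N -> gamma k != 1)
  (gamma_lt1 : forall k, (k.+1 < n)%N -> nrm2 (gamma k) < 1)
  (gamma_last : nrm2 (gamma n.-1) = 1).

Let b := path_fun n gamma.
Notation p_ k := (Qp gamma k).
Notation q_ k := (Qq gamma k).

Lemma path_funE k t : k%:R / n%:R <= t < k.+1%:R / n%:R -> b t = path_pt n gamma k.
Proof.
have n0 : 0 < n%:R :> R by rewrite ltr0n.
move=> /andP[h1 h2]; rewrite /b /path_fun; congr path_pt; apply: truncn_def.
by rewrite mulrC -ler_pdivrMr// h1 -ltr_pdivlMr.
Qed.

(** e^(iz/(2n)), a square root of the spectral parameter: [rot] uses it together with its inverse,
    while the recursion sees its square. *)
Definition omega z : C := cexp (z * 'i / 2 * (n%:R^-1)%:C%C).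

Lemma omega_neq0 z : omega z != 0.
Proof.
apply/eqP => w0; have := cexpD (z * 'i / 2 * (n%:R^-1)%:C%C) (- (z * 'i / 2 * (n%:R^-1)%:C%C)).
by rewrite subrr cexp0 -/(omega z) w0 mul0r => /eqP; rewrite oner_eq0.
Qed.

Lemma omegaV z : cexp (- (z * 'i / 2) * (n%:R^-1)%:C%C) = (omega z)^-1.
Proof.
apply: (mulfI (omega_neq0 z)); rewrite divff ?omega_neq0// /omega -cexpD.
by rewrite mulNr subrr cexp0.
Qed.

Fixpoint monodromy z k : 'M[C]_2 :=
  if k is j.+1 then rot (p_ j) (q_ j) (omega z) (omega z)^-1 *m monodromy z j else 1.

(** The equation is switched off after k / n, so the solution is frozen there and its value at k / n
    is read off at 1. *)
Lemma fund_step z k (x0 y0 : C) : (k <= n)%N -> exists x y : R -> C, [/\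
  cprim x (fun t => if t < k%:R / n%:R then z * ('i * W0 (b t) (x t) (y t)) else 0),
  cprim y (fun t => if t < k%:R / n%:R then z * (- 'i * W1 (b t) (x t) (y t)) else 0),
  x 0 = x0, y 0 = y0 & cv2 (x 1) (y 1) = monodromy z k *m cv2 x0 y0].
Proof.
have n0 : 0 < n%:R :> R by rewrite ltr0n.
elim: k => [_|k IH kn].
  exists (cst x0), (cst y0); split => //; last by rewrite mul1mx.
    by apply: eq_cprim (cprim_cst x0) => // t /andP[t0 _]; rewrite mul0r ltNge t0.
  by apply: eq_cprim (cprim_cst y0) => // t /andP[t0 _]; rewrite mul0r ltNge t0.
have [x [y [px py x00 y00 E]]] := IH (ltnW kn).
have [QE qp] := QmxE gamma_neq1 gamma_lt1 kn.
set a := k%:R / n%:R in px py; set c := k.+1%:R / n%:R.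
have a0 : 0 <= a by rewrite divr_ge0.
have ac : a <= c by rewrite ler_pM2r ?invr_gt0// ler_nat.
have c1 : c <= 1 by rewrite ler_pdivrMr// mul1r ler_nat.
have ca : c - a = n%:R^-1 by rewrite /c /a -mulrBl -natrB// subSnn mul1r.
have bE t : a <= t < c -> b t = q_ k / (p_ k)^*.
  by move=> /path_funE ->; rewrite path_pt_lt.
have [px' py'] := rot_cprim qp a0 ac c1 bE px py.
pose w t := cexp (z * 'i / 2 * (clamp 0 (c - a) (t - a))%:C%C).
pose v t := cexp (- (z * 'i / 2) * (clamp 0 (c - a) (t - a))%:C%C).
pose X t := rot (p_ k) (q_ k) (w t) (v t) *m cv2 (x t) (y t).
exists (fun t => X t 0 0), (fun t => X t 1 0).
have w0 : w 0 = 1 /\ v 0 = 1.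
  rewrite /w /v /clamp (max_idPl _) ?mulr0 ?cexp0//.
  by rewrite ge_min subr_le0 a0.
have X0 : X 0 = cv2 x0 y0 by rewrite /X; have [-> ->] := w0; rewrite rot1// mul1mx x00 y00.
split; [exact: px'|exact: py'|by rewrite X0 cv20|by rewrite X0 cv21|].
have w1 : w 1 = omega z /\ v 1 = (omega z)^-1.
  rewrite /w /v /clamp (min_idPr _) ?lerB// (max_idPr _) ?subr_ge0//.
  by rewrite ca omegaV.
have -> : cv2 (X 1 0 0) (X 1 1 0) = X 1 by apply: cv2_eq; rewrite !cv2E.
by rewrite /X; have [-> ->] := w1; rewrite E /= mulmxA.
Qed.

(** diag(omega, 1/omega) is 1/omega times diag(omega^2, 1), and Q_k = Q_(k+1) Atilde_k: passing from
    the frame of one interval to the next supplies the matrix of the Szego step. The scalars collect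
    in omega^-k. *)
Lemma monodromy_psi z k : (k < n)%N ->
  monodromy z k *m cv2 1 1 = (omega z ^+ k)^-1 *: (su (p_ k) (q_ k) *m psi gamma (omega z ^+ 2) k).
Proof.
elim: k => [_|k IH kn].
  rewrite expr0 invr1 scale1r /=; congr (_ *m _).
  by have [<- _] := QmxE gamma_neq1 gamma_lt1 n_gt0; rewrite /Qmx big_ord0.
have kn' := ltn_trans (ltnSn k) kn.
have [QE qp] := QmxE gamma_neq1 gamma_lt1 kn'.
have [QE' _] := QmxE gamma_neq1 gamma_lt1 kn.
have [uA _ _ _] := Atilde_inv (gamma_neq1 kn') (gamma_lt1 kn).
have QA : su (p_ k) (q_ k) = su (p_ k.+1) (q_ k.+1) *m Atilde (gamma k).
  by rewrite -QE -QE' QmxS mulmxKV.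
rewrite [LHS]/= -mulmxA (IH kn') -scalemxAr (rot_su _ _ _ qp).
rewrite /= [su (p_ k.+1) _ *m _]mulmxA -QA [psi _ _ k](_ : _ = cv2 (psi gamma (omega z ^+ 2) k 0 0) (psi gamma (omega z ^+ 2) k 1 0)); last first.
  by apply: cv2_eq; rewrite !cv2E.
rewrite !cv2E mx2_cv2 !scalemxAr; congr (_ *m _).
have w0 := omega_neq0 z; have wk := expf_neq0 k w0.
by apply: cv2_eq; rewrite !mxE /= [_ ^+ k.+1]exprS; field; rewrite w0 wk.
Qed.

(** No change of frame follows the last interval. As (b(1), 1) is proportional to Q_(n-1)
    (gamma_(n-1), 1), removing the invertible Q_(n-1) turns the end condition into parallelism of
    (omega^2 u_0, u_1) and (gamma_(n-1), 1). *)
Lemma monodromy_last z (g := gamma n.-1) (u := psi gamma (omega z ^+ 2) n.-1)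
   (X := monodromy z n *m cv2 1 1) :
  X 0 0 - b 1 * X 1 0 = 0 <-> omega z ^+ 2 * u 0 0 = g * u 1 0.
Proof.
have nn : (n.-1 < n)%N by rewrite prednK.
have [QE qp] := QmxE gamma_neq1 gamma_lt1 nn.
have w0 := omega_neq0 z; have wk := expf_neq0 n w0.
have XE : X = (omega z ^+ n)^-1 *: (su (p_ n.-1) (q_ n.-1) *m cv2 (omega z ^+ 2 * u 0 0) (u 1 0)).
  have MS : monodromy z n.-1.+1 = rot (p_ n.-1) (q_ n.-1) (omega z) (omega z)^-1 *m monodromy z n.-1 by [].
  rewrite prednK// in MS; rewrite /X MS -mulmxA (monodromy_psi _ nn) -scalemxAr (rot_su _ _ _ qp) -/u.
  rewrite [u](_ : _ = cv2 (u 0 0) (u 1 0)); last by apply: cv2_eq; rewrite !cv2E.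
  rewrite !cv2E mx2_cv2 !scalemxAr; congr (_ *m _).
  have wk' := expf_neq0 n.-1 w0.
  have -> : omega z ^+ n = omega z * omega z ^+ n.-1 by rewrite -exprS prednK.
  by apply: cv2_eq; rewrite !mxE /=; field; rewrite w0 wk'.
have b1 : b 1 = path_pt n gamma n.
  by rewrite /b /path_fun mulr1; congr path_pt; apply: truncn_def; rewrite lexx ltr_nat ltnSn.
have d0 := path_last_neq0 n_gt0 gamma_neq1 gamma_lt1 gamma_last.
rewrite mx2_cv2 in XE; rewrite b1 (path_pt_last n_gt0 gamma_neq1 gamma_lt1) XE !mxE/=.
have D0 := su_det_neq0 qp; move: (omega z ^+ n) wk => W W0.
move: (p_ n.-1) (q_ n.-1) (_ * u 0 0) (u 1 0) d0 D0; rewrite -/g => p q s t d0 D0.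
have -> : W^-1 * (p * s + q * t) - (p * g + q) / (q^* * g + p^*) *
    (W^-1 * (q^* * s + p^* * t)) =
    W^-1 * (p * p^* - q * q^*) / (q^* * g + p^*) * (s - g * t).
  by field; rewrite W0 d0.
split => [/eqP|->]; last by rewrite subrr mulr0.
by rewrite !mulf_eq0 !invr_eq0 (negPf W0) (negPf D0) (negPf d0) /= subr_eq0 => /eqP.
Qed.

Lemma fund_path z : exists y00 y10 y01 y11 : R -> C,
  [/\ dirac_solution b z y00 y10, dirac_solution b z y01 y11,
    [/\ y00 0 = 1, y10 0 = 0, y01 0 = 0 & y11 0 = 1] &
    y00 1 + y01 1 - b 1 * (y10 1 + y11 1) = 0 <->
    omega z ^+ 2 * psi gamma (omega z ^+ 2) n.-1 0 0 =
      gamma n.-1 * psi gamma (omega z ^+ 2) n.-1 1 0].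
Proof.
have [y00 [y10 [p00 p10 e00 e10 E0]]] := fund_step z 1 0 (leqnn n).
have [y01 [y11 [p01 p11 e01 e11 E1]]] := fund_step z 0 1 (leqnn n).
have nn : n%:R / n%:R = 1 :> R by rewrite divff// pnatr_eq0 -lt0n.
exists y00, y10, y01, y11; split => //.
- by split; [apply: eq_cprim p00|apply: eq_cprim p10] => // t /andP[_ t1]; rewrite nn t1.
- by split; [apply: eq_cprim p01|apply: eq_cprim p11] => // t /andP[_ t1]; rewrite nn t1.
rewrite -monodromy_last.
have <- : cv2 (y00 1) (y10 1) + cv2 (y01 1) (y11 1) = monodromy z n *m cv2 1 1.
  rewrite E0 E1 -mulmxDr; congr (_ *m _).
  by apply: cv2_eq; rewrite !mxE /= ?addr0 ?add0r.
by rewrite !mxE.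
Qed.

End Fundamental.

(** * The eigenvalue equation *)

Section Periodicity.
Variable R : realType.
Notation C := R[i].
Implicit Types (u v : R) (z : C).

Lemma cexpiD u v : cexpi (u + v) = cexpi u * cexpi v :> C.
Proof. by apply: ceq; rewrite /cexpi !cE/= ?cosD ?sinD; ring. Qed.

Lemma cexpi0 : cexpi 0 = 1 :> C.
Proof. by rewrite /cexpi cos0 sin0. Qed.

Lemma nrm2_cexpi u : nrm2 (cexpi u) = 1.
Proof. by rewrite /nrm2/= cos2Dsin2. Qed.

Lemma cexpi_period (j : int) : cexpi (2 * pi * j%:~R) = 1 :> C.
Proof.
have c2 : cexpi (2 * pi) = 1 :> C.
  by apply: ceq; rewrite /cexpi mulrC mulr_natr ?cos2pi ?sin2pi.
have cn (m : nat) : cexpi (2 * pi * m%:R) = 1 :> C.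
  elim: m => [|m IH]; first by rewrite mulr0 cexpi0.
  by rewrite -[m.+1]addn1 natrD mulrDr cexpiD IH mul1r mulr1.
case: j => m; first exact: cn.
have := cexpiD (2 * pi * m.+1%:R) (2 * pi * (Negz m)%:~R).
by rewrite -mulrDr NegzE mulrNz subrr mulr0 cexpi0 cn mul1r.
Qed.

(** The remainder v modulo 2 pi lies in [0, 2 pi) and satisfies 1 = cos v = 1 - 2 sin(v/2)^2,
    whereas sin(v/2) > 0 for v > 0. *)
Lemma cexpi_eq1 u : cexpi u = 1 :> C -> exists j : int, u = 2 * pi * j%:~R.
Proof.
move=> u1; have p0 := pi_gt0 R; have p20 : 0 < 2 * pi :> R by rewrite mulr_gt0.
pose j := Num.floor (u / (2 * pi)); exists j; pose v := u - 2 * pi * j%:~R.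
have v1 : cexpi v = 1 :> C.
  by have := cexpiD (u - 2 * pi * j%:~R) (2 * pi * j%:~R); rewrite subrK u1 cexpi_period mulr1.
have /andP[f1 f2] : j%:~R <= u / (2 * pi) < (j + 1)%:~R by exact: floor_itv.
have v0 : 0 <= v by rewrite /v subr_ge0 mulrC -ler_pdivlMr.
have v2 : v < 2 * pi.
  move: f2; rewrite ltr_pdivrMr// intrD mulrDl mul1r /v => f2; lra.
suff : v = 0 by rewrite /v => /eqP; rewrite subr_eq0 => /eqP.
apply/eqP; rewrite eq_le v0 andbT leNgt; apply/negP => vp.
have s0 : 0 < sin (v / 2) by apply: sin_gt0_pi; lra.
have : cos v = 1 by move/(congr1 (@complex.Re R)): v1.
have -> : v = v / 2 + v / 2 by lra.
rewrite cosD; have := cos2Dsin2 (v / 2); nra.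
Qed.

Lemma cexpi_inj_mod u v : cexpi u = cexpi v :> C <-> exists j : int, u = v + 2 * pi * j%:~R.
Proof.
split => [uv|[j ->]]; last by rewrite cexpiD cexpi_period mulr1.
have : cexpi (u - v) = 1 :> C.
  by rewrite cexpiD uv -cexpiD subrr cexpi0.
by move=> /cexpi_eq1[j jE]; exists j; rewrite -jE addrC subrK.
Qed.

Variables (n : nat) (n_gt0 : (0 < n)%N).

Lemma omega_sqrE z : omega n z ^+ 2 =
  (expR (- (complex.Im z) / n%:R))%:C%C * cexpi (complex.Re z / n%:R).
Proof.
rewrite /omega expr2 -cexpD -mulrDl -splitr /cexp; congr ((expR _)%:C%C * cexpi _);
  by rewrite !cE/=; ring.
Qed.

(** Comparing moduli forces Im z = 0, after which only the periodicity of the exponential is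
    left. *)
Lemma omega_eigen (l : R) z : omega n z ^+ 2 = cexpi l <->
  exists j : int, z = (n%:R * l + 2 * pi * n%:R * j%:~R)%:C%C.
Proof.
have n0 : n%:R != 0 :> R by rewrite pnatr_eq0 -lt0n.
rewrite omega_sqrE; split => [E|[j ->]]; last first.
  rewrite /= oppr0 mul0r expR0 mul1r; apply/cexpi_inj_mod; exists j.
  by field.
have z0 : complex.Im z = 0.
  have := congr1 (@nrm2 R) E; rewrite nrm2M !nrm2_cexpi mulr1 /nrm2/= expr0n addr0.
  rewrite -expRM_natl => e1; have /eqP : 2%:R * (- complex.Im z / n%:R) = 0.
    by apply: expR_inj; rewrite expR0.
  by rewrite mulf_eq0 pnatr_eq0/= mulf_eq0 invr_eq0 (negPf n0) orbF oppr_eq0 => /eqP.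
move: E; rewrite z0 oppr0 mul0r expR0 mul1r => /cexpi_inj_mod[j jE]; exists j.
apply: ceq => //=; rewrite -[LHS](divfK n0) jE; ring.
Qed.

End Periodicity.

(** * Measurability and bounds of the path *)

Section PathFun.
Variable R : realType.
Notation C := R[i].
Notation I01 := (`[0%R, 1%R[%classic : set R).
Variables (n : nat) (n_gt0 : (0 < n)%N) (gamma : nat -> C).
Implicit Type t : R.

Lemma truncn_lt t : 0 <= t < 1 -> (Num.truncn (n%:R * t) < n)%N.
Proof.
move=> /andP[t0 t1]; have n0 : 0 < n%:R :> R by rewrite ltr0n.
have nt0 : 0 <= n%:R * t by rewrite mulr_ge0.
have /andP[h _] := truncn_itv nt0; rewrite -(@ltr_nat R) (le_lt_trans h)//.
by rewrite gtr_pMr.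
Qed.

(** [phi] can be arbitrary because the composition is a finite combination of indicators of
    intervals. *)
Lemma path_fun_measurable (phi : C -> R) : measurable_fun I01 (phi \o path_fun n gamma).
Proof.
have n0 : 0 < n%:R :> R by rewrite ltr0n.
apply: (@eq_measurable_fun _ _ _ _ _ (fun t => \sum_(k < n)
    if k%:R / n%:R <= t < k.+1%:R / n%:R then phi (path_pt n gamma k) else 0)).
  move=> t; rewrite inE/= in_itv/= => t01; have tn := truncn_lt t01.
  have /andP[t0 _] := t01; have nt0 : 0 <= n%:R * t by rewrite mulr_ge0.
  rewrite (bigD1 (Ordinal tn))//= [X in _ + X]big1 => [|k kt].
    have /andP[h1 h2] := truncn_itv nt0.
    by rewrite addr0 ler_pdivrMr// ltr_pdivlMr// [t * _]mulrC h1 h2.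
  rewrite ler_pdivrMr// ltr_pdivlMr// [t * _]mulrC; case: ifP => // /truncn_def E.
  by case/eqP: kt; apply: val_inj; rewrite /= E.
apply: measurable_funTS; apply: measurable_sum => k; apply: measurable_fun_ifT => //.
apply: measurable_and; first exact: measurable_fun_ler.
exact: measurable_fun_ltr.
Qed.

Lemma path_fun1 : path_fun n gamma 1 = path_pt n gamma n.
Proof.
rewrite /path_fun mulr1; congr path_pt; apply: truncn_def.
by rewrite lexx ltr_nat ltnSn.
Qed.

(** Only finitely many values are taken before time 1, so their largest squared modulus is a uniform
    bound, although b(1) lies on the unit circle. *)
Lemma path_fun_bound : (forall k, (k < n)%N -> nrm2 (path_pt n gamma k) < 1) ->
  exists2 rho, rho < 1 & forall t, 0 <= t < 1 -> nrm2 (path_fun n gamma t) <= rho.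
Proof.
move=> H; exists (\big[Num.max/0]_(k < n) nrm2 (path_pt n gamma k)).
  by apply: bigmax_lt => // k _; exact: H.
move=> t /truncn_lt tn.
exact: (le_bigmax 0 (fun k : 'I_n => nrm2 (path_pt n gamma k)) (Ordinal tn)).
Qed.

Lemma norm_lt1 (c : C) : (`|c| < 1) = (nrm2 c < 1).
Proof.
by rewrite -(@ltr_pXn2r _ 2)// ?nnegrE ?normr_ge0 ?ler01// nrm2E expr1n ltcR.
Qed.

Lemma norm_eq1 (c : C) : c * c^* = 1 -> `|c| = 1.
Proof. by rewrite -normCK => /eqP; rewrite pexpr_eq1// => /eqP. Qed.

End PathFun.

Theorem proposition17 (R : realType) (n : nat) (n_gt0 : (0 < n)%N)
  (V : 'M[R[i]]_n) (V_unitary : V \is unitarymx)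
  (lam : 'I_n -> R)
  (eigen_distinct : injective (fun k => cexpi (lam k)))
  (eigen_V : forall z : R[i], eigenvalue V z <-> exists k, z = cexpi (lam k))
  (eigen_neq1 : ~~ eigenvalue V 1)
  (e : 'cV[R[i]]_n) (e_unit : vdot e e = 1)
  (e_cyclic : forall (z : R[i]) (v : 'cV[R[i]]_n),
     v != 0 -> V *m v = z *: v -> vdot v e != 0)
  (gamma : nat -> R[i]) (gammaP : deformed_verblunsky V e gamma) :
  let b := path_fun n gamma in
  let T := dirac_op b (cv2 1 1) (cv2 (b 1) 1) in
  (* the matrices, inverses and quotients defining b make sense *)
  [/\ forall k, (k < n)%N -> gamma k != 1,
      forall k, (k.+1 < n)%N -> Atilde (gamma k) \in unitmx
    & forall k, (k <= n)%N -> path_vec n gamma k 1 0 != 0] /\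
  [/\ forall t : R, 0 <= t < 1 -> `|b t| < 1,
      `|b 1| = 1,
      self_adjoint b T
    & spectrum b T =
      [set z : R[i] | exists (k : 'I_n) (j : int),
         z = (n%:R * lam k + 2 * pi * n%:R * j%:~R)%:C%C]].
Proof.
move=> b T; have [alpha alphaP gammaE] := gammaP.
have g1 := gamma_neq1 n_gt0 V_unitary eigen_distinct eigen_V eigen_neq1 e_cyclic alphaP gammaE.
have glt := gamma_lt1 n_gt0 V_unitary eigen_distinct eigen_V e_cyclic alphaP gammaE.
have glast := gamma_last n_gt0 V_unitary eigen_distinct eigen_V e_cyclic alphaP gammaE.
have eig := eigenvalue_psi n_gt0 V_unitary eigen_distinct eigen_V eigen_neq1 e_cyclic alphaP gammaE.
have blt t : 0 <= t < 1 -> nrm2 (b t) < 1.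
  by move=> /(truncn_lt n_gt0) tn; exact: path_pt_nrm2 g1 glt _ tn.
have b1 : b 1 * (b 1)^* = 1.
  by rewrite /b path_fun1; exact: path_pt_last_norm.
have [rho rho1 b_rho] := path_fun_bound n_gt0 (path_pt_nrm2 g1 glt).
set S := [set z | _].
(* Membership in S says that e^(iz/n), the square of omega, is one of the numbers e^(i lam_k). *)
have SE z : S z <-> eigenvalue V (omega n z ^+ 2).
  rewrite eigen_V; split=> [[k /(omega_eigen n_gt0) zk]|[k zk]]; first by exists k.
  by exists k; apply/(omega_eigen n_gt0).
have Sfund z : exists y00 y10 y01 y11 : R -> R[i],
  [/\ dirac_solution b z y00 y10, dirac_solution b z y01 y11,
    [/\ y00 0 = 1, y10 0 = 0, y01 0 = 0 & y11 0 = 1] &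
    y00 1 + y01 1 - b 1 * (y10 1 + y11 1) = 0 <-> S z].
  have [y00 [y10 [y01 [y11 [h1 h2 h3 h4]]]]] := fund_path n_gt0 g1 glt glast z.
  by exists y00, y10, y01, y11; split => //; rewrite h4 SE eig.
(* At z = 0 the spectral parameter is 1, which is not an eigenvalue of V. *)
have S0 : ~ S 0.
  by rewrite SE /omega !mul0r cexp0 expr1n; exact/negP.
have Sreal z : S z -> z^* = z.
  by move=> [k [j ->]]; apply: ceq; rewrite cE/= ?oppr0.
have mb := path_fun_measurable n_gt0 gamma.
split; split => //.
- by move=> k kn; have [] := Atilde_inv (g1 k (ltnW kn)) (glt k kn).
- move=> k; rewrite leq_eqVlt => /predU1P[->|kn].
    by rewrite path_vec_last// cv21 path_last_neq0.
  by rewrite path_vec_lt// cv21 conjC_eq0 (Qp_neq0 g1 glt).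
- by move=> t t01; rewrite norm_lt1 blt.
- exact: norm_eq1.
- exact (dirac_self_adjoint mb rho1 b_rho b1 S0 Sfund).
- exact (dirac_spectrum mb rho1 b_rho b1 Sreal Sfund).
Qed.
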